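(* For $n\in\mathbb N$ and $1\le i\le n$ let $\mathbf X_{i,n}=(X^{(1)}_{i,n},X^{(2)}_{i,n})$ be bivariate Gaussian random vectors, independent within each row $n$, such that $X^{(1)}_{i,n}$ and $X^{(2)}_{i,n}$ are standard normal with correlation $\rho_{i,n}$. Let $b_n$ be the solution of $b_n=n\phi(b_n)$, $\phi$ the standard normal density, and let $$\nu_n=\frac1n\sum_{i=1}^n\delta_{\sqrt{b_n^2(1-\rho_{i,n})/2}},$$ a probability measure on $[0,\infty]$. For $\nu\in\mathcal M_1([0,\infty])$ define the distribution function $F_\nu$ by $$-\log F_\nu(x,y)=\int_{[0,\infty]}\left[\Phi\Big(\lambda+\frac{y-x}{2\lambda}\Big)e^{-x}+\Phi\Big(\lambda+\frac{x-y}{2\lambda}\Big)e^{-y}\right]\nu(d\lambda),\qquad x,y\in\mathbb R.$$ Then: (i) As $n\to\infty$, the normalized componentwise maximum $\max_{i=1,\dots,n}b_n(\mathbf X_{i,n}-b_n)$ converges in distribution if and only if $\nu_n$ converges weakly to some probability measure $\nu$ on $[0,\infty]$. In this case the limit has distribution function $F_\nu$. (ii) $F_\nu$ uniquely determines $\nu$: if $\nu,\tilde\nu\in\mathcal M_1([0,\infty])$ and $\nu\ne\tilde\nu$, then $F_\nu\neq F_{\tilde\nu}$. (iii) $F_\nu$ depends continuously on $\nu$: if $\mu_n,\nu\in\mathcal M_1([0,\infty])$ and $\mu_n$ converges weakly to $\nu$ as $n\to\infty$, then $F_{\mu_n}$ converges pointwise to $F_\nu$.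
   Context: $\Phi$ is the standard normal distribution function. $\delta_a$ is the Dirac measure at $a$. $[0,\infty]$ carries the metric $d(x,y)=|e^{-x}-e^{-y}|$ (with $e^{-\infty}=0$), which makes it compact; $\mathcal M_1([0,\infty])$ is the space of Borel probability measures on it with the topology of weak convergence. Operations between a vector and the scalar $b_n$, and the maximum of vectors, are componentwise. The integrand in $-\log F_\nu$ at $\lambda=0$ and $\lambda=\infty$ is understood as its limit, i.e. it equals $e^{-\min(x,y)}$ at $\lambda=0$ and $e^{-x}+e^{-y}$ at $\lambda=\infty$. *)

(* Defs.v *)
From HB Require Import structures.
From mathcomp Require Import all_boot all_order all_algebra.
From mathcomp Require Import all_classical all_reals all_analysis.
From mathcomp Require Import measurable_realfun.

Set Implicit Arguments.
Unset Strict Implicit.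
Unset Printing Implicit Defensive.

Import Order.TTheory GRing.Theory Num.Theory.
Import numFieldNormedType.Exports.

Local Open Scope classical_set_scope.
Local Open Scope ring_scope.

Record extnng (R : realType) := ExtNng {
  extnng_val : \bar R ;
  extnng_ge0 : (0 <= extnng_val)%E }.

Section extnng_structures.
Variable R : realType.

HB.instance Definition _ := [isSub for @extnng_val R].
HB.instance Definition _ := [Choice of extnng R by <:].

Definition extnng_fin (r : R) (r0 : 0 <= r) : extnng R := @ExtNng R r%:E r0.

HB.instance Definition _ := isPointed.Build (extnng R) (extnng_fin (lexx 0)).

Definition expN_extnng (x : extnng R) : R :=
  if extnng_val x is r%:E then expR (- r) else 0.

Definition dist_extnng (x y : extnng R) : R :=
  `|expN_extnng x - expN_extnng y|.

Lemma expN_extnng_inj : injective expN_extnng.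
Proof.
move=> [[r| |] r0] [[s| |] s0]; rewrite /expN_extnng //=.
- by move=> /expR_inj/oppr_inj rs; apply: val_inj => /=; rewrite rs.
- by move=> rs; have := expR_gt0 (- r); rewrite rs ltxx.
- by move=> rs; have := expR_gt0 (- s); rewrite -rs ltxx.
- by move=> _; apply: val_inj.
Qed.

Let dist_xx x : dist_extnng x x = 0.
Proof. by rewrite /dist_extnng subrr normr0. Qed.

Let dist_positivity x y : dist_extnng x y = 0 -> x = y.
Proof. by move/eqP; rewrite normr_eq0 subr_eq0 => /eqP/expN_extnng_inj. Qed.

Let dist_sym x y : dist_extnng x y = dist_extnng y x.
Proof. exact: distrC. Qed.

Let dist_triangle y x z :
  dist_extnng x z <= dist_extnng x y + dist_extnng y z.
Proof. exact: ler_distD. Qed.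

HB.instance Definition _ := isMetric.Build R (extnng R)
  dist_xx dist_positivity dist_sym dist_triangle.

Let borel_extnng : set_system (extnng R) := <<s @open (extnng R) >>.

Let borel0 : borel_extnng set0. Proof. exact: sigma_algebra0. Qed.

Let borelC A : borel_extnng A -> borel_extnng (~` A).
Proof. exact: sigma_algebraC. Qed.

Let borel_bigcup (F : (set (extnng R))^nat) :
  (forall i, borel_extnng (F i)) -> borel_extnng (\bigcup_i F i).
Proof. exact: sigma_algebra_bigcup. Qed.

HB.instance Definition _ := @isMeasurable.Build default_measure_display
  (extnng R) borel_extnng borel0 borelC borel_bigcup.

End extnng_structures.

(* The structure only joins its two parents and does not require the
   sigma-algebra to be the Borel one; on R, R * R and extnng R it is. *)
#[short(type="topMeasurableType")]
HB.structure Definition TopMeasurable d := {T of Measurable d T & Topological T}.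

HB.instance Definition _ (R : realType) := Measurable.on (Real.sort R).

HB.instance Definition _ (d1 d2 : measure_display) (T1 : topMeasurableType d1)
  (T2 : topMeasurableType d2) := Measurable.on (T1 * T2)%type.

HB.instance Definition _ (R : realType) := Measurable.on (extnng R).

Definition weak_cvg (d : measure_display) (T : topMeasurableType d)
    (R : realType) (mu_ : nat -> probability T R) (mu : probability T R) :=
  forall f : T -> R, continuous f -> [bounded f x | x in setT] ->
    (\int[mu_ n]_x f x) @[n --> \oo] --> \int[mu]_x f x.

Section random_vectors.
Context (d : measure_display) (T : measurableType d) (R : realType).
Variable P : probability T R.
Implicit Type X : T -> R * R.

Definition standard_normal (Y : T -> R) :=
  forall A : set R, measurable A -> P (Y @^-1` A) = normal_prob 0 1 A.

(* X has the law of m + A Z, with Z a pair of independent standard normal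
   variables; A may be singular, so that correlations 1 and -1 are included. *)
Definition bivariate_gaussian X :=
  exists m1 m2 a11 a12 a21 a22 : R,
  forall B : set (R * R), measurable B ->
    P (X @^-1` B) =
    (normal_prob 0 1 \x normal_prob 0 1)%E
      [set z | B (m1 + a11 * z.1 + a12 * z.2, m2 + a21 * z.1 + a22 * z.2)].

Definition correlation (Y Z : T -> R) : R :=
  fine (covariance P Y Z) / Num.sqrt (fine 'V_P[Y] * fine 'V_P[Z]).

Definition mutually_independent n (X : 'I_n -> T -> R * R) :=
  forall (J : {set 'I_n}) (B : 'I_n -> set (R * R)),
    (forall i, measurable (B i)) ->
    P (\bigcap_(i in [set` J]) (X i @^-1` B i)) =
    (\prod_(i in J) P (X i @^-1` B i))%E.

End random_vectors.

Definition maxord (R : realType) n (f : 'I_n.+1 -> R) : R :=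
  \big[Num.max/f ord0]_(i < n.+1) f i.

Definition normalized_max (d : measure_display) (T : measurableType d)
    (R : realType) (n : nat) (b : R) (X : 'I_n.+1 -> {mfun T >-> (R * R)%type}) :
    T -> R * R :=
  fun w => (maxord (fun i => b * ((X i w).1 - b)),
            maxord (fun i => b * ((X i w).2 - b))).

Lemma measurable_maxord (d : measure_display) (T : measurableType d)
    (R : realType) (n : nat) (f : 'I_n.+1 -> T -> R) :
  (forall i, measurable_fun setT (f i)) ->
  measurable_fun setT (fun w => maxord (f^~ w)).
Proof.
move=> mf; rewrite /maxord.
elim: (index_enum _) => [|i s ih].
  by under eq_fun do rewrite big_nil; exact: mf.
under eq_fun do rewrite big_cons.
exact: measurable_maxr.
Qed.

Section normalized_max_measurable.
Context (d : measure_display) (T : measurableType d) (R : realType).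
Context (n : nat) (b : R) (X : 'I_n.+1 -> {mfun T >-> (R * R)%type}).

Let measurable_normalized_max : measurable_fun setT (normalized_max b X).
Proof.
apply/measurable_fun_pairP; split; apply: measurable_maxord => i;
  apply: measurable_funM => //; apply: measurable_funB => //;
  apply: measurableT_comp => //.
Qed.

HB.instance Definition _ := isMeasurableFun.Build _ _ _ _ (normalized_max b X)
  measurable_normalized_max.

End normalized_max_measurable.

Section empirical.
Context (d : measure_display) (T : measurableType d) (R : realType).
Context (n : nat) (l : 'I_n.+1 -> T).

Definition empirical (A : set T) : \bar R :=
  ((n.+1%:R^-1)%:E * \sum_(i < n.+1) \d_(l i) A)%E.

Let empiricalE :
  empirical = mscale (n.+1%:R^-1)%:nng
    (msum (fun k => \d_(l (inord k))) n.+1) :> (set T -> \bar R).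
Proof.
apply/funext => A; rewrite /empirical /mscale /msum/=; congr (_ * _)%E.
by apply: eq_bigr => i _; rewrite inord_val.
Qed.

Let empirical0 : empirical set0 = 0%E.
Proof. by rewrite empiricalE measure0. Qed.

Let empirical_ge0 A : (0 <= empirical A)%E.
Proof. by rewrite empiricalE measure_ge0. Qed.

Let empirical_sigma_additive : semi_sigma_additive empirical.
Proof. by rewrite empiricalE; exact: measure_semi_sigma_additive. Qed.

HB.instance Definition _ := isMeasure.Build _ _ _ empirical
  empirical0 empirical_ge0 empirical_sigma_additive.

Let empirical_setT : empirical setT = 1%E.
Proof.
rewrite /empirical; under eq_bigr do rewrite diracT.
rewrite sumEFin sumr_const card_ord -EFinM mulVf//.
Qed.

HB.instance Definition _ := Measure_isProbability.Build _ _ _ empirical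
  empirical_setT.

End empirical.

Section limit_distribution.
Context (R : realType).

Definition Phi (x : R) : R := fine (normal_prob 0 1 `]-oo, x]).

(* The values at l = 0 and l = +oo are the limits of the generic expression. *)
Definition F_integrand (x y : R) (l : extnng R) : R :=
  if extnng_val l is r%:E then
    if r == 0 then expR (- Num.min x y)
    else Phi (r + (y - x) / (2 * r)) * expR (- x) +
         Phi (r + (x - y) / (2 * r)) * expR (- y)
  else expR (- x) + expR (- y).

Definition F_ (nu : probability (extnng R) R) (x y : R) : R :=
  expR (- \int[nu]_l F_integrand x y l).

Definition lambda (b rho : R) : extnng R :=
  extnng_fin (sqrtr_ge0 (b ^+ 2 * (1 - rho) / 2)).

End limit_distribution.

(* Main.v *)
(* Let Z be standard normal and let W = lognormal l Z be the likelihood ratio of N(2l, 1) to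
   N(0, 1), with W = 0 for l = oo. The integrand of -log F_nu(x, y) is
   exp(-x) + exp(-y) - E[min(exp(-x), exp(-y) W)].

   Row maxima: n P(X_1 > b + x/b, X_2 > b + y/b) is asymptotic to E[min(exp(-x), exp(-y) W)] with
   l = lambda, uniformly in the correlation because [0, oo] is compact; hence the distribution
   function of the maximum differs from F_{nu_n} by o(1).

   Uniqueness: F_nu determines the law of W, and testing it with
   sqrt(w) (ln w)^(2k) exp(-(ln w)^2 / 8) gives the moments of l^2 / (1 + l^2) under a measure
   equivalent to nu on [0, oo[, hence nu.

   Existence: F_nu is a distribution function, realised by two exponential variables and an
   explicit conditional quantile; and every ultrafilter on the indices gives a limit of nu_n, with
   F of it equal to the limit law, so by uniqueness all these limits agree and nu_n converges. *)
Require Import Defs.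
From HB Require Import structures.
From mathcomp Require Import all_boot all_order all_algebra.
From mathcomp Require Import all_classical all_reals all_analysis.
From mathcomp Require Import measurable_realfun giry ring lra.

Import Order.TTheory GRing.Theory Num.Theory.
Import numFieldNormedType.Exports.

Local Open Scope classical_set_scope.
Local Open Scope ring_scope.

Set Implicit Arguments.
Unset Strict Implicit.

(** * Integrals of bounded functions *)

(** Write a pair as [(Z1, rho Z1 + sqrt(1 - rho^2) Z2)] and fix [Z2 = z]: for positive [rho] the
    joint exceedance becomes one exceedance of [Z1], at a level depending on [z]. Since
    [b = n phi(b)], its scaled probability tends to [exp(-level)]. A finite limit [l] of lambda
    forces [rho] to 1 and the level to [max(x, 2 l^2 + y - 2 l z)], whence the minimum with [W]. At
    l = oo the correlation is not controlled, and a separate bound takes over. In the uniqueness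
    proof the Gaussian damping of the test functions is essential: without it the moments would be
    those of [l^2], on an unbounded range where polynomials do not approximate uniformly. A limit
    law has to be exhibited before convergence of the maxima can be stated; this is why [F_nu] is
    realised as a distribution function, a construction that rests on [E[W] <= 1]. Ultrafilters
    replace the choice of subsequences: all quantile functions converge pointwise at once. Dominated
    convergence is a statement about sequences and is lost; Riemann sums of monotone functions, with
    an error independent of the function, do its work. *)

Lemma integral_indicT d (T : measurableType d) (R : realType) (mu : {measure set T -> \bar R})
  (A : set T) : measurable A -> (\int[mu]_x (\1_A x)%:E = mu A)%E.
Proof. by move=> mA; rewrite integral_indic// setIT. Qed.

Section bounded_integrals.
Context d (T : measurableType d) (R : realType) (P : probability T R).

Lemma bounded_integrable (f : T -> R) (M : R) :
  measurable_fun setT f -> (forall x, `|f x| <= M) ->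
  P.-integrable setT (EFin \o f).
Proof.
move=> mf fM; apply: measurable_bounded_integrable => //.
  by rewrite -ge0_fin_numE// fin_num_measure.
by exists M; split; [exact: num_real|move=> N MN x _; exact: le_trans (ltW MN)].
Qed.

Lemma bounded_cvg_Rintegral (f_ : nat -> T -> R) (f : T -> R) (M : R) :
  (forall n, measurable_fun setT (f_ n)) ->
  (forall x, f_ n x @[n --> \oo] --> f x) ->
  (forall n x, `|f_ n x| <= M) ->
  (\int[P]_x f_ n x) @[n --> \oo] --> \int[P]_x f x.
Proof.
move=> mf_ f_f fM.
have mf : measurable_fun setT f by apply: (measurable_fun_cvg mf_) => x _; exact: f_f.
have fM' x : `|f x| <= M.
  have cf : `|f_ n x| @[n --> \oo] --> `|f x| by apply: cvg_norm; exact: f_f.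
  by rewrite -(cvg_lim _ cf)//; apply: limr_le; [apply/cvg_ex; eexists; exact: cf|exact: nearW].
apply: fine_cvg; rewrite fineK; last first.
  by apply: integrable_fin_num => //; exact: (bounded_integrable mf fM').
apply: (@dominated_cvg _ _ _ P setT measurableT _ _ (cst M%:E)) => //.
- by move=> n; apply/measurable_EFinP.
- by move=> x _; apply: cvg_EFin; [exact: nearW|exact: f_f].
- exact: (@bounded_integrable (cst M) `|M|).
- by move=> n x _; rewrite lee_fin.
Qed.

Lemma le_bounded_Rintegral (f g : T -> R) (M : R) :
  measurable_fun setT f -> measurable_fun setT g ->
  (forall x, `|f x| <= M) -> (forall x, `|g x| <= M) ->
  (forall x, f x <= g x) -> \int[P]_x f x <= \int[P]_x g x.
Proof.
move=> mf mg fM gM fg.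
by apply: le_Rintegral => //; [exact: (bounded_integrable mf fM)|
  exact: (bounded_integrable mg gM)].
Qed.

Lemma bounded_RintegralD (f g : T -> R) (M : R) :
  measurable_fun setT f -> measurable_fun setT g ->
  (forall x, `|f x| <= M) -> (forall x, `|g x| <= M) ->
  \int[P]_x (f x + g x) = \int[P]_x f x + \int[P]_x g x.
Proof.
move=> mf mg fM gM.
by apply: RintegralD => //; [exact: (bounded_integrable mf fM)|
  exact: (bounded_integrable mg gM)].
Qed.

Lemma bounded_RintegralB (f g : T -> R) (M : R) :
  measurable_fun setT f -> measurable_fun setT g ->
  (forall x, `|f x| <= M) -> (forall x, `|g x| <= M) ->
  \int[P]_x (f x - g x) = \int[P]_x f x - \int[P]_x g x.
Proof.
move=> mf mg fM gM.
by apply: RintegralB => //; [exact: (bounded_integrable mf fM)|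
  exact: (bounded_integrable mg gM)].
Qed.

Lemma probability_Rintegral_cst (r : R) : \int[P]_x (fun=> r) x = r.
Proof.
rewrite Rintegral_cst//; have -> : (P : {measure set T -> \bar R}) setT = 1%E.
  exact: probability_setT.
by rewrite mulr1.
Qed.

Lemma Rintegral_indic (A : set T) : measurable A ->
  \int[P]_x (\1_A x) = fine (P A).
Proof. by move=> mA; rewrite /Rintegral integral_indic// setIT. Qed.

Lemma normr_bounded_Rintegral (f : T -> R) (M : R) :
  measurable_fun setT f -> (forall x, `|f x| <= M) -> `|\int[P]_x f x| <= M.
Proof.
move=> mf fM; apply: le_trans (le_normr_Rintegral _ _) _ => //.
  exact: (bounded_integrable mf fM).
rewrite -[leRHS]probability_Rintegral_cst; apply: (@le_bounded_Rintegral _ _ M) => //.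
- exact: measurableT_comp.
- by move=> x; rewrite normr_id.
- by move=> x; rewrite ger0_norm// (le_trans _ (fM x)).
Qed.

End bounded_integrals.

(** * Change of variables and Fubini *)

Section transfer.
Context d1 d2 (T1 : measurableType d1) (T2 : measurableType d2) (R : realType).

Lemma Rintegral_transfer (P : probability T1 R) (Q : probability T2 R)
    (phi : T1 -> T2) (f : T2 -> R) (M : R) :
  measurable_fun setT phi ->
  (forall A, measurable A -> Q A = P (phi @^-1` A)) ->
  measurable_fun setT f -> (forall x, `|f x| <= M) ->
  \int[Q]_y f y = \int[P]_x f (phi x).
Proof.
move=> mphi QP mf fM; rewrite /Rintegral; congr fine.
rewrite (eq_measure_integral (pushforward P phi)); last first.
  by move=> A mA _; exact: QP.
rewrite (@integral_pushforward _ _ _ _ _ _ mphi P setT (EFin \o f)) ?preimage_setT//.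
  exact/measurable_EFinP.
by apply: (@bounded_integrable _ _ _ _ _ M) => //; exact: measurableT_comp.
Qed.

(** The hypothesis is an equality on measurable sets rather than [Q = pushforward P phi]; with [phi]
    the identity it also compares a measure on [measurableTypeR R] with its copy on [R]. *)
Lemma ge0_integral_transfer (P : {measure set T1 -> \bar R})
    (Q : {measure set T2 -> \bar R}) (phi : T1 -> T2) (f : T2 -> \bar R) :
  measurable_fun setT phi ->
  (forall A, measurable A -> Q A = P (phi @^-1` A)) ->
  measurable_fun setT f -> (forall x, 0 <= f x)%E ->
  (\int[Q]_y f y = \int[P]_x f (phi x))%E.
Proof.
move=> mphi QP mf f0.
rewrite (eq_measure_integral (pushforward P phi)); last first.
  by move=> A mA _; exact: QP.
by rewrite ge0_integral_pushforward// preimage_setT.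
Qed.

Context (P : probability T1 R) (Q : probability T2 R).

Lemma bounded_Fubini (f : T1 * T2 -> R) (M : R) :
  measurable_fun setT f -> (forall x, `|f x| <= M) ->
  \int[(P \x Q)%E]_z f z = \int[P]_x \int[Q]_y f (x, y).
Proof.
move=> mf fM; rewrite {1}/Rintegral -integral12_prod_meas1; last first.
  exact: (@bounded_integrable _ _ _ (P \x Q)%E _ M).
rewrite [RHS]/Rintegral; congr fine; apply: eq_integral => x _.
rewrite /fubini_F /Rintegral fineK//; apply: integrable_fin_num => //.
apply: (@bounded_integrable _ _ _ Q (fun y => f (x, y)) M) => //.
by apply: measurableT_comp => //; exact: measurable_pair1.
Qed.

Lemma measurable_bounded_fubini (f : T1 * T2 -> R) (M : R) :
  measurable_fun setT f -> (forall x, `|f x| <= M) ->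
  measurable_fun setT (fun x => \int[Q]_y f (x, y)).
Proof.
move=> mf fM; apply: measurableT_comp => //.
apply: (@measurable_fubini_F _ _ _ _ _ P Q (EFin \o f)).
exact: (@bounded_integrable _ _ _ (P \x Q)%E _ M).
Qed.

End transfer.

(** * Measures determined by rays; Borel sets of the plane *)

Section uniqueness.
Context (R : realType).

(** Open upper rays are stable under intersection, generate the Borel sets and exhaust the line. The
    two functions live on different spaces, so this is an identification of two laws. *)
Lemma measure_eq_ray d1 d2 (T1 : measurableType d1) (T2 : measurableType d2)
    (m1 : {measure set T1 -> \bar R}) (m2 : {measure set T2 -> \bar R})
    (f1 : T1 -> R) (f2 : T2 -> R) :
  measurable_fun setT f1 -> measurable_fun setT f2 ->
  (m1 setT < +oo)%E ->
  (forall r, m1 (f1 @^-1` `]r, +oo[) = m2 (f2 @^-1` `]r, +oo[)) ->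
  forall A, measurable A -> m1 (f1 @^-1` A) = m2 (f2 @^-1` A).
Proof.
move=> mf1 mf2 m1oo m12 A mA.
have := @g_sigma_algebra_measure_unique _ R R (@RGenOInfty.G R) _
  (fun n => `](- n%:R), +oo[%classic) _ _ (pushforward m1 f1) (pushforward m2 f2).
apply.
- by move=> _ [x ->].
- by move=> n; exists (- n%:R).
- rewrite -subTset => x _; exists (Num.truncn `|x|).+1 => //=.
  rewrite in_itv/= andbT ltrNl (le_lt_trans (ler_norm _))// normrN.
  exact: truncnS_gt.
- move=> _ _ [x ->] [y ->]; exists (Num.max x y).
  apply/predeqP => z /=; rewrite !in_itv/= !andbT gt_max.
  by split=> [[-> ->]|/andP[]].
- by move=> _ [x ->]; exact: m12.
- move=> k; apply: (le_lt_trans _ m1oo); apply: (@le_measure _ _ _ m1); rewrite ?inE//.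
  by rewrite /= -[X in measurable X]setTI; exact: mf1.
- have E : @measurable _ R = <<s @RGenOInfty.G R >> := RGenOInfty.measurableE R.
  by rewrite -E.
Qed.

(** Second countability: an open set is the union of the rational squares that it contains, and
    there are countably many of these. *)
Lemma open_measurable_pair (U : set (R * R)) : open U -> measurable U.
Proof.
move=> oU.
pose B (q : rat * rat * rat) : set (R * R) :=
  ball (ratr q.1.1 : R) (ratr q.2) `*` ball (ratr q.1.2 : R) (ratr q.2).
have -> : U = \bigcup_(q in [set q | B q `<=` U]) B q.
  apply/predeqP => z; split=> [Uz|[q qU Bz]]; last exact: qU.
  have /nbhs_ballP[e /= e0 zU] : nbhs z U by exact: open_nbhs_nbhs.
  have [r r0 re] : exists2 r : rat, 0 < ratr r :> R & ratr r < e / 2.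
    have e2 : 0 < e / 2 by rewrite divr_gt0.
    by have [r /[!in_itv]/= /andP[? ?]] := rat_in_itvoo e2; exists r.
  have appr (u : R) : exists p : rat, ball (ratr p : R) (ratr r) u.
    have : u - ratr r < u by rewrite ltrBlDr ltrDl.
    move=> /rat_in_itvoo[p /[!in_itv]/= /andP[up pu]]; exists p.
    rewrite /ball/= distrC ger0_norm ?subr_ge0 ?(ltW pu)//.
    by rewrite ltrBlDr -ltrBlDl.
  have [p Hp] := appr z.1; have [q Hq] := appr z.2.
  exists (p, q, r) => //= w [/= w1 w2]; apply: zU; split => /=.
  - have := ler_distD (ratr p) z.1 w.1; move: w1 Hp; rewrite /ball/= distrC.
    by rewrite (distrC z.1); lra.
  - have := ler_distD (ratr q) z.2 w.2; move: w2 Hq; rewrite /ball/= distrC.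
    by rewrite (distrC z.2); lra.
rewrite bigcup_mkcond; apply: countable_bigcupT_measurable; first exact/countableP.
move=> q; case: ifPn => // _; apply: measurableX; exact: measurable_ball.
Qed.

Lemma continuous_measurable_pair (f : R * R -> R) :
  continuous f -> measurable_fun setT f.
Proof.
move=> /continuousP cf; apply: (measurability _ (RGenOpens.measurableE R)).
move=> _ [_ [a [b ->] <-]]; rewrite setTI; apply: open_measurable_pair.
exact/cf/interval_open.
Qed.

End uniqueness.

(** Counterexamples at distance below [1 / (k + 1)] have a cluster point by compactness, and
    continuity fails there. *)
Lemma heine_cantor (R : realType) (T : pseudoMetricType R) (A : set T) (f : T -> R) (eps : R) :
  compact A -> {within A, continuous f} -> 0 < eps ->
  exists2 d, 0 < d & forall x y, A x -> A y -> ball x d y -> `|f x - f y| < eps.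
Proof.
move=> cA /subspace_continuousP cf eps0; apply: contrapT => H.
have /choice[p Hp] : forall k : nat, exists q : T * T,
    [/\ A q.1, A q.2, ball q.1 k.+1%:R^-1 q.2 & eps <= `|f q.1 - f q.2|].
  move=> k; apply: contrapT => Hk; apply: H; exists k.+1%:R^-1; first by rewrite invr_gt0.
  move=> x y Ax Ay xy; rewrite ltNge; apply/negP => fxy; apply: Hk.
  by exists (x, y).
have UA : ((fun k => (p k).1) @ \oo) A by exists 0%N => // k _; case: (Hp k).
have [l [Al ul]] := cA _ _ UA.
have eps2 : 0 < eps / 2 by rewrite divr_gt0.
have /cvgrPdist_lt/(_ _ eps2) := cf l Al.
rewrite near_withinE => /nbhs_ballP[d /= d0 Hd].
have d2 : 0 < d / 2 by rewrite divr_gt0.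
have [m _ Hm] := near_infty_natSinv_lt (PosNum d2).
have [_ [/= [k mk <-] lk]] : (fun k => (p k).1) @` [set k | (m <= k)%N] `&` ball l (d / 2) !=set0.
  by apply: ul; [exists m => // k /= mk; exists k|exact: nbhsx_ballx].
have [A1 A2 pk] := Hp k; apply/negP; rewrite -ltNge.
have kd : k.+1%:R^-1 < d / 2 := Hm k mk.
have b1 : ball l d (p k).1 by apply: le_ball lk; rewrite ler_pdivrMr// ler_pMr// ler1n.
have b2 : ball l d (p k).2.
  by rewrite [d]splitr; apply: ball_triangle lk _; apply: le_ball pk; exact: ltW.
rewrite (_ : f _ - f _ = (f l - f (p k).2) - (f l - f (p k).1)); last by ring.
rewrite (le_lt_trans (ler_normB _ _))// [ltRHS]splitr ltrD//; exact: Hd.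
Qed.

(** * The standard normal law *)

Section density.
Context d (T : measurableType d) (R : realType).

(** Any density [g] agrees almost everywhere with the Radon-Nikodym derivative, for which the change
    of variables is known. *)
Lemma ge0_integral_density (mu : {sigma_finite_measure set T -> \bar R})
    (nu : {finite_measure set T -> \bar R}) (g : T -> R) (f : T -> \bar R) :
  measurable_fun setT g -> (forall x, 0 <= g x) ->
  (forall A, measurable A -> nu A = \int[mu]_(x in A) (g x)%:E)%E ->
  measurable_fun setT f -> (forall x, 0 <= f x)%E ->
  (\int[nu]_x f x = \int[mu]_x (f x * (g x)%:E))%E.
Proof.
move=> mg g0 nuE mf f0.
have numu : nu `<< mu.
  apply/null_content_dominatesP => A mA muA0; rewrite nuE//.
  by apply: null_set_integral => //; apply/measurable_EFinP; exact: measurable_funTS.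
rewrite -(Radon_Nikodym_SigmaFinite.change_of_variables numu)//.
have intg : mu.-integrable setT (EFin \o g).
  apply/integrableP; split; first exact/measurable_EFinP.
  under eq_integral do rewrite /= ger0_norm//.
  by rewrite -nuE// -ge0_fin_numE// fin_num_measure.
have intf := @Radon_Nikodym_SigmaFinite.f_integrable _ _ _ nu mu numu.
apply: ae_eq_integral => //.
- by apply: emeasurable_funM => //; exact: (measurable_int mu).
- by apply: emeasurable_funM => //; exact/measurable_EFinP.
apply: ae_eqe_mul2l; apply: integral_ae_eq => //.
- exact: (measurable_int mu).
- by move=> A _ mA; rewrite -Radon_Nikodym_SigmaFinite.f_integral// nuE.
Qed.

End density.

(* On [R] the library has two convertible sigma-algebras with different displays:
   [normal_prob] and [lebesgue_measure] live on [measurableTypeR R], random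
   variables on [R] itself. *)
Section gauss_leb.
Context (R : realType).

Definition gauss : set R -> \bar R := @normal_prob R 0 1.

Let gauss0 : gauss set0 = 0%E.
Proof. exact: (@measure0 _ _ _ (@normal_prob R 0 1)). Qed.

Let gauss_ge0 A : (0 <= gauss A)%E.
Proof. exact: (@measure_ge0 _ _ _ (@normal_prob R 0 1)). Qed.

Let gauss_sigma_additive : semi_sigma_additive gauss.
Proof. exact: (@measure_semi_sigma_additive _ _ _ (@normal_prob R 0 1)). Qed.

HB.instance Definition _ := isMeasure.Build _ R _ gauss
  gauss0 gauss_ge0 gauss_sigma_additive.

Let gauss_setT : gauss setT = 1%E.
Proof. exact: (@probability_setT _ _ _ (@normal_prob R 0 1)). Qed.

HB.instance Definition _ := Measure_isProbability.Build _ R _ gauss gauss_setT.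

Definition leb : set R -> \bar R := @lebesgue_measure R.

Let leb0 : leb set0 = 0%E.
Proof. exact: (@measure0 _ _ _ (@lebesgue_measure R)). Qed.

Let leb_ge0 A : (0 <= leb A)%E.
Proof. exact: (@measure_ge0 _ _ _ (@lebesgue_measure R)). Qed.

Let leb_sigma_additive : semi_sigma_additive leb.
Proof. exact: (@measure_semi_sigma_additive _ _ _ (@lebesgue_measure R)). Qed.

HB.instance Definition _ := isMeasure.Build _ R _ leb
  leb0 leb_ge0 leb_sigma_additive.

Let leb_sigma_finite : sigma_finite setT leb.
Proof. exact: (@sigma_finiteT _ _ _ (@lebesgue_measure R)). Qed.

HB.instance Definition _ := Measure_isSigmaFinite.Build _ R _ leb leb_sigma_finite.

Lemma ge0_integral_lebE (f : R -> \bar R) (A : set R) :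
  measurable A -> measurable_fun A f -> (forall x, A x -> 0 <= f x)%E ->
  (\int[@lebesgue_measure R]_(x in A) f x = \int[leb]_(x in A) f x)%E.
Proof.
move=> mA mf f0; rewrite integral_mkcond [RHS]integral_mkcond; apply/esym.
apply: (@ge0_integral_transfer _ _ (measurableTypeR R) R R
  (@lebesgue_measure R) leb idfun) => //.
- by move=> _ B mB; rewrite setTI.
- exact/(measurable_restrictT _ mA).
- by move=> x; apply: erestrict_ge0.
Qed.

Lemma ge0_integral_gaussE (f : R -> \bar R) :
  measurable_fun setT f -> (forall x, 0 <= f x)%E ->
  (\int[@normal_prob R 0 1]_x f x = \int[gauss]_x f x)%E.
Proof.
move=> mf f0; apply/esym.
apply: (@ge0_integral_transfer _ _ (measurableTypeR R) R R
  (@normal_prob R 0 1) gauss idfun) => //.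
by move=> _ B mB; rewrite setTI.
Qed.

Lemma gaussE A : measurable A ->
  gauss A = (\int[leb]_(x in A) (normal_pdf 0 1 x)%:E)%E.
Proof.
move=> mA; rewrite -ge0_integral_lebE//.
  by apply/measurable_EFinP; apply: measurable_funTS; exact: measurable_normal_pdf.
by move=> x _; rewrite lee_fin normal_pdf_ge0.
Qed.

Lemma product_gaussE (A : set (R * R)) : measurable A ->
  ((@normal_prob R 0 1 \x @normal_prob R 0 1) A = (gauss \x gauss) A)%E.
Proof.
move=> mA; rewrite /product_measure1 ge0_integral_gaussE//.
exact: (@measurable_fun_xsection _ _ _ _ _ gauss).
Qed.

Lemma leb_itv (i : interval R) :
  leb [set` i] = (if i.1 < i.2 then (i.2 : \bar R) - (i.1 : \bar R) else 0)%E.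
Proof. exact: lebesgue_measure_itv. Qed.

Lemma leb_unique (mu : {measure set R -> \bar R}) :
  (forall a b, leb `]a, b]%classic = mu `]a, b]%classic) ->
  forall A, measurable A -> leb A = mu A.
Proof.
move=> H A mA.
(* The same set function is repackaged as a measure on [measurableTypeR R], where uniqueness of
   Lebesgue measure is stated. *)
have mu0 : mu set0 = 0%E by exact: measure0.
have mu_ge0 B : (0 <= mu B)%E by exact: measure_ge0.
have mu_sa : @semi_sigma_additive _ (measurableTypeR R) R mu by exact: (@measure_semi_sigma_additive _ _ _ mu).
pose mumix := @isMeasure.Build _ (measurableTypeR R) R mu mu0 mu_ge0 mu_sa.
pose mupack : {measure set (measurableTypeR R) -> \bar R} := HB.pack (mu : set (measurableTypeR R) -> \bar R) mumix.
apply: (@lebesgue_measure_unique _ mupack) => // _ [[a b] _ <-].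
exact: H.
Qed.

End gauss_leb.
Arguments gauss : clear implicits.
Arguments leb : clear implicits.

(** * Affine maps, shifts and rotations in Gaussian integrals *)

Section gaussian.
Context (R : realType).
Local Notation N := (gauss R).
Local Notation phi := (@normal_pdf R 0 1).
Local Notation leb := (leb R).

Lemma ge0_integral_normal (f : R -> \bar R) :
  measurable_fun setT f -> (forall x, 0 <= f x)%E ->
  (\int[N]_x f x = \int[leb]_x (f x * (phi x)%:E))%E.
Proof.
move=> mf f0; apply: ge0_integral_density => //.
- exact: measurable_normal_pdf.
- by move=> x; exact: normal_pdf_ge0.
- exact: gaussE.
Qed.

Lemma ge0_integral_affine (a b : R) (f : R -> \bar R) : a != 0 ->
  measurable_fun setT f -> (forall x, 0 <= f x)%E ->
  (\int[leb]_x f x = `|a|%:E * \int[leb]_x f (a * x + b)%R)%E.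
Proof.
move=> a0 mf f0.
have mab : measurable_fun setT (fun x : R => a * x + b).
  by apply: measurable_funD => //; exact: measurable_funM.
have na0 : 0 < `|a| by rewrite normr_gt0.
pose k := NngNum (ltW na0).
have E A : measurable A -> leb A = mscale k (pushforward leb (fun x => a * x + b)) A.
  move=> mA; apply: (@leb_unique _
    (mscale k (pushforward leb (fun x => a * x + b)))) => // c e.
  suff : leb `]c, e]%classic = (`|a|%:E * leb ((fun x => (a * x + b)%R) @^-1` `]c, e]))%E by [].
  have [ap|an] := ltP 0 a.
    have -> : (fun x => a * x + b) @^-1` `]c, e] = `](c - b) / a, (e - b) / a]%classic.
      apply/predeqP => x /=; rewrite !in_itv/=.
      by rewrite ltr_pdivrMr// ler_pdivlMr// ltrBlDr lerBrDr (mulrC x).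
    rewrite !leb_itv/= !lte_fin ltr_pM2r ?invr_gt0// ltrBlDr subrK.
    case: ifPn => _; last by rewrite mule0.
    by rewrite -EFinB -EFinB -EFinM gtr0_norm//; congr EFin; field.
  (* A negative slope reverses the interval and moves its closed end; the length is the same. *)
  have {}an : a < 0 by rewrite lt_neqAle a0.
  have -> : (fun x => a * x + b) @^-1` `]c, e] = `[(e - b) / a, (c - b) / a[%classic.
    apply/predeqP => x /=; rewrite !in_itv/= andbC.
    by rewrite ltr_ndivlMr// ler_ndivrMr// ltrBlDr lerBrDr (mulrC x).
  rewrite !leb_itv/= !lte_fin ltr_nM2r ?invr_lt0// ltrBlDr subrK.
  case: ifPn => _; last by rewrite mule0.
  by rewrite -EFinB -EFinB -EFinM ltr0_norm//; congr EFin; field.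
rewrite (eq_measure_integral (mscale k (pushforward leb (fun x => a * x + b)))); last first.
  by move=> A mA _; exact: E.
by rewrite ge0_integral_mscale// ge0_integral_pushforward// preimage_setT.
Qed.

Lemma normal_pdf01E x : phi x = normal_peak 1 * expR (- x ^+ 2 / 2).
Proof. by rewrite normal_pdfE// /normal_fun subr0 expr1n. Qed.

Lemma normal_pdf01_gt0 x : 0 < phi x.
Proof. by rewrite normal_pdf01E mulr_gt0 ?expR_gt0// normal_peak_gt0. Qed.

(** Cameron-Martin formula on the line: the exponential factor is the density of N(s, 1) with
    respect to N(0, 1). *)
Lemma ge0_integral_normal_shift (s : R) (f : R -> \bar R) :
  measurable_fun setT f -> (forall x, 0 <= f x)%E ->
  (\int[N]_z (f z * (expR (s * z - s ^+ 2 / 2))%:E) = \int[N]_z f (z + s)%R)%E.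
Proof.
move=> mf f0.
have mfs : measurable_fun setT (fun z : R => f (z + s)).
  by apply: measurableT_comp => //; exact: measurable_funD.
have me : measurable_fun setT (fun z : R => expR (s * z - s ^+ 2 / 2)).
  apply: measurableT_comp => //; apply: measurable_funB => //.
rewrite ge0_integral_normal; last 2 first.
- by apply: emeasurable_funM => //; exact/measurable_EFinP.
- by move=> x; rewrite mule_ge0// lee_fin expR_ge0.
rewrite ge0_integral_normal//.
rewrite (@ge0_integral_affine 1 s)//; last 2 first.
- apply: emeasurable_funM; first apply: emeasurable_funM => //; apply/measurable_EFinP => //.
  exact: measurable_normal_pdf.
- by move=> x; rewrite !mule_ge0// lee_fin ?expR_ge0// normal_pdf_ge0.
rewrite normr1 mul1e; apply: eq_integral => z _; rewrite mul1r -muleA; congr (_ * _)%E.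
rewrite -EFinM !normal_pdf01E; congr EFin; rewrite mulrCA -expRD; congr (_ * expR _).
by field.
Qed.

Lemma ge0_integral_normalN (f : R -> \bar R) :
  measurable_fun setT f -> (forall x, 0 <= f x)%E ->
  (\int[N]_z f (- z)%R = \int[N]_z f z)%E.
Proof.
move=> mf f0; rewrite !ge0_integral_normal//; last first.
  exact: measurableT_comp.
rewrite [RHS](@ge0_integral_affine (-1) 0)//; last 2 first.
- apply: emeasurable_funM => //; apply/measurable_EFinP.
  exact: measurable_normal_pdf.
- by move=> x; rewrite !mule_ge0// lee_fin normal_pdf_ge0.
rewrite normrN1 mul1e; apply: eq_integral => z _; rewrite mulN1r addr0.
by rewrite !normal_pdf01E sqrrN.
Qed.

Let mulEFinI (a : R) (u v : \bar R) : a != 0 -> (a%:E * u = a%:E * v)%E -> u = v.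
Proof.
by move=> a0 /(congr1 (mule a^-1%:E)); rewrite !muleA -EFinM mulVf// !mul1e.
Qed.

Let mlin (a b : R) : measurable_fun setT (fun z : R * R => a * z.1 + b * z.2).
Proof. by apply: measurable_funD; apply: measurable_funM. Qed.

(* A rotation is a composition of affine maps in one variable at a time. *)
Let rotation0 (c s : R) (f : R * R -> \bar R) : c != 0 -> c ^+ 2 + s ^+ 2 = 1 ->
  measurable_fun setT f -> (forall x, 0 <= f x)%E ->
  (\int[N \x N]_z f (c * z.1 + s * z.2, - s * z.1 + c * z.2)%R = \int[N \x N]_z f z)%E.
Proof.
move=> c0 cs mf f0.
have mrot : measurable_fun setT (fun z : R * R => (c * z.1 + s * z.2, - s * z.1 + c * z.2)).
  by apply/measurable_fun_pairP; split; exact: mlin.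
have mphi : measurable_fun setT (fun z : R * R => (phi z.1)%:E).
  by apply/measurable_EFinP; apply: measurableT_comp => //; exact: measurable_normal_pdf.
have mphi2 : measurable_fun setT (fun z : R * R => (phi z.2)%:E).
  by apply/measurable_EFinP; apply: measurableT_comp => //; exact: measurable_normal_pdf.
have nc0 : `|c| != 0 by rewrite normr_eq0.
pose g (z : R * R) := (f z * ((phi z.1)%:E * (phi z.2)%:E))%E.
have mg : measurable_fun setT g.
  by apply: emeasurable_funM => //; exact: emeasurable_funM.
have g0 z : (0 <= g z)%E by rewrite !mule_ge0// lee_fin normal_pdf_ge0.
have toleb (h : R * R -> \bar R) : measurable_fun setT h -> (forall x, 0 <= h x)%E ->
    (\int[N \x N]_z h z = \int[leb]_x \int[leb]_y (h (x, y) * ((phi x)%:E * (phi y)%:E)))%E.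
  move=> mh h0.
  have mh' x : measurable_fun setT (fun y => h (x, y)).
    by apply: measurableT_comp => //; exact: measurable_pair1.
  rewrite fubini_tonelli1// /fubini_F ge0_integral_normal; last 2 first.
  - exact: (@measurable_fun_fubini_tonelli_F _ _ _ _ _ N).
  - by move=> x; exact: integral_ge0.
  apply: eq_integral => x _; rewrite ge0_integral_normal// muleC -ge0_integralZl//.
  - by apply: eq_integral => y _; rewrite muleCA.
  - apply: emeasurable_funM => //; apply/measurable_EFinP; exact: measurable_normal_pdf.
  - by move=> y _; rewrite mule_ge0// lee_fin normal_pdf_ge0.
  - by rewrite lee_fin normal_pdf_ge0.
have RE : (\int[N \x N]_z f z = \int[leb]_x \int[leb]_y g (x, y))%E.
  exact: toleb.
have LE : (\int[N \x N]_z f (c * z.1 + s * z.2, - s * z.1 + c * z.2)%R =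
    \int[leb]_x \int[leb]_y (f (c * x + s * y, - s * x + c * y)%R * ((phi x)%:E * (phi y)%:E)))%E.
  have mfr : measurable_fun setT (fun z : R * R => f (c * z.1 + s * z.2, - s * z.1 + c * z.2)).
    exact: (@measurableT_comp _ _ _ _ _ _ f).
  exact: (toleb _ mfr).
rewrite RE LE.
(* The product density depends on [x^2 + y^2] only, so it is carried along by the rotation. *)
have gE x y : (f (c * x + s * y, - s * x + c * y)%R * ((phi x)%:E * (phi y)%:E) =
    g (c * x + s * y, - s * x + c * y)%R)%E.
  congr (_ * _)%E; rewrite -!EFinM !normal_pdf01E /=; congr EFin.
  rewrite mulrACA [RHS]mulrACA -!expRD; congr (_ * expR _).
  have : (c ^+ 2 + s ^+ 2) * (x ^+ 2 + y ^+ 2) = x ^+ 2 + y ^+ 2 by rewrite cs mul1r.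
  by rewrite /=; lra.
under eq_integral do under eq_integral do rewrite gE.
clear RE LE gE toleb; clearbody g.
pose h (x y : R) : \bar R := g (c * x + s * y, - s * x + c * y)%R.
have mh : measurable_fun setT (fun z : R * R => h z.1 z.2).
  by apply: (@measurableT_comp _ _ _ _ _ _ g).
have -> : (\int[leb]_x \int[leb]_y g (c * x + s * y, - s * x + c * y)%R =
    \int[leb]_y \int[leb]_x h x y)%E.
  exact: (fubini_tonelli (fun z : R * R => h z.1 z.2) mh (fun z => g0 _)).
(* With [t = c x + s y] in place of [x], the second coordinate becomes [(y - s t) / c]. Both
   substitutions, first in [x] and then in [y], are affine in one variable; their factors [|c|]
   cancel. *)
pose h1 (t y : R) : \bar R := g (t, (y - s * t) / c)%R.
have mh1 : measurable_fun setT (fun z : R * R => h1 z.1 z.2).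
  have m2 : measurable_fun setT (fun z : R * R => (z.2 - s * z.1) / c).
    by apply: measurable_funM => //; apply: measurable_funB => //; exact: measurable_funM.
  apply: (@measurableT_comp _ _ _ _ _ _ g) => //; apply/measurable_fun_pairP.
  by split; [exact: measurable_fst|exact: m2].
have hh1 y : (`|c|%:E * \int[leb]_x h x y = \int[leb]_t h1 t y)%E.
  rewrite [RHS](@ge0_integral_affine c (s * y))//; last 2 first.
  - exact: (measurableT_comp mh1 (measurable_pair2 y)).
  - by move=> x; exact: g0.
  congr (_ * _)%E; apply: eq_integral => x _; rewrite /h /h1; congr (g (_, _)).
  apply: (mulfI c0); rewrite [RHS]mulrC divfK//.
  have : (c ^+ 2 + s ^+ 2) * y = y by rewrite cs mul1r.
  by lra.
have h1h t : (\int[leb]_y h1 t y = `|c|%:E * \int[leb]_w g (t, w))%E.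
  rewrite [LHS](@ge0_integral_affine c (s * t))//; last 2 first.
  - exact: (measurableT_comp mh1 (measurable_pair1 t)).
  - by move=> x; exact: g0.
  by congr (_ * _)%E; apply: eq_integral => x _; rewrite /h1 addrK mulrC mulKf.
have : (`|c|%:E * \int[leb]_y \int[leb]_x h x y = `|c|%:E * \int[leb]_t \int[leb]_w g (t, w))%E.
  rewrite -ge0_integralZl//; last 2 first.
  - exact: (@measurable_fun_fubini_tonelli_G _ _ _ _ _ leb
      (fun z : R * R => h z.1 z.2) mh (fun z => g0 _)).
  - by move=> y _; apply: integral_ge0 => u _; exact: g0.
  under eq_integral do rewrite hh1.
  have -> : (\int[leb]_y \int[leb]_t h1 t y = \int[leb]_t \int[leb]_y h1 t y)%E.
    apply/esym.
    exact: (fubini_tonelli (fun z : R * R => h1 z.1 z.2) mh1 (fun z => g0 _)).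
  under eq_integral do rewrite h1h.
  rewrite ge0_integralZl//.
  - exact: (@measurable_fun_fubini_tonelli_F _ _ _ _ _ leb g).
  - by move=> y _; exact: integral_ge0.
by have /(_ `|c| _ _ nc0)/[apply] := @mulEFinI.
Qed.

Lemma ge0_integral_rotation (c s : R) (f : R * R -> \bar R) : c ^+ 2 + s ^+ 2 = 1 ->
  measurable_fun setT f -> (forall x, 0 <= f x)%E ->
  (\int[N \x N]_z f (c * z.1 + s * z.2, - s * z.1 + c * z.2)%R = \int[N \x N]_z f z)%E.
Proof.
move=> cs mf f0; have [c0|c0] := eqVneq c 0; last exact: rotation0.
have s1 : s ^+ 2 = 1 by rewrite -cs c0 expr0n/= add0r.
(* A quarter turn is the composite of two eighth turns, whose cosine [r] is nonzero. *)
pose r : R := Num.sqrt 2^-1.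
have r2 : r ^+ 2 = 2^-1 by rewrite sqr_sqrtr.
have r0 : r != 0 by rewrite sqrtr_eq0 -ltNge.
have rs : r ^+ 2 + (r * s) ^+ 2 = 1 by rewrite exprMn s1 r2; field.
rewrite -[RHS](rotation0 r0 rs)//.
set h := fun z => f (r * z.1 + r * s * z.2, - (r * s) * z.1 + r * z.2).
have mh : measurable_fun setT h.
  by apply: measurableT_comp => //; apply/measurable_fun_pairP; split; exact: mlin.
rewrite -[RHS](rotation0 r0 rs)//; apply: eq_integral => -[u v] _; rewrite /h /= c0.
congr (f (_, _)).
  transitivity (r ^+ 2 * ((1 - s ^+ 2) * u + 2 * s * v)); last by ring.
  by rewrite s1 r2; field.
transitivity (r ^+ 2 * ((1 - s ^+ 2) * v - 2 * s * u)); last by ring.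
by rewrite s1 r2; field.
Qed.

End gaussian.

(** * The space [0, +oo] *)

Section extnng_topology.
Context (R : realType).
Implicit Types (l : extnng R) (w : R).
Local Notation e := (@expN_extnng R).

Lemma expN_extnng_ge0 l : 0 <= e l.
Proof. by rewrite /expN_extnng; case: (extnng_val l) => // r; exact: expR_ge0. Qed.

Lemma expN_extnng_le1 l : e l <= 1.
Proof.
rewrite /expN_extnng; case: l => -[r| |] //= r0.
by rewrite -expR0 ler_expR oppr_le0.
Qed.

(** The inverse of [expN_extnng] on [0, 1], extended to the line by clamping. On ]0, 1] the absolute
    value is [- ln w]; it makes nonnegativity immediate. *)
Definition rexpN_extnng w : extnng R :=
  if w <= 0 then @ExtNng R +oo%E le0y
  else if w <= 1 then extnng_fin (normr_ge0 (ln w)) else extnng_fin (lexx 0).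

Lemma rexpN_extnngK w : 0 <= w <= 1 -> e (rexpN_extnng w) = w.
Proof.
move=> /andP[w0 w1]; rewrite /rexpN_extnng; case: ifPn => [w0'|].
  by rewrite /expN_extnng/=; apply/eqP; rewrite eq_le w0 w0'.
rewrite -ltNge => w0'; rewrite w1 /expN_extnng/=.
by rewrite ler0_norm ?ln_le0// opprK lnK.
Qed.

Lemma expN_extnngK l : rexpN_extnng (e l) = l.
Proof.
apply: (@expN_extnng_inj R); rewrite rexpN_extnngK//.
by rewrite expN_extnng_ge0 expN_extnng_le1.
Qed.

Lemma continuous_expN_extnng : continuous e.
Proof.
move=> l.
apply: (iffRL (@cvgrPdist_lt _ _ _ (nbhs l) (nbhs_filter l) e (e l))) => eps eps0.
near=> l'; suff : ball l eps l' by [].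
by near: l'; exact: nbhsx_ballx.
Unshelve. all: by end_near. Qed.

Lemma continuous_measurable_extnng (f : extnng R -> R) :
  continuous f -> measurable_fun setT f.
Proof.
move=> /continuousP cf; apply: (measurability _ (RGenOpens.measurableE R)).
move=> _ [_ [a [b ->] <-]]; rewrite setTI; apply: sub_sigma_algebra.
exact/cf/interval_open.
Qed.

Lemma measurable_expN_extnng : measurable_fun setT e.
Proof. by apply: continuous_measurable_extnng; exact: continuous_expN_extnng. Qed.

Lemma open_extnng_preimage (U : set (extnng R)) : open U ->
  exists2 V : set R, open V & U = e @^-1` V.
Proof.
move=> oU.
exists (\bigcup_(p in [set p : extnng R * R | 0 < p.2 /\ ball p.1 p.2 `<=` U]) ball (e p.1) p.2).
  by apply: bigcup_open => -[l r] /= [r0 _]; exact: ball_open.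
apply/predeqP => l; split => [Ul|[[l' r] /= [r0 +] Bl]]; last exact.
have /nbhs_ballP[r /= r0 rU] : nbhs l U by exact: open_nbhs_nbhs.
by exists (l, r) => //=; exact: ballxx.
Qed.

(** The preimages of Borel sets under [e] form a sigma-algebra that contains the open sets. A
    measure on [0, oo] is thus determined by the law of [e] on the line. *)
Lemma measurable_extnng_preimage (A : set (extnng R)) : measurable A ->
  exists2 B : set R, measurable B & A = e @^-1` B.
Proof.
pose C := [set A : set (extnng R) | exists2 B : set R, measurable B & A = e @^-1` B].
suff : @measurable _ (extnng R) `<=` C by apply.
apply: smallest_sub; last first.
  move=> U /open_extnng_preimage[V oV UV]; exists V => //; exact: open_measurable.
split.
- by exists set0; rewrite ?preimage_set0.
- move=> _ [B mB ->]; exists (~` B); first exact: measurableC.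
  by rewrite setTD preimage_setC.
- move=> F /= HF; exists (\bigcup_n (sval (cid2 (HF n)))).
    by apply: bigcupT_measurable => n; case: cid2.
  rewrite preimage_bigcup; apply: eq_bigcupr => n _; by case: cid2.
Qed.

Lemma expN_rexpN_extnng w : e (rexpN_extnng w) = Num.min (Num.max w 0) 1.
Proof.
have [w0|w0] := leP w 0.
  by rewrite /rexpN_extnng w0 /expN_extnng/= minEle ler01.
have [w1|w1] := leP w 1; first by rewrite rexpN_extnngK ?(ltW w0).
by rewrite /rexpN_extnng leNgt w0/= leNgt w1/= /expN_extnng/= oppr0 expR0.
Qed.

Lemma measurable_rexpN_extnng : measurable_fun setT rexpN_extnng.
Proof.
move=> _ A mA; rewrite setTI; have [B mB ->] := measurable_extnng_preimage mA.
rewrite -[X in measurable X]setTI.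
apply: (_ : measurable_fun setT (fun w => e (rexpN_extnng w))) => //.
under eq_fun do rewrite expN_rexpN_extnng.
by apply: measurable_minr => //; exact: measurable_maxr.
Qed.

Lemma continuous_comp_rexpN (f : extnng R -> R) : continuous f ->
  {within `[0, 1], continuous (f \o rexpN_extnng)}.
Proof.
move=> cf; apply/subspace_continuousP => w; rewrite /= in_itv/= => w01.
apply/cvgrPdist_lt => eps eps0.
have /nbhs_ballP[r /= r0 rB] :
    nbhs (rexpN_extnng w) [set l | `|f (rexpN_extnng w) - f l| < eps].
  by have /cvgrPdist_lt/(_ _ eps0) := cf (rexpN_extnng w).
near=> w'; apply: rB.
have w'01 : 0 <= w' <= 1 by have : `[0, 1]%classic w' by near: w'; exact: withinT.
rewrite ballEmdist /= /mdist/= /dist_extnng !rexpN_extnngK//.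
near: w'; apply: cvg_within; by apply/nbhs_ballP; exists r.
Unshelve. all: by end_near. Qed.

Lemma extnng_measure_eq (nu nu' : probability (extnng R) R) :
  (forall r, nu [set l | r < e l] = nu' [set l | r < e l]) -> measure_eq nu nu'.
Proof.
move=> H A mA; have [B mB ->] := measurable_extnng_preimage mA.
apply: measure_eq_ray => //; try exact: measurable_expN_extnng.
- by rewrite -ge0_fin_numE// fin_num_measure.
- move=> r; have -> : e @^-1` `]r, +oo[ = [set l | r < e l].
    by apply/predeqP => l /=; rewrite in_itv/= andbT.
  exact: H.
Qed.

End extnng_topology.

(** * The likelihood ratio and its continuity in l *)

Section lognormal_factor.
Context (R : realType).
Implicit Types (l : extnng R) (w z : R).
Local Notation e := (@expN_extnng R).

(* The likelihood ratio of N(2l, 1) to N(0, 1), with its limit [0] at [l = +oo]. *)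
Definition lognormal l z : R :=
  if extnng_val l is r%:E then expR (2 * r * z - 2 * r ^+ 2) else 0.

(** In terms of [e l] the formula only involves real variables, which is the form that measurability
    and limits in [l] require. *)
Lemma lognormalE l z : lognormal l z =
  if e l == 0 then 0 else expR (2 * - ln (e l) * z - 2 * (- ln (e l)) ^+ 2).
Proof.
rewrite /lognormal /expN_extnng; case: l => -[r| |]//= r0; last by rewrite eqxx.
by rewrite gt_eqF ?expR_gt0// expRK opprK.
Qed.

Lemma lognormal_ge0 l z : 0 <= lognormal l z.
Proof. by rewrite /lognormal; case: (extnng_val l) => // r; exact: expR_ge0. Qed.

Lemma measurable_lognormal : measurable_fun setT (fun u : extnng R * R => lognormal u.1 u.2).
Proof.
under eq_fun do rewrite lognormalE.
have me : measurable_fun setT (fun u : extnng R * R => e u.1).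
  by apply: measurableT_comp => //; exact: measurable_expN_extnng.
have ml : measurable_fun setT (fun u : extnng R * R => - ln (e u.1)).
  apply: measurable_funN; apply: (@measurableT_comp _ _ _ _ _ _ (@ln R)) => //.
apply: measurable_fun_ifT => //.
- by apply: measurable_fun_eqr.
- apply: measurableT_comp => //; apply: measurable_funB.
    by apply: measurable_funM => //; exact: measurable_funM.
  by apply: measurable_funM => //; exact: measurable_funX.
Qed.

(** Completing squares in the exponent. The factor [e l] squeezes [lognormal l z] to its value 0 at
    l = oo. *)
Lemma lognormal_le l z : lognormal l z <= expR (z ^+ 2 + 1) * e l.
Proof.
rewrite /lognormal /expN_extnng; case: (extnng_val l) => [r| |]; rewrite ?mulr0//.
rewrite -expRD ler_expR.
have := sqr_ge0 (r - z); have := sqr_ge0 (r - 2^-1).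
rewrite !sqrrB; lra.
Qed.

Lemma cvg_lognormal (l_ : nat -> extnng R) l z :
  e (l_ n) @[n --> \oo] --> e l -> lognormal (l_ n) z @[n --> \oo] --> lognormal l z.
Proof.
move=> cl; have [l0|l0] := eqVneq (e l) 0.
  rewrite [in X in _ --> X]lognormalE l0 eqxx.
  apply: (@squeeze_cvgr _ _ _ _ (fun=> 0) (fun n => expR (z ^+ 2 + 1) * e (l_ n))).
  - by apply: nearW => n; rewrite lognormal_ge0 lognormal_le.
  - exact: cvg_cst.
  - by rewrite -(mulr0 (expR (z ^+ 2 + 1))); apply: cvgMr; rewrite -l0.
have {}l0 : 0 < e l by rewrite lt_neqAle eq_sym l0 expN_extnng_ge0.
have cln : - ln (e (l_ n)) @[n --> \oo] --> - ln (e l).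
  apply: cvgN; apply: (continuous_cvg _ _ cl); exact: continuous_ln.
rewrite [in X in _ --> X]lognormalE gt_eqF//.
apply: (@cvg_trans _ (expR (2 * - ln (e (l_ n)) * z - 2 * (- ln (e (l_ n))) ^+ 2) @[n --> \oo])).
  apply: near_eq_cvg; near=> n; rewrite lognormalE gt_eqF//.
  by near: n; exact: (cvgr_gt _ cl).
apply: (continuous_cvg _ (@continuous_expR R _)); apply: cvgB.
  by apply: cvgMl; exact: cvgMr.
by apply: cvgMr; rewrite expr2; under eq_fun do rewrite expr2; exact: cvgM.
Unshelve. all: by end_near. Qed.

End lognormal_factor.

(** * The integrand of F *)

Section gaussian_facts.
Context (R : realType).
Local Notation N := (gauss R).

Lemma gauss_set1 (x : R) : N [set x] = 0%E.
Proof.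
rewrite gaussE//; apply: null_set_integral => //.
  by apply/measurable_EFinP; apply: measurable_funTS; exact: measurable_normal_pdf.
exact: lebesgue_measure_set1.
Qed.

Lemma integral_gauss_indic (A : set R) : measurable A ->
  (\int[N]_z (\1_A z)%:E = N A)%E.
Proof. by move=> mA; rewrite integral_indic// setIT. Qed.

Lemma gauss_opp (A : set R) : measurable A -> N (-%R @^-1` A) = N A.
Proof.
move=> mA; have mNA : measurable (-%R @^-1` A) by rewrite -[X in measurable X]setTI; exact: oppr_measurable.
have -> : N A = (\int[N]_z (\1_A z)%:E)%E by rewrite integral_indic// setIT.
have -> : N (-%R @^-1` A) = (\int[N]_z (\1_(-%R @^-1` A) z)%:E)%E.
  by rewrite integral_indic// setIT.
apply: (@ge0_integral_normalN R (fun z => (\1_A z)%:E)) => //.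
by apply/measurable_EFinP; exact: measurable_indic.
Qed.

Lemma gauss_shift (s : R) (A : set R) : measurable A ->
  (\int[N]_z (\1_A z * expR (s * z - s ^+ 2 / 2))%:E = N [set z : R | A (z + s)%R])%E.
Proof.
move=> mA; have mAs : measurable [set z : R | A (z + s)].
  rewrite -[X in measurable X]setTI.
  by apply: (_ : measurable_fun setT (fun z : R => z + s)) => //; exact: measurable_funD.
under eq_integral do rewrite EFinM.
rewrite (@ge0_integral_normal_shift R s (fun z => (\1_A z)%:E))//; last first.
  by apply/measurable_EFinP; exact: measurable_indic.
have -> : N [set z : R | A (z + s)] = (\int[N]_z (\1_[set z : R | A (z + s)%R] z)%:E)%E.
  by rewrite integral_indic// setIT.
apply: eq_integral => z _.
by rewrite !indicE; congr (_%:R%:E); rewrite !in_setE.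
Qed.

Lemma gauss_expR (s : R) : (\int[N]_z (expR (s * z - s ^+ 2 / 2))%:E = 1)%E.
Proof.
have := @gauss_shift s setT measurableT.
rewrite [X in _ = N X -> _](_ : _ = setT)// probability_setT => <-.
by apply: eq_integral => z _; rewrite indicT mul1r.
Qed.

Lemma PhiE (x : R) : Phi x = fine (N `]-oo, x]).
Proof. by []. Qed.

Lemma gauss_Phi (x : R) : N `]-oo, x] = (Phi x)%:E.
Proof. by rewrite PhiE fineK// fin_num_measure. Qed.

Lemma gauss_ray (x : R) : N `]x, +oo[ = (1 - Phi x)%:E.
Proof.
have -> : `]x, +oo[%classic = ~` `]-oo, x] :> set R by rewrite setCitvl.
have -> : N (~` `]-oo, x]%classic) = (1 - N `]-oo, x]%classic)%E.
  exact: probability_setC.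
by rewrite gauss_Phi.
Qed.

Lemma PhiN (x : R) : Phi (- x) = 1 - Phi x.
Proof.
apply: EFin_inj; rewrite -gauss_Phi -gauss_ray -(gauss_opp (measurable_itv `]x, +oo[)).
have -> : -%R @^-1` `]x, +oo[ = `]-oo, - x[%classic :> set R.
  by apply/predeqP => z /=; rewrite !in_itv/= andbT ltrNr.
have -> : `]-oo, - x]%classic = `]-oo, - x[ `|` [set - x] :> set R.
  apply/predeqP => z /=; rewrite !in_itv/= le_eqVlt.
  by split=> [/orP[/eqP|]|[->|->]]; [right|left|rewrite orbT|rewrite eqxx].
have -> : N (`]-oo, - x[%classic `|` [set - x]) = (N `]-oo, (- x)%R[%classic + N [set (- x)%R])%E.
  apply: measureU => //.
  by apply/predeqP => z /=; rewrite in_itv/=; split=> // -[/[swap]->]; rewrite ltxx.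
by rewrite gauss_set1 adde0.
Qed.

(** For finite positive [r] the two terms of the minimum cross at [t = r + (y - x) / (2 r)]. Above
    [t] the minimum is [expR (- x)]; below, it is [expR (- y)] times the likelihood ratio, whose
    integral is the mass of N(2r, 1) below [t]. *)
Lemma F_integrandE (x y : R) (l : extnng R) :
  F_integrand x y l = expR (- x) + expR (- y) -
    \int[N]_z Num.min (expR (- x)) (expR (- y) * lognormal l z).
Proof.
rewrite /F_integrand /lognormal; case: l => -[r| |]//= r0; last first.
  have -> : (fun z : R => Num.min (expR (- x)) (expR (- y) * 0)) = fun=> 0.
    by apply/funext => z; rewrite mulr0 minEle leNgt expR_gt0.
  by rewrite (probability_Rintegral_cst N 0) subr0.
have [->|rn0] := eqVneq r 0.
  have -> : (fun z : R => Num.min (expR (- x)) (expR (- y) * expR (2 * 0 * z - 2 * 0 ^+ 2))) =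
      fun=> Num.min (expR (- x)) (expR (- y)).
    by apply/funext => z; rewrite mulr0 mul0r expr0n/= mulr0 subr0 expR0 mulr1.
  rewrite (probability_Rintegral_cst N (Num.min (expR (- x)) (expR (- y)))).
  by rewrite /Num.min ltr_expR ltrN2; case: (ltgtP x y) => [xy|xy|->]; lra.
have {}r0 : 0 < r by rewrite lt_neqAle eq_sym rn0 -lee_fin.
pose t := r + (y - x) / (2 * r).
have -> : \int[N]_z Num.min (expR (- x)) (expR (- y) * expR (2 * r * z - 2 * r ^+ 2)) =
    expR (- x) * (1 - Phi t) + expR (- y) * Phi (t - 2 * r).
  apply: EFin_inj; rewrite /Rintegral.
  have E z : (Num.min (expR (- x)) (expR (- y) * expR (2 * r * z - 2 * r ^+ 2)))%:E =
      ((expR (- x))%:E * (\1_`]t, +oo[ z)%:E + (expR (- y))%:E *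
      (\1_`]-oo, t] z * expR ((2 * r) * z - (2 * r) ^+ 2 / 2))%:E)%E.
    have -> : (2 * r) ^+ 2 / 2 = 2 * r ^+ 2 by field.
    rewrite -!EFinM -EFinD; congr EFin.
    have tz : (t < z) = (expR (- x) < expR (- y) * expR (2 * r * z - 2 * r ^+ 2)).
      rewrite -expRD ltr_expR -subr_gt0 -[RHS]subr_gt0.
      have -> : - y + (2 * r * z - 2 * r ^+ 2) - - x = (2 * r) * (z - t) by rewrite /t; field.
      by rewrite pmulr_rgt0// mulr_gt0.
    rewrite !indicE !mem_setE !in_itv/= andbT leNgt tz /Order.min.
    by case: ifP => _ /=; ring.
  under eq_integral do rewrite E.
  have mi (A : set R) : measurable A -> measurable_fun setT (fun z => (\1_A z : R)%:E).
    by move=> mA; apply/measurable_EFinP; exact: measurable_indic.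
  have me : measurable_fun setT (fun z : R => (\1_`]-oo, t] z * expR ((2 * r) * z - (2 * r) ^+ 2 / 2))%:E).
    apply/measurable_EFinP; apply: measurable_funM; first exact: measurable_indic.
    by apply: measurableT_comp => //; apply: measurable_funB => //; exact: measurable_funM.
  have e0 z : (0 <= (\1_`]-oo, t] z * expR ((2 * r) * z - (2 * r) ^+ 2 / 2))%:E)%E.
    by rewrite lee_fin mulr_ge0// expR_ge0.
  have mi1 := mi `]t, +oo[%classic (measurable_itv _).
  have i0 (A : set R) z : (0 <= (\1_A z : R)%:E)%E by rewrite lee_fin.
  have x0 : (0 <= (expR (- x))%:E)%E by rewrite lee_fin expR_ge0.
  have y0 : (0 <= (expR (- y))%:E)%E by rewrite lee_fin expR_ge0.
  rewrite ge0_integralD//; last 2 first.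
    exact: emeasurable_funM.
    exact: emeasurable_funM.
  rewrite !ge0_integralZl//.
  rewrite integral_gauss_indic// gauss_ray gauss_shift//.
  have -> : [set z | `]-oo, t]%classic (z + 2 * r)] = `]-oo, t - 2 * r]%classic.
    by apply/predeqP => z /=; rewrite !in_itv/= lerBrDr.
  by rewrite gauss_Phi.
have -> : t - 2 * r = - (r + (x - y) / (2 * r)) by rewrite /t; field.
by rewrite PhiN /t; ring.
Qed.

Lemma measurable_min_lognormal (a c : R) :
  measurable_fun setT (fun u : extnng R * R => Num.min a (c * lognormal u.1 u.2)).
Proof.
by apply: measurable_minr => //; apply: measurable_funM => //; exact: measurable_lognormal.
Qed.

Lemma measurable_lognormalr (l : extnng R) : measurable_fun setT (lognormal l).
Proof.
exact: (measurableT_comp (@measurable_lognormal R) (pair1_measurable l)).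
Qed.

Lemma min_lognormal_bound (a c : R) (l : extnng R) (z : R) : 0 <= a -> 0 <= c ->
  `|Num.min a (c * lognormal l z)| <= a.
Proof.
move=> a0 c0; have h : 0 <= c * lognormal l z by rewrite mulr_ge0// lognormal_ge0.
by rewrite ger0_norm ?ge_min ?lexx// le_min a0.
Qed.

Lemma continuous_minM (a c : R) : continuous (fun u : R => Num.min a (c * u)).
Proof.
move=> u; apply: (@continuous_min R R (cst a) ( *%R c)); first exact: cvg_cst.
by apply: cvgMr; exact: cvg_id.
Qed.

Lemma cvg_F_integrand (x y : R) (l_ : nat -> extnng R) (l : extnng R) :
  expN_extnng (l_ n) @[n --> \oo] --> expN_extnng l ->
  F_integrand x y (l_ n) @[n --> \oo] --> F_integrand x y l.
Proof.
move=> cl; rewrite F_integrandE; under eq_fun do rewrite F_integrandE.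
apply: cvgB; first exact: cvg_cst.
apply: (@bounded_cvg_Rintegral _ _ _ _ _ _ (expR (- x))).
- move=> n; apply: measurable_minr => //; apply: measurable_funM => //.
  exact: measurable_lognormalr.
- move=> z; apply: (continuous_cvg _ (@continuous_minM _ _ _)).
  exact: cvg_lognormal.
- by move=> n z; apply: min_lognormal_bound; exact: expR_ge0.
Qed.

Lemma F_integrand_ge0 (x y : R) (l : extnng R) : 0 <= F_integrand x y l.
Proof.
rewrite F_integrandE subr_ge0 (le_trans (ler_norm _))//.
apply: (@le_trans _ _ (expR (- x))); last by rewrite lerDl expR_ge0.
apply: normr_bounded_Rintegral.
- apply: measurable_minr => //; apply: measurable_funM => //.
  exact: measurable_lognormalr.
- by move=> z; apply: min_lognormal_bound; exact: expR_ge0.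
Qed.

Lemma F_integrand_le (x y : R) (l : extnng R) :
  F_integrand x y l <= expR (- x) + expR (- y).
Proof.
rewrite F_integrandE gerBl; apply: Rintegral_ge0 => z _.
by rewrite le_min expR_ge0 mulr_ge0// ?expR_ge0// lognormal_ge0.
Qed.

Lemma continuous_F_integrand (x y : R) : continuous (F_integrand x y).
Proof.
(* Limits are available along sequences. On the real line these suffice for continuity, so the
   integrand is first composed with [rexpN_extnng]. *)
have cg : continuous (F_integrand x y \o @rexpN_extnng R).
  move=> w; apply/(@cvg_nbhsP _ R^o) => u uw; apply: cvg_F_integrand.
  rewrite expN_rexpN_extnng; under eq_fun do rewrite expN_rexpN_extnng.
  apply: (cvg_comp u (fun w => Num.min (Num.max w 0) 1) uw).
  apply: (@continuous_min R R (fun w => Num.max w 0) (cst 1)); last exact: cvg_cst.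
  by apply: (@continuous_max R R idfun (cst 0)); [exact: cvg_id|exact: cvg_cst].
move=> l; have -> : F_integrand x y = (F_integrand x y \o @rexpN_extnng R) \o @expN_extnng R.
  by apply/funext => l' /=; rewrite expN_extnngK.
by apply: continuous_comp; [exact: continuous_expN_extnng|exact: cg].
Qed.

Lemma F_integrand_bounded (x y : R) : [bounded F_integrand x y l | l in setT].
Proof.
exists (expR (- x) + expR (- y)); split; first exact: num_real.
move=> M FM l _ /=; rewrite ger0_norm ?F_integrand_ge0// (le_trans _ (ltW FM))//.
exact: F_integrand_le.
Qed.

Lemma normr_F_integrand (x y : R) l : `|F_integrand x y l| <= expR (- x) + expR (- y).
Proof. by rewrite ger0_norm ?F_integrand_ge0// F_integrand_le. Qed.

Lemma measurable_F_integrand (x y : R) : measurable_fun setT (F_integrand x y).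
Proof. by apply: continuous_measurable_extnng; exact: continuous_F_integrand. Qed.

(** By Fubini, [F_ nu] depends on [nu] only through the law of [W] under [nu \x N]. *)
Lemma Rintegral_F_integrand (nu : probability (extnng R) R) (x y : R) :
  \int[nu]_l F_integrand x y l = expR (- x) + expR (- y) -
    \int[(nu \x N)%E]_u Num.min (expR (- x)) (expR (- y) * lognormal u.1 u.2).
Proof.
rewrite (@bounded_Fubini _ _ _ _ _ _ _ _ (expR (- x))); last 2 first.
- exact: measurable_min_lognormal.
- by move=> u; apply: min_lognormal_bound; exact: expR_ge0.
rewrite -{1}(probability_Rintegral_cst nu (expR (- x) + expR (- y))).
rewrite -(@bounded_RintegralB _ _ _ nu (fun=> expR (- x) + expR (- y)) _ (expR (- x) + expR (- y)))//.
- by apply: eq_Rintegral => l _; rewrite F_integrandE.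
- apply: (@measurable_bounded_fubini _ _ _ _ _ nu N (fun u => Num.min (expR (- x)) (expR (- y) * lognormal u.1 u.2)) (expR (- x))).
    exact: measurable_min_lognormal.
  by move=> u; apply: min_lognormal_bound; exact: expR_ge0.
- by move=> l; rewrite ger0_norm ?addr_ge0 ?expR_ge0.
- move=> l; apply: (@le_trans _ _ (expR (- x))); last by rewrite lerDl expR_ge0.
  apply: normr_bounded_Rintegral.
    by apply: measurable_minr => //; apply: measurable_funM => //; exact: measurable_lognormalr.
  by move=> z; apply: min_lognormal_bound; exact: expR_ge0.
Qed.

Lemma weak_cvg_F (mu_ : nat -> probability (extnng R) R) (nu : probability (extnng R) R)
    (x y : R) : weak_cvg mu_ nu -> F_ (mu_ n) x y @[n --> \oo] --> F_ nu x y.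
Proof.
move=> munu; rewrite /F_; apply: (continuous_cvg _ (@continuous_expR R _)); apply: cvgN.
by apply: munu; [exact: continuous_F_integrand|exact: F_integrand_bounded].
Qed.

End gaussian_facts.

(** * Gaussian pairs *)

Section integrable_transfer.
Context d1 d2 (T1 : measurableType d1) (T2 : measurableType d2) (R : realType).
Variables (P : {measure set T1 -> \bar R}) (Q : {measure set T2 -> \bar R}).
Variables (phi : T1 -> T2) (f : T2 -> \bar R).
Hypothesis mphi : measurable_fun setT phi.
Hypothesis QP : forall A, measurable A -> Q A = P (phi @^-1` A).
Hypothesis mf : measurable_fun setT f.

Lemma integrable_transferE : Q.-integrable setT f <-> P.-integrable setT (f \o phi).
Proof.
have E : (\int[Q]_y `|f y| = \int[P]_x `|f (phi x)|)%E.
  apply: (@ge0_integral_transfer _ _ _ _ _ P Q phi (abse \o f)) => //.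
    exact: measurableT_comp.
  by move=> y; exact: abse_ge0.
split=> /integrableP[_ fi]; apply/integrableP; split => //.
- exact: measurableT_comp.
- by rewrite -E.
- by rewrite E.
Qed.

Lemma integral_transfer : Q.-integrable setT f ->
  (\int[Q]_y f y = \int[P]_x f (phi x))%E.
Proof.
move=> /integrable_transferE fi.
rewrite (eq_measure_integral (pushforward P phi)); last first.
  by move=> A mA _; exact: QP.
by rewrite integral_pushforward// preimage_setT.
Qed.

End integrable_transfer.

(** * Moments of the normal law and of independent pairs *)

Section gaussian_moments.
Context (R : realType).
Local Notation N := (gauss R).
Local Notation NN := (gauss R \x gauss R)%E.

Let mid : measurable_fun setT (EFin : R -> \bar R).
Proof. exact/measurable_EFinP. Qed.

Let msq : measurable_fun setT (fun z : R => (z ^+ 2)%:E).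
Proof. by apply/measurable_EFinP; exact: measurable_funX. Qed.

(** [z^(2k) <= (2k)! exp |z|], and [exp |z|] is dominated by [exp z + exp(-z)], a multiple of the
    sum of two likelihood ratios of integral 1. *)
Lemma integrable_gauss_even k : N.-integrable setT (fun z => ((z ^+ 2) ^+ k)%:E).
Proof.
have pow_le n (x : R) : 0 <= x -> x ^+ n <= n`!%:R * expR x.
  case: n => [|n] x0; first by rewrite expr0 mul1r -expR0 ler_expR.
  rewrite mulrC -ler_pdivrMr ?ltr0n ?fact_gt0//.
  by have := expR_ge1Dxn n x0; lra.
pose C : R := (2 * k)`!%:R * expR 2^-1.
pose g (s z : R) : R := expR (s * z - s ^+ 2 / 2).
have mg s : measurable_fun setT (EFin \o g s).
  apply/measurable_EFinP; apply: measurableT_comp => //; exact: measurable_funB.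
have ig s : N.-integrable setT (EFin \o g s).
  apply/integrableP; split => //.
  under eq_integral do rewrite /= ger0_norm ?expR_ge0//.
  by rewrite gauss_expR ltry.
apply: (@le_integrable _ _ _ N setT _ _ (fun z => C%:E * (g 1 z)%:E + C%:E * (g (-1) z)%:E)%E) => //.
- by apply/measurable_EFinP; apply: measurable_funX; exact: measurable_funX.
- move=> z _; rewrite -!EFinM -EFinD /= lee_fin [leRHS]ger0_norm; last first.
    by rewrite addr_ge0// !mulr_ge0// expR_ge0.
  rewrite -exprM normrX (le_trans (pow_le _ _ (normr_ge0 z)))// /C /g.
  rewrite -!(mulrA _ (expR 2^-1)) -mulrDr ler_wpM2l// -!expRD.
  have -> : 2^-1 + (1 * z - 1 ^+ 2 / 2) = z by field.
  have -> : 2^-1 + (-1 * z - (-1) ^+ 2 / 2) = - z by field.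
  by have [z0|z0] := ger0P z; rewrite ?lerDl ?lerDr expR_ge0.
- exact: (integrableD measurableT (integrableZl measurableT C (ig 1)) (integrableZl measurableT C (ig (-1)))).
Qed.

(** The moments stay symbolic: they are only divided out, for which positivity suffices. *)
Definition gauss_moment k : R := fine (\int[N]_z ((z ^+ 2) ^+ k)%:E).

Lemma integral_gauss_even k : (\int[N]_z ((z ^+ 2) ^+ k)%:E = (gauss_moment k)%:E)%E.
Proof. by rewrite fineK//; apply: integrable_fin_num => //; exact: integrable_gauss_even. Qed.

Lemma gauss_moment_gt0 k : 0 < gauss_moment k.
Proof.
have p0 (z : R) : 0 <= (z ^+ 2) ^+ k by rewrite exprn_ge0// sqr_ge0.
rewrite lt_neqAle -lee_fin -integral_gauss_even integral_ge0 ?andbT; last first.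
  by move=> z _; rewrite lee_fin.
apply/eqP => v0.
have /ae_eq_integral_abs : (\int[N]_z `|((z ^+ 2) ^+ k)%:E| = 0)%E.
  under eq_integral do rewrite gee0_abs ?lee_fin//.
  by rewrite integral_gauss_even -v0.
have mk : measurable_fun setT (fun z : R => ((z ^+ 2) ^+ k)%:E).
  by apply/measurable_EFinP; apply: measurable_funX; exact: measurable_funX.
move=> /(_ measurableT mk) [A [mA NA0 nA]].
(* Otherwise a null set and the point 0 would cover the line. *)
have NU : N (A `|` [set 0]) = 1%E.
  rewrite -(@probability_setT _ _ _ N); congr (N _); apply/predeqP => z; split=> // _.
  have [->|z0] := eqVneq z 0; [by right|left; apply: nA => /(_ I) [] /eqP].
  by rewrite !expf_eq0 (negbTE z0) !andbF.
have : (N (A `|` [set 0%R]) <= N A + N [set 0%R])%E by exact: measureU2.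
by rewrite NU [X in (_ <= X + _)%E]NA0 gauss_set1 adde0 lee_fin ler10.
Qed.

Lemma integrable_gauss_sqr : N.-integrable setT (fun z => (z ^+ 2)%:E).
Proof. exact: (integrable_gauss_even 1). Qed.

Lemma integral_gauss_sqr : (\int[N]_z (z ^+ 2)%:E = (gauss_moment 1)%:E)%E.
Proof. exact: (integral_gauss_even 1). Qed.

Lemma integrable_gauss_id : N.-integrable setT (EFin : R -> \bar R).
Proof.
apply: (@le_integrable _ _ _ N setT _ _ (fun z => 1 + (z ^+ 2)%:E)%E) => //.
- move=> z _; rewrite -EFinD /= lee_fin [leRHS]ger0_norm; last by rewrite addr_ge0// sqr_ge0.
  have := sqr_ge0 (`|z| - 1); rewrite sqrrB real_normK ?num_real//.
  have := sqr_ge0 z; lra.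
- apply: integrableD => //; last exact: integrable_gauss_sqr.
  exact: (@bounded_integrable _ _ _ N (fun=> 1) `|1|).
Qed.

Lemma integral_gauss_id : (\int[N]_z z%:E = 0)%E.
Proof.
have E : (\int[N]_z z%:E = \int[N]_z (- z)%:E)%E.
  apply: (@integral_transfer _ _ R R R N N -%R) => //.
  - by move=> A mA; rewrite -[LHS]gauss_opp.
  - exact: integrable_gauss_id.
have fi : (\int[N]_z z%:E)%E \is a fin_num.
  by apply: integrable_fin_num => //; exact: integrable_gauss_id.
move: E; under [in X in _ = X -> _]eq_integral do rewrite -mulN1r EFinM.
rewrite integralZl//; last exact: integrable_gauss_id.
rewrite -(fineK fi) -EFinM => -[E]; congr EFin; lra.
Qed.

Lemma gauss_fst (A : set R) : measurable A -> N A = NN (fst @^-1` A).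
Proof.
move=> mA; have -> : fst @^-1` A = A `*` [set: R] by apply/predeqP => -[u v] /=; split=> [|[]].
rewrite product_measure1E// -[LHS]mule1; congr (_ * _)%E.
by apply/esym; exact: (@probability_setT _ _ _ N).
Qed.

Lemma gauss_snd (A : set R) : measurable A -> N A = NN (snd @^-1` A).
Proof.
move=> mA; have -> : snd @^-1` A = [set: R] `*` A by apply/predeqP => -[u v] /=; split=> [|[]].
rewrite product_measure1E// -[LHS]mul1e; congr (_ * _)%E.
by apply/esym; exact: (@probability_setT _ _ _ N).
Qed.

Lemma integrable_gauss2 (f : R -> \bar R) : N.-integrable setT f -> measurable_fun setT f ->
  [/\ NN.-integrable setT (fun z => f z.1), NN.-integrable setT (fun z => f z.2),
      (\int[NN]_z f z.1 = \int[N]_z f z)%E & (\int[NN]_z f z.2 = \int[N]_z f z)%E].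
Proof.
move=> fi mf; split.
- by apply/(@integrable_transferE _ _ _ _ _ NN N fst f _ gauss_fst).
- by apply/(@integrable_transferE _ _ _ _ _ NN N snd f _ gauss_snd).
- by apply/esym; apply: (@integral_transfer _ _ _ _ _ NN N fst f _ gauss_fst).
- by apply/esym; apply: (@integral_transfer _ _ _ _ _ NN N snd f _ gauss_snd).
Qed.

Lemma integral_gauss2_mul : NN.-integrable setT (fun z => (z.1 * z.2)%:E) /\
  (\int[NN]_z (z.1 * z.2)%:E = 0)%E.
Proof.
have [i1 i2 _ _] := integrable_gauss2 integrable_gauss_sqr msq.
have mm : measurable_fun setT (fun z : R * R => (z.1 * z.2)%:E).
  by apply/measurable_EFinP; exact: measurable_funM.
have ii : NN.-integrable setT (fun z => (z.1 * z.2)%:E).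
  apply: (@le_integrable _ _ _ NN setT _ _ (fun z => (z.1 ^+ 2)%:E + (z.2 ^+ 2)%:E)%E) => //.
  - move=> -[x y] _; rewrite -EFinD /= lee_fin [leRHS]ger0_norm; last by rewrite addr_ge0// sqr_ge0.
    rewrite normrM; have := sqr_ge0 (`|x| - `|y|); rewrite sqrrB !real_normK ?num_real//.
    have := sqr_ge0 x; have := sqr_ge0 y; have : 0 <= `|x| * `|y| by rewrite mulr_ge0.
    lra.
  - exact: integrableD.
split => //; rewrite -integral12_prod_meas1//.
rewrite (eq_integral (cst 0%E)) ?integral0// => x _; rewrite /fubini_F /=.
under eq_integral do rewrite EFinM.
rewrite integralZl//; last exact: integrable_gauss_id.
by rewrite integral_gauss_id mule0.
Qed.

Lemma ge0_integral_gauss2_oppr (f : R * R -> \bar R) : measurable_fun setT f ->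
  (forall z, 0 <= f z)%E -> (\int[NN]_z f (z.1, (- z.2)%R) = \int[NN]_z f z)%E.
Proof.
move=> mf f0.
have mo : measurable_fun setT (fun z : R * R => (z.1, - z.2)).
  by apply/measurable_fun_pairP; split; [exact: measurable_fst|exact: (measurable_funN measurable_snd)].
rewrite [RHS](@fubini_tonelli1 _ _ _ _ _ N N _ mf f0).
rewrite (@fubini_tonelli1 _ _ _ _ _ N N _ (measurableT_comp mf mo) (fun z => f0 _)).
apply: eq_integral => x _; rewrite /fubini_F /=.
apply: (@ge0_integral_normalN R (fun y => f (x, y))) => //.
exact: (measurableT_comp mf (pair1_measurable x)).
Qed.

(** One formula yields the means, second moments and mixed moment of an affine image of a Gaussian
    pair, by choice of the coefficients. *)
Lemma integral_gauss2_quadratic (a b1 b2 c1 c2 c12 : R) :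
  let q (z : R * R) := a + b1 * z.1 + b2 * z.2 + c1 * z.1 ^+ 2 + c2 * z.2 ^+ 2 + c12 * (z.1 * z.2) in
  NN.-integrable setT (EFin \o q) /\
  (\int[NN]_z (q z)%:E = (a + (c1 + c2) * gauss_moment 1)%:E)%E.
Proof.
have [i1 i2 e1 e2] := integrable_gauss2 integrable_gauss_id mid.
have [s1 s2 es1 es2] := integrable_gauss2 integrable_gauss_sqr msq.
have [i12 e12] := integral_gauss2_mul.
have icst : NN.-integrable setT (EFin \o cst a).
  exact: (@bounded_integrable _ _ _ NN (fun=> a) `|a|).
have iZ (k : R) (f : R * R -> R) : NN.-integrable setT (EFin \o f) ->
    NN.-integrable setT (EFin \o (fun z => k * f z)).
  by move=> fi; exact: (integrableZl measurableT k fi).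
have iD (f g : R * R -> R) : NN.-integrable setT (EFin \o f) -> NN.-integrable setT (EFin \o g) ->
    NN.-integrable setT (EFin \o (fun z => f z + g z)).
  by move=> fi gi; exact: (integrableD measurableT fi gi).
have j1 := iD _ _ icst (iZ b1 _ i1).
have j2 := iD _ _ j1 (iZ b2 _ i2).
have j3 := iD _ _ j2 (iZ c1 _ s1).
have j4 := iD _ _ j3 (iZ c2 _ s2).
split; first exact: iD _ _ j4 (iZ c12 _ i12).
rewrite /= (integralD_EFin measurableT j4 (iZ c12 _ i12)).
rewrite (integralD_EFin measurableT j3 (iZ c2 _ s2)).
rewrite (integralD_EFin measurableT j2 (iZ c1 _ s1)).
rewrite (integralD_EFin measurableT j1 (iZ b2 _ i2)).
rewrite (integralD_EFin measurableT icst (iZ b1 _ i1)).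
have eZ (k : R) (f : R * R -> R) (r : R) : NN.-integrable setT (EFin \o f) ->
    (\int[NN]_z (f z)%:E = r%:E)%E -> (\int[NN]_z (k * f z)%:E = (k * r)%:E)%E.
  by move=> fi fr; under eq_integral do rewrite EFinM; rewrite integralZl// fr.
rewrite (eZ _ _ 0 i1); last by rewrite e1 integral_gauss_id.
rewrite (eZ _ _ 0 i2); last by rewrite e2 integral_gauss_id.
rewrite (eZ _ _ (gauss_moment 1) s1); last by rewrite es1 integral_gauss_sqr.
rewrite (eZ _ _ (gauss_moment 1) s2); last by rewrite es2 integral_gauss_sqr.
have ea : (\int[NN]_z (cst a z)%:E = a%:E)%E.
  transitivity (\int[NN]_z cst a%:E z)%E; first by [].
  rewrite integral_cst// -[RHS]mule1; congr (_ * _)%E.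
  exact: (@probability_setT _ _ _ NN).
have e12' := eZ c12 _ 0 i12 e12.
transitivity (a%:E + (b1 * 0)%:E + (b2 * 0)%:E + (c1 * gauss_moment 1)%:E +
    (c2 * gauss_moment 1)%:E + (c12 * 0)%:E)%E.
  by congr (_ + _ + _ + _ + _ + _)%E; [exact: ea|exact: e12'].
by rewrite -!EFinD; congr EFin; ring.
Qed.

End gaussian_moments.

(** * Normal form of a standardised Gaussian pair *)

Section gaussian_pair.
Context d (T : measurableType d) (R : realType) (P : probability T R).
Local Notation N := (gauss R).
Local Notation NN := (gauss R \x gauss R)%E.
Variable X : T -> R * R.
Hypothesis mX : measurable_fun setT X.

Let affine_law : bivariate_gaussian P X -> exists m1 m2 a11 a12 a21 a22 : R,
  forall B, measurable B -> P (X @^-1` B) =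
    NN [set z : R * R | B (m1 + a11 * z.1 + a12 * z.2, m2 + a21 * z.1 + a22 * z.2)].
Proof.
move=> [m1 [m2 [a11 [a12 [a21 [a22 H]]]]]]; exists m1, m2, a11, a12, a21, a22 => B mB.
rewrite H// product_gaussE//; rewrite -[X in measurable X]setTI.
apply: (_ : measurable_fun setT (fun z : R * R =>
  (m1 + a11 * z.1 + a12 * z.2, m2 + a21 * z.1 + a22 * z.2))) => //.
by apply/measurable_fun_pairP; split => /=; apply: measurable_funD;
  try apply: measurable_funD; try apply: measurable_funM.
Qed.

Hypothesis stdX1 : standard_normal P (fun w => (X w).1).
Hypothesis stdX2 : standard_normal P (fun w => (X w).2).

(** Matching means and variances gives [m1 = m2 = 0] and rows of unit length, whose inner product is
    the correlation. Rotating the first row onto the first axis turns the second row into [(rho, s)]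
    with [s] the determinant, and a reflection of [z.2] makes [s] nonnegative. *)
Lemma gaussian_pair_law : bivariate_gaussian P X ->
  let rho := correlation P (fun w => (X w).1) (fun w => (X w).2) in
  -1 <= rho <= 1 /\ forall B, measurable B -> P (X @^-1` B) =
    NN [set z : R * R | B (z.1, rho * z.1 + Num.sqrt (1 - rho ^+ 2) * z.2)].
Proof.
move=> /affine_law[m1 [m2 [a11 [a12 [a21 [a22 H]]]]]].
pose A (z : R * R) := (m1 + a11 * z.1 + a12 * z.2, m2 + a21 * z.1 + a22 * z.2).
have mA : measurable_fun setT A.
  by apply/measurable_fun_pairP; split => /=; apply: measurable_funD;
    try apply: measurable_funD; try apply: measurable_funM.
have mX1 : measurable_fun setT (fun w => (X w).1) by exact: measurableT_comp.
have mX2 : measurable_fun setT (fun w => (X w).2) by exact: measurableT_comp.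
have lawA (f : R * R -> R) : measurable_fun setT f -> NN.-integrable setT (fun z => (f (A z))%:E) ->
    (\int[P]_w (f (X w))%:E = \int[NN]_z (f (A z))%:E)%E.
  move=> mf fi; have mEf : measurable_fun setT (EFin \o f) by exact/measurable_EFinP.
  have QP B : measurable B -> pushforward P X B = P (X @^-1` B) by [].
  have QN B : measurable B -> pushforward P X B = NN (A @^-1` B) by move=> mB; exact: H.
  have iQ := (integrable_transferE mA QN mEf).2 fi.
  by rewrite -(integral_transfer mX QP mEf (iQ mX)) (integral_transfer mA QN mEf (iQ mX)).
have law1 (f : R -> R) : measurable_fun setT f -> N.-integrable setT (EFin \o f) ->
    (\int[P]_w (f (X w).1)%:E = \int[N]_z (f z)%:E)%E.
  move=> mf fi; apply/esym; apply: (@integral_transfer _ _ _ _ _ P N (fun w => (X w).1) (EFin \o f)) => //.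
  - by move=> B mB; exact: (esym (stdX1 mB)).
  - exact/measurable_EFinP.
have law2 (f : R -> R) : measurable_fun setT f -> N.-integrable setT (EFin \o f) ->
    (\int[P]_w (f (X w).2)%:E = \int[N]_z (f z)%:E)%E.
  move=> mf fi; apply/esym; apply: (@integral_transfer _ _ _ _ _ P N (fun w => (X w).2) (EFin \o f)) => //.
  - by move=> B mB; exact: (esym (stdX2 mB)).
  - exact/measurable_EFinP.
have quad (f : R * R -> R) a b1 b2 c1 c2 c12 : measurable_fun setT f ->
    (forall z, f (A z) = a + b1 * z.1 + b2 * z.2 + c1 * z.1 ^+ 2 + c2 * z.2 ^+ 2 + c12 * (z.1 * z.2)) ->
    (\int[P]_w (f (X w))%:E = (a + (c1 + c2) * gauss_moment R 1)%:E)%E.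
  move=> mf fE; have [i e] := integral_gauss2_quadratic a b1 b2 c1 c2 c12.
  rewrite lawA//; first by rewrite -e; apply: eq_integral => z _; rewrite fE.
  by under eq_fun do rewrite fE; exact: i.
have E1 : (\int[P]_w ((X w).1)%:E = 0)%E.
  exact: etrans (law1 idfun (@measurable_id _ _ _) (integrable_gauss_id R)) (integral_gauss_id R).
have E2 : (\int[P]_w ((X w).2)%:E = 0)%E.
  exact: etrans (law2 idfun (@measurable_id _ _ _) (integrable_gauss_id R)) (integral_gauss_id R).
have m10 : m1 = 0.
  have := quad fst m1 a11 a12 0 0 0; rewrite E1 => h.
  have : (0 = (m1 + (0 + 0) * gauss_moment R 1)%:E)%E by apply: h => //= z; ring.
  by move=> [->]; ring.
have m20 : m2 = 0.
  have := quad snd m2 a21 a22 0 0 0; rewrite E2 => h.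
  have : (0 = (m2 + (0 + 0) * gauss_moment R 1)%:E)%E by apply: h => //= z; ring.
  by move=> [->]; ring.
have v0 := gauss_moment_gt0 R 1.
have msqr : measurable_fun setT (fun z : R => z ^+ 2) by exact: measurable_funX.
have V1 : (\int[P]_w ((X w).1 ^+ 2)%:E = (gauss_moment R 1)%:E)%E.
  exact: etrans (law1 _ msqr (integrable_gauss_sqr R)) (integral_gauss_sqr R).
have V2 : (\int[P]_w ((X w).2 ^+ 2)%:E = (gauss_moment R 1)%:E)%E.
  exact: etrans (law2 _ msqr (integrable_gauss_sqr R)) (integral_gauss_sqr R).
have u1 : a11 ^+ 2 + a12 ^+ 2 = 1.
  have h0 : ((gauss_moment R 1)%:E = (0 + (a11 ^+ 2 + a12 ^+ 2) * gauss_moment R 1)%:E).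
    rewrite -V1; apply: (quad (fun z => z.1 ^+ 2) 0 0 0 (a11 ^+ 2) (a12 ^+ 2) (2 * a11 * a12)).
      exact: measurable_funX.
    by move=> z; rewrite /A/= m10; ring.
  by case: h0; rewrite add0r => h; apply: (mulIf (lt0r_neq0 v0)); rewrite mul1r.
have u2 : a21 ^+ 2 + a22 ^+ 2 = 1.
  have h0 : ((gauss_moment R 1)%:E = (0 + (a21 ^+ 2 + a22 ^+ 2) * gauss_moment R 1)%:E).
    rewrite -V2; apply: (quad (fun z => z.2 ^+ 2) 0 0 0 (a21 ^+ 2) (a22 ^+ 2) (2 * a21 * a22)).
      exact: measurable_funX.
    by move=> z; rewrite /A/= m20; ring.
  by case: h0; rewrite add0r => h; apply: (mulIf (lt0r_neq0 v0)); rewrite mul1r.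
have C12 : (\int[P]_w ((X w).1 * (X w).2)%:E = ((a11 * a21 + a12 * a22) * gauss_moment R 1)%:E)%E.
  rewrite (quad (fun z => z.1 * z.2) 0 0 0 (a11 * a21) (a12 * a22) (a11 * a22 + a12 * a21)).
  - by rewrite add0r.
  - exact: measurable_funM.
  - by move=> z; rewrite /A/= m10 m20; ring.
have covE (Y Z : T -> R) : (\int[P]_w (Y w)%:E = 0)%E -> (\int[P]_w (Z w)%:E = 0)%E ->
    covariance P Y Z = (\int[P]_w (Y w * Z w)%:E)%E.
  move=> Y0 Z0; rewrite covariance.unlock expectation.unlock Y0 Z0.
  by apply: eq_integral => w _ /=; rewrite !fctE/= !subr0.
have rhoE : correlation P (fun w => (X w).1) (fun w => (X w).2) = a11 * a21 + a12 * a22.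
  rewrite /correlation /variance !covE// C12.
  under eq_integral do rewrite -expr2.
  rewrite V1; under eq_integral do rewrite -expr2.
  rewrite V2 /= -expr2 sqrtr_sqr gtr0_norm// mulfK//; exact: lt0r_neq0.
rewrite /= rhoE; set rho := a11 * a21 + a12 * a22.
pose s := - a12 * a21 + a11 * a22.
(* Lagrange's identity: the left-hand side is the product of the squared lengths of the two rows. *)
have rs : rho ^+ 2 + s ^+ 2 = 1.
  rewrite -[RHS](mulr1 1) -{1}u1 -u2 /rho /s; ring.
have rho1 : rho ^+ 2 <= 1 by rewrite -rs lerDl sqr_ge0.
split; first by nra.
move=> B mB; transitivity (NN (A @^-1` B)); first exact: H.
have sE : 1 - rho ^+ 2 = s ^+ 2 by rewrite -rs; ring.
rewrite sE sqrtr_sqr.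
have mC k : measurable_fun setT (fun z : R * R => (z.1, rho * z.1 + k * z.2)).
  apply/measurable_fun_pairP; split; first exact: measurable_fst.
  by apply: measurable_funD; apply: measurable_funM.
have ind (g : R * R -> R * R) : measurable_fun setT g ->
    NN (g @^-1` B) = (\int[NN]_z (\1_B (g z))%:E)%E.
  move=> mg; have mgB : measurable (g @^-1` B) by rewrite -[X in measurable X]setTI; exact: mg.
  by rewrite -[g @^-1` B]setIT -integral_indic//.
have mB1 : measurable_fun setT (fun z => (\1_B z : R)%:E).
  by apply/measurable_EFinP; exact: measurable_indic.
rewrite (ind A mA).
transitivity (NN ((fun z : R * R => (z.1, rho * z.1 + `|s| * z.2)) @^-1` B)); last by [].
rewrite (ind _ (mC `|s|)).
have -> : (\int[NN]_z (\1_B (A z))%:E = \int[NN]_z (\1_B (z.1, rho * z.1 + s * z.2)%R)%:E)%E.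
  rewrite -[RHS](ge0_integral_rotation u1)//; last first.
  - exact: (measurableT_comp mB1 (mC s)).
  apply: eq_integral => z _; congr ((\1_B _)%:E); rewrite /A /= m10 m20 !add0r; congr (_, _).
  rewrite -[a21 * z.1]mul1r -[a22 * z.2]mul1r -{1}u1 -u1 /rho /s; ring.
have [s0|s0] := leP 0 s; first by rewrite ger0_norm.
rewrite -[RHS](@ge0_integral_gauss2_oppr R (fun z => (\1_B (z.1, rho * z.1 + `|s| * z.2)%R)%:E))//.
  by apply: eq_integral => z _; rewrite /= ltr0_norm// mulrNN.
exact: (measurableT_comp mB1 (mC `|s|)).
Qed.

End gaussian_pair.

(** * Gaussian tails *)

Section exponential_tail.
Context (R : realType).
Local Notation leb := (leb R).

Let mexpN (h : R -> R) : measurable_fun setT h -> measurable_fun setT (fun s => expR (- h s)).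
Proof. by move=> mh; apply: measurableT_comp => //; exact: measurable_funN. Qed.

Lemma integral_expN_ray (x : R) :
  (\int[leb]_s (\1_`[x, +oo[ s * expR (- s))%:E = (expR (- x))%:E)%E.
Proof.
have mi : measurable_fun setT (\1_`[x, +oo[%classic : R -> R) by exact: measurable_indic.
have m1 : measurable_fun setT (fun s : R => (\1_`[x, +oo[%classic s * expR (- s))%:E).
  by apply/measurable_EFinP; apply: measurable_funM => //; exact: (mexpN (@measurable_id _ _ _)).
have mp : measurable_fun setT (fun t : R => (exponential_pdf 1 t)%:E).
  by apply/measurable_EFinP; exact: measurable_exponential_pdf.
rewrite (@ge0_integral_affine R 1 x)// normr1 mul1e.
transitivity (\int[leb]_t ((expR (- x))%:E * (exponential_pdf 1 t)%:E))%E.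
  apply: eq_integral => t _; rewrite -EFinM; congr EFin.
  rewrite /exponential_pdf patchE mem_setE in_itv/= andbT indicE mem_setE in_itv/= andbT mul1r.
  rewrite lerDr; case: ifP => _; last by rewrite mul0r mulr0.
  by rewrite mul1r mul1r -expRD; congr expR; ring.
rewrite ge0_integralZl//.
- by rewrite -ge0_integral_lebE// ?integral_exponential_pdf ?mule1// => t _; rewrite lee_fin exponential_pdf_ge0.
- by move=> t _; rewrite lee_fin exponential_pdf_ge0.
Qed.

Lemma integral_expN_oray (x : R) :
  (\int[leb]_s (\1_`]x, +oo[ s * expR (- s))%:E = (expR (- x))%:E)%E.
Proof.
have me A : measurable A -> measurable_fun A (fun s : R => (expR (- s))%:E).
  move=> mA; apply/measurable_EFinP; apply: measurable_funTS.
  exact: (mexpN (@measurable_id _ _ _)).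
have E (A : set R) : measurable A -> (\int[leb]_s (\1_A s * expR (- s))%:E =
    \int[@lebesgue_measure R]_(s in A) (expR (- s))%:E)%E.
  move=> mA; rewrite ge0_integral_lebE//; last exact: me.
  rewrite [RHS]integral_mkcond; apply: eq_integral => s _.
  by rewrite patchE indicE; case: ifP => _; rewrite ?mul1r ?mul0r.
rewrite -integral_expN_ray !E//; apply: integral_itv_obnd_cbnd.
exact: me.
Qed.

End exponential_tail.

Section gaussian_tail.
Context (R : realType).
Local Notation N := (gauss R).
Local Notation leb := (leb R).

Definition scaled_tail (n : nat) (b x : R) : R := n%:R * fine (N `]b + x / b, +oo[).

(** Substitute [z = b + s / b]. The equation [b = n phi(b)] turns the prefactor [n phi(b) / b] into
    1, leaving [exp(-s - s^2 / (2 b^2))]. *)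
Lemma scaled_tailE n b x : 0 < b -> b = n%:R * normal_pdf 0 1 b ->
  ((scaled_tail n b x)%:E =
   \int[leb]_s (\1_`]x, +oo[ s * expR (- (s + s ^+ 2 / (2 * b ^+ 2))))%:E)%E.
Proof.
move=> b0 bn.
have mphi : measurable_fun setT (fun z : R => (normal_pdf 0 1 z)%:E).
  by apply/measurable_EFinP; exact: measurable_normal_pdf.
have mi (A : set R) : measurable A -> measurable_fun setT (fun z => (\1_A z : R)%:E).
  by move=> mA; apply/measurable_EFinP; exact: measurable_indic.
rewrite /scaled_tail EFinM fineK ?fin_num_measure//.
rewrite gaussE// integral_mkcond.
rewrite (eq_integral (fun z => (\1_`]b + x / b, +oo[ z)%:E * (normal_pdf 0 1 z)%:E)%E); last first.
  move=> z _; rewrite patchE indicE; case: ifP => _; by rewrite ?mul1e ?mul0e.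
rewrite [in LHS](@ge0_integral_affine R b^-1 b)//; last 2 first.
- by apply: emeasurable_funM => //; exact: mi.
- by move=> z; rewrite mule_ge0// lee_fin ?normal_pdf_ge0.
rewrite gtr0_norm ?invr_gt0// muleA -EFinM -ge0_integralZl//; last 3 first.
- apply: (@measurableT_comp _ _ _ _ _ _ (fun z => (\1_`]b + x / b, +oo[ z)%:E * (normal_pdf 0 1 z)%:E)%E).
    by apply: emeasurable_funM => //; exact: mi.
  by apply: measurable_funD => //; exact: measurable_funM.
- by move=> z _; rewrite mule_ge0// lee_fin ?normal_pdf_ge0.
- by rewrite lee_fin divr_ge0// ltW.
apply: eq_integral => s _; rewrite -!EFinM; congr EFin.
rewrite mulrCA; congr (_ * _).
  rewrite !indicE !mem_setE !in_itv/= !andbT; congr (_%:R).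
  by rewrite [b^-1 * s + b]addrC ltrD2l [b^-1 * s]mulrC ltr_pM2r ?invr_gt0.
rewrite mulrAC; apply: (mulIf (lt0r_neq0 b0)); rewrite divfK ?lt0r_neq0//.
transitivity (expR (- (s + s ^+ 2 / (2 * b ^+ 2))) * (n%:R * normal_pdf 0 1 b)); last by rewrite -bn.
rewrite !normal_pdf01E.
have -> : expR (- (b^-1 * s + b) ^+ 2 / 2) = expR (- (s + s ^+ 2 / (2 * b ^+ 2))) * expR (- b ^+ 2 / 2).
  by rewrite -expRD; congr expR; field; exact: lt0r_neq0.
ring.
by rewrite invr_eq0 gt_eqF.
Qed.

Let mtail (x : R) (q : R) : measurable_fun setT
  (fun s : R => (\1_`]x, +oo[%classic s * expR (- (s + s ^+ 2 / q)))%:E).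
Proof.
apply/measurable_EFinP; apply: measurable_funM; first exact: measurable_indic.
apply: measurableT_comp => //; apply: measurable_funN; apply: measurable_funD => //.
by apply: measurable_funM => //; exact: measurable_funX.
Qed.

Let tail_dom (x q s : R) : 0 <= q ->
  \1_`]x, +oo[%classic s * expR (- (s + s ^+ 2 / q)) <= \1_`[x, +oo[%classic s * expR (- s).
Proof.
move=> q0; rewrite !indicE !mem_setE !in_itv/= !andbT.
have [xs|xs] := ltP x s; last by rewrite mul0r mulr_ge0// expR_ge0.
by rewrite (ltW xs) !mul1r ler_expR lerN2 lerDl divr_ge0// sqr_ge0.
Qed.

Let mdom (x : R) : measurable_fun setT (fun s : R => (\1_`[x, +oo[%classic s * expR (- s))%:E).
Proof.
apply/measurable_EFinP; apply: measurable_funM; first exact: measurable_indic.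
by apply: measurableT_comp => //; exact: measurable_funN.
Qed.

(** The quadratic term of the exponent only decreases the integrand. Uniformity in [n] makes this
    the dominating bound for the conditional tails below. *)
Lemma scaled_tail_le n b x : 0 < b -> b = n%:R * normal_pdf 0 1 b ->
  scaled_tail n b x <= expR (- x).
Proof.
move=> b0 bn; rewrite -lee_fin scaled_tailE// -integral_expN_ray.
apply: ge0_le_integral => //.
- by move=> s _; rewrite lee_fin tail_dom// mulr_ge0// sqr_ge0.
Qed.

Lemma scaled_tail_noninc n b x y : 0 < b -> x <= y -> scaled_tail n b y <= scaled_tail n b x.
Proof.
move=> b0 xy; rewrite ler_wpM2l//; apply: fine_le; rewrite ?fin_num_measure//.
apply: le_measure; rewrite ?inE//; apply: subset_itvr.
by rewrite bnd_simp lerD2l ler_pM2r// invr_gt0.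
Qed.

Variables (n_ : nat -> nat) (b_ : nat -> R).
Hypothesis b0 : forall k, 0 < b_ k.
Hypothesis bn : forall k, b_ k = (n_ k)%:R * normal_pdf 0 1 (b_ k).
Hypothesis boo : b_ k @[k --> \oo] --> +oo.

Let cvg_binv : (b_ k)^-1 @[k --> \oo] --> (0 : R).
Proof. by apply/gtr0_cvgV0 => //; exact: nearW. Qed.

Lemma cvg_scaled_tail x : scaled_tail (n_ k) (b_ k) x @[k --> \oo] --> expR (- x).
Proof.
have E k : ((scaled_tail (n_ k) (b_ k) x)%:E =
   \int[leb]_s (\1_`]x, +oo[ s * expR (- (s + s ^+ 2 / (2 * b_ k ^+ 2))))%:E)%E.
  exact: scaled_tailE.
suff : (scaled_tail (n_ k) (b_ k) x)%:E @[k --> \oo] --> (expR (- x))%:E.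
  by move=> /fine_cvgP[].
under eq_fun do rewrite E.
rewrite -integral_expN_oray.
apply: (@dominated_cvg _ _ _ leb setT measurableT _ _
  (fun s => (\1_`[x, +oo[%classic s * expR (- s))%:E)) => //.
- by move=> s _; apply: cvg_EFin; [exact: nearW|]; apply: cvgMr;
    apply: (continuous_cvg _ (@continuous_expR R _)); apply: cvgN;
    rewrite -[X in _ --> X]addr0; apply: cvgD; [exact: cvg_cst|];
    rewrite -(mulr0 (s ^+ 2)); apply: cvgMr;
    under eq_fun do rewrite invfM -exprVn expr2 mulrA;
    rewrite -(mulr0 (2^-1 * 0)); apply: cvgM; [apply: cvgMr|]; exact: cvg_binv.
- apply/integrableP; split; first exact: mdom.
  under eq_integral do rewrite /= ger0_norm ?mulr_ge0 ?expR_ge0//.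
  by rewrite integral_expN_ray ltry.
- move=> k s _; rewrite gee0_abs ?lee_fin ?mulr_ge0 ?expR_ge0//.
  by rewrite tail_dom// mulr_ge0// sqr_ge0.
Qed.

(** Monotonicity in the level extends the limit to moving levels: [x_ k] is enclosed between
    [x - d / 2] and [x + d / 2], and the limit is continuous in the level. *)
Lemma cvg_scaled_tail2 (x_ : nat -> R) x : x_ k @[k --> \oo] --> x ->
  scaled_tail (n_ k) (b_ k) (x_ k) @[k --> \oo] --> expR (- x).
Proof.
move=> cx; apply/cvgrPdist_lt => eps eps0.
have ce : expR (- z) @[z --> x] --> expR (- x).
  by apply: (@continuous_comp _ _ _ (fun z : R => - z) expR); [exact: opp_continuous|exact: continuous_expR].
have /cvgrPdist_lt/(_ _ (divr_gt0 eps0 (ltr0n _ 2)))/nbhs_ballP[d /= d0 Hd] := ce.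
have dx (s : R) : `|s| <= 1 -> `|expR (- x) - expR (- (x + s * (d / 2)))| < eps / 2.
  move=> s1; apply: Hd; rewrite /ball/= opprD addNKr normrN normrM (gtr0_norm (divr_gt0 d0 (ltr0n _ 2))).
  have : `|s| * (d / 2) <= d / 2 by rewrite ler_piMl// ltW// divr_gt0.
  by lra.
have e2 : 0 < eps / 2 by rewrite divr_gt0.
have /cvgrPdist_lt/(_ _ e2) c1 := @cvg_scaled_tail (x + d / 2).
have /cvgrPdist_lt/(_ _ e2) c2 := @cvg_scaled_tail (x - d / 2).
near=> k.
have xk : x - d / 2 <= x_ k <= x + d / 2.
  have : `|x - x_ k| < d / 2.
    by near: k; move/cvgrPdist_lt : cx; apply; rewrite divr_gt0.
  by rewrite ltr_norml; lra.
have [lo hi] : scaled_tail (n_ k) (b_ k) (x + d / 2) <= scaled_tail (n_ k) (b_ k) (x_ k) /\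
    scaled_tail (n_ k) (b_ k) (x_ k) <= scaled_tail (n_ k) (b_ k) (x - d / 2).
  by case/andP: xk => ? ?; split; exact: scaled_tail_noninc.
have a1 : `|expR (- (x + d / 2)) - scaled_tail (n_ k) (b_ k) (x + d / 2)| < eps / 2.
  by near: k.
have a2 : `|expR (- (x - d / 2)) - scaled_tail (n_ k) (b_ k) (x - d / 2)| < eps / 2.
  by near: k.
have := dx 1; rewrite normr1 mul1r => /(_ (lexx _)) d1.
have := dx (-1); rewrite normrN1 mulN1r => /(_ (lexx _)) d2.
move: lo hi a1 a2 d1 d2; rewrite !ltr_norml; move: (scaled_tail _ _ (x_ k))
  (scaled_tail _ _ (x + _)) (scaled_tail _ _ (x - _)) (expR _) (expR _) (expR _) => *; lra.
Unshelve. all: by end_near. Qed.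

End gaussian_tail.

(** * Joint tails, uniformly in the correlation *)

Section joint_tail.
Context (R : realType).
Local Notation N := (gauss R).
Local Notation NN := (N \x N)%E.
Local Notation e := (@expN_extnng R).

Definition tail_set (b rho x y : R) : set (R * R) :=
  [set z | b + x / b < z.1 /\ b + y / b < rho * z.1 + Num.sqrt (1 - rho ^+ 2) * z.2].

Definition joint_tail (n : nat) (b rho x y : R) : R :=
  n%:R * fine (NN (tail_set b rho x y)).

(** The scaled joint tail given the independent component [z]. For positive [rho] both constraints
    are upper half-lines in [t], so a tail in one variable remains. *)
Definition tail_slice (n : nat) (b rho x y z : R) : R :=
  n%:R * fine (N [set t : R | tail_set b rho x y (t, z)]).

Lemma measurable_tail_set b rho x y : measurable (tail_set b rho x y).
Proof.
have -> : tail_set b rho x y = fst @^-1` `]b + x / b, +oo[ `&`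
    (fun z : R * R => rho * z.1 + Num.sqrt (1 - rho ^+ 2) * z.2) @^-1` `]b + y / b, +oo[.
  by apply/predeqP => z; rewrite /tail_set /= !in_itv/= !andbT.
apply: measurableI; rewrite -[X in measurable X]setTI.
  exact: measurable_fst.
apply: (_ : measurable_fun setT (fun z : R * R => rho * z.1 + Num.sqrt (1 - rho ^+ 2) * z.2)) => //.
by apply: measurable_funD; apply: measurable_funM => //; exact: measurable_snd.
Qed.

Let mtail := measurable_tail_set.

Lemma measurable_tail_section b rho x y z :
  measurable [set t : R | tail_set b rho x y (t, z)].
Proof.
rewrite -[X in measurable X]setTI.
exact: (pair2_measurable z measurableT (mtail b rho x y)).
Qed.

Let sliceE n b rho x y z :
  tail_slice n b rho x y z = n%:R * fine (\int[N]_t (\1_(tail_set b rho x y) (t, z))%:E)%E.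
Proof.
rewrite /tail_slice; congr (_ * fine _).
rewrite -(integral_gauss_indic (measurable_tail_section b rho x y z)).
by apply: eq_integral => t _; rewrite !indicE; congr (_%:R)%:E; congr nat_of_bool;
  apply/idP/idP; rewrite !inE.
Qed.

Let mind b rho x y : measurable_fun setT
  (fun z : R * R => (\1_(tail_set b rho x y) z)%:E : \bar R).
Proof. by apply/measurable_EFinP; exact: measurable_indic. Qed.

Let ind0 b rho x y : forall z : R * R, (0 <= (\1_(tail_set b rho x y) z)%:E :> \bar R)%E.
Proof. by move=> z; rewrite lee_fin. Qed.

Lemma measurable_tail_slice n b rho x y : measurable_fun setT (tail_slice n b rho x y).
Proof.
rewrite (_ : tail_slice n b rho x y = fun z => n%:R * fine (\int[N]_t (\1_(tail_set b rho x y) (t, z))%:E)%E); last first.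
  by apply/funext => z; exact: sliceE.
apply: measurable_funM => //; apply: measurableT_comp => //.
exact: (@measurable_fun_fubini_tonelli_G _ _ _ _ _ N _ (mind b rho x y) (ind0 b rho x y)).
Qed.

Lemma tail_slice_ge0 n b rho x y z : 0 <= tail_slice n b rho x y z.
Proof. by rewrite mulr_ge0// fine_ge0. Qed.

Let slice_le n b rho x y z (A : set R) : measurable A ->
  [set t : R | tail_set b rho x y (t, z)] `<=` A -> tail_slice n b rho x y z <= n%:R * fine (N A).
Proof.
move=> mA sA; rewrite ler_wpM2l//; apply: fine_le; rewrite ?fin_num_measure//.
  exact: measurable_tail_section.
by apply: le_measure; rewrite ?inE//; exact: measurable_tail_section.
Qed.

Lemma tail_slice_le n b rho x y z : 0 < b -> b = n%:R * normal_pdf 0 1 b ->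
  tail_slice n b rho x y z <= expR (- x).
Proof.
move=> b0 bn; apply: le_trans (scaled_tail_le _ b0 bn).
by apply: slice_le => // t [+ _]; rewrite /= in_itv/= andbT.
Qed.

Lemma joint_tailE n b rho x y : 0 < b -> b = n%:R * normal_pdf 0 1 b ->
  joint_tail n b rho x y = \int[N]_z tail_slice n b rho x y z.
Proof.
move=> b0 bn; rewrite /joint_tail.
have -> : NN (tail_set b rho x y) = (\int[N]_z \int[N]_t (\1_(tail_set b rho x y) (t, z))%:E)%E.
  transitivity (\int[NN]_z (\1_(tail_set b rho x y) z)%:E)%E.
    by rewrite integral_indic ?setIT//; exact: mtail.
  by rewrite (@fubini_tonelli2 _ _ _ _ _ N N _ (mind b rho x y) (ind0 b rho x y)).
have mh : measurable_fun setT (fun z => fine (N [set t : R | tail_set b rho x y (t, z)])).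
  have := measurable_tail_slice 1 b rho x y; rewrite /tail_slice.
  by under eq_fun do rewrite mul1r.
have hb z : `|fine (N [set t : R | tail_set b rho x y (t, z)])| <= 1.
  rewrite ger0_norm ?fine_ge0// -lee_fin fineK; last first.
    by rewrite fin_num_measure//; exact: measurable_tail_section.
  exact: (@probability_le1 _ _ _ N _ (measurable_tail_section b rho x y z)).
have -> : \int[N]_z tail_slice n b rho x y z =
    n%:R * \int[N]_z fine (N [set t : R | tail_set b rho x y (t, z)]).
  have := @RintegralZl _ _ _ N setT _ n%:R measurableT (@bounded_integrable _ _ _ N _ 1 mh hb).
  exact.
congr (_ * _); rewrite /Rintegral; congr fine; apply: eq_integral => z _.
rewrite fineK; last by rewrite fin_num_measure//; exact: measurable_tail_section.
rewrite -(integral_gauss_indic (measurable_tail_section b rho x y z)).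
by apply: eq_integral => t _; rewrite !indicE; congr (_%:R)%:E; congr nat_of_bool;
  apply/idP/idP; rewrite !inE.
Qed.

Lemma joint_tail_ge0 n b rho x y : 0 <= joint_tail n b rho x y.
Proof. by rewrite mulr_ge0// fine_ge0. Qed.

(** For [0 < rho], this is the [s] for which the second constraint at fixed [z] reads
    [b + s / b < t], rewritten by [b^2 (1 - rho) = 2 L^2] and
    [b sqrt(1 - rho^2) = L sqrt(2 (1 + rho))]. For [rho] near 1 it is close to
    [2 L^2 + y - 2 L z]. *)
Definition shifted_level (b rho y z : R) : R :=
  let L := Num.sqrt (b ^+ 2 * (1 - rho) / 2) in
  (2 * L ^+ 2 + y - L * Num.sqrt (2 * (1 + rho)) * z) / rho.

Lemma tail_sliceE n b rho x y z : 0 < b -> 0 < rho -> rho <= 1 ->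
  tail_slice n b rho x y z = scaled_tail n b (Num.max x (shifted_level b rho y z)).
Proof.
move=> b0 r0 r1; rewrite /tail_slice /scaled_tail; congr (_ * fine (N _)).
apply/predeqP => t; rewrite /tail_set /= in_itv/= andbT.
have L2 : Num.sqrt (b ^+ 2 * (1 - rho) / 2) ^+ 2 = b ^+ 2 * (1 - rho) / 2.
  by rewrite sqr_sqrtr// divr_ge0// mulr_ge0 ?sqr_ge0// subr_ge0.
have bs : b * Num.sqrt (1 - rho ^+ 2) =
    Num.sqrt (b ^+ 2 * (1 - rho) / 2) * Num.sqrt (2 * (1 + rho)).
  have {1}-> : b = Num.sqrt (b ^+ 2) by rewrite sqrtr_sqr gtr0_norm.
  have S (u v : R) : 0 <= u -> Num.sqrt u * Num.sqrt v = Num.sqrt (u * v) by move=> u0; rewrite sqrtrM.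
  rewrite !S ?sqr_ge0//; last by rewrite divr_ge0// mulr_ge0 ?sqr_ge0// subr_ge0.
  by congr Num.sqrt; field.
have E : b + shifted_level b rho y z / b = (b + y / b - Num.sqrt (1 - rho ^+ 2) * z) / rho.
  rewrite /shifted_level L2 -bs; field.
  by rewrite !gt_eqF.
have -> : (b + Num.max x (shifted_level b rho y z) / b < t) =
    (b + x / b < t) && (b + shifted_level b rho y z / b < t).
  rewrite !(mulrC _ b^-1) maxr_pMr ?invr_ge0 ?(ltW b0)// addr_maxr.
  by rewrite gt_max.
rewrite E ltr_pdivrMr// ltrBlDr (mulrC t).
by split=> [[-> ->]|/andP[]].
Qed.

(** Meant for lambda tending to oo, where [rho] need not approach 1 and may be negative. If
    [rho > 0], the exponential tail bound applies, and the exponent is negative, so division by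
    [rho <= 1] only improves it. If [rho <= 0], a positive [t] cannot lift the second coordinate
    above [b + y / b > |z|], and the slice is empty. *)
Lemma tail_slice_le_lognormal n b rho x y z : 0 < b -> b = n%:R * normal_pdf 0 1 b ->
  -1 <= rho <= 1 -> 0 < b + x / b -> `|z| < b + y / b ->
  expR `|y| * lognormal (lambda b rho) `|z| < 1 ->
  tail_slice n b rho x y z <= expR `|y| * lognormal (lambda b rho) `|z|.
Proof.
move=> b0 bn /andP[rN1 r1] bx bz; rewrite /lognormal /= -expRD expR_lt1.
set L := Num.sqrt (b ^+ 2 * (1 - rho) / 2).
have L0 : 0 <= L by exact: sqrtr_ge0.
move=> m0; have [r0|r0] := ltP 0 rho.
  rewrite tail_sliceE// (le_trans (scaled_tail_le _ b0 bn))// ler_expR.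
  apply: (@le_trans _ _ (- shifted_level b rho y z)); first by rewrite lerN2 le_max lexx orbT.
  rewrite lerNl /shifted_level -/L ler_pdivlMr//.
  have sq : Num.sqrt (2 * (1 + rho)) <= 2.
    rewrite -[leRHS]ger0_norm// -sqrtr_sqr ler_sqrt ?sqr_ge0//.
    rewrite expr2; lra.
  have zz : Num.sqrt (2 * (1 + rho)) * z <= 2 * `|z|.
    apply: (@le_trans _ _ (Num.sqrt (2 * (1 + rho)) * `|z|)).
        by rewrite ler_wpM2l ?sqrtr_ge0// ler_norm.
    by rewrite ler_wpM2r.
  have Lz : L * Num.sqrt (2 * (1 + rho)) * z <= L * 2 * `|z|.
    by rewrite -!mulrA ler_wpM2l.
  have yy : - `|y| <= y by have := ler_norm (- y); rewrite normrN; lra.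
  apply: (@le_trans _ _ (- (`|y| + (2 * L * `|z| - 2 * L ^+ 2)))).
    by rewrite ler_piMr// oppr_ge0 ltW.
  by move: Lz yy; lra.
apply: (@le_trans _ _ 0); last by rewrite expR_ge0.
rewrite /tail_slice (_ : [set t : R | _] = set0) ?measure0 ?mulr0//.
apply/predeqP => t; split => // -[/= xt yt].
have t0 : 0 < t by exact: lt_trans xt.
have : rho * t <= 0 by rewrite mulr_le0_ge0// ltW.
have : Num.sqrt (1 - rho ^+ 2) * z <= `|z|.
  apply: (@le_trans _ _ (Num.sqrt (1 - rho ^+ 2) * `|z|)).
    by rewrite ler_wpM2l ?sqrtr_ge0// ler_norm.
  by rewrite ler_piMl// -[leRHS]sqrtr1 ler_wsqrtr// gerBl sqr_ge0.
by move: bz yt; lra.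
Qed.

Section cvg_joint_tail.
Variables (n_ : nat -> nat) (b_ rho_ : nat -> R) (l : extnng R).
Hypothesis b0 : forall k, 0 < b_ k.
Hypothesis bn : forall k, b_ k = (n_ k)%:R * normal_pdf 0 1 (b_ k).
Hypothesis boo : b_ k @[k --> \oo] --> +oo.
Hypothesis rho1 : forall k, -1 <= rho_ k <= 1.
Hypothesis cl : e (lambda (b_ k) (rho_ k)) @[k --> \oo] --> e l.

Let cvg_binv : (b_ k)^-1 @[k --> \oo] --> (0 : R).
Proof. by apply/gtr0_cvgV0 => //; exact: nearW. Qed.

Let L k := Num.sqrt (b_ k ^+ 2 * (1 - rho_ k) / 2).

Let cvg_slice0 x y z : e l = 0 -> tail_slice (n_ k) (b_ k) (rho_ k) x y z @[k --> \oo] --> (0 : R).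
Proof.
move=> l0.
have c0 : expR `|y| * lognormal (lambda (b_ k) (rho_ k)) `|z| @[k --> \oo] --> (0 : R).
  rewrite -(mulr0 (expR `|y|)) -(_ : lognormal l `|z| = 0); last by rewrite lognormalE l0 eqxx.
  by apply: cvgMr; exact: cvg_lognormal.
apply: (@squeeze_cvgr _ _ _ _ (fun=> 0) (fun k => expR `|y| * lognormal (lambda (b_ k) (rho_ k)) `|z|)); [|exact: cvg_cst|exact: c0].
have /cvgrPdist_lt/(_ _ ltr01) H := c0.
near=> k; rewrite tail_slice_ge0 /= tail_slice_le_lognormal//.
- have bk1 : 1 <= b_ k by near: k; move/cvgryPge: boo; exact.
  have bkx : `|x| < b_ k by near: k; move/cvgryPgt: boo; exact.
  rewrite -(pmulr_lgt0 _ (b0 k)) mulrDl divfK ?gt_eqF//.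
  have : b_ k <= b_ k * b_ k by rewrite ler_pMl.
  have := ler_norm (- x); rewrite normrN; lra.
- have bk1 : 1 <= b_ k by near: k; move/cvgryPge: boo; exact.
  have bkx : `|y| + `|z| < b_ k by near: k; move/cvgryPgt: boo; exact.
  apply: (lt_le_trans (_ : `|z| < b_ k - `|y|)); first by rewrite ltrBrDl.
  rewrite lerD2l (le_trans (_ : - `|y| <= - `|y / b_ k|))//.
    rewrite lerN2 normrM normfV (gtr0_norm (b0 k)) ler_pdivrMr// ler_peMr//.
  by have := ler_norm (- (y / b_ k)); rewrite normrN; lra.
- have : `|0 - expR `|y| * lognormal (lambda (b_ k) (rho_ k)) `|z| | < 1 by near: k; exact: H.
  by rewrite sub0r normrN; apply: le_lt_trans; exact: ler_norm.
Unshelve. all: by end_near. Qed.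

Let cvg_slice1 x y z : 0 < e l -> tail_slice (n_ k) (b_ k) (rho_ k) x y z @[k --> \oo] -->
  Num.min (expR (- x)) (expR (- y) * lognormal l z).
Proof.
move=> l0.
have LE k : L k = - ln (e (lambda (b_ k) (rho_ k))) by rewrite /expN_extnng/= expRK opprK.
pose t := - ln (e l).
have cL : L k @[k --> \oo] --> t.
  under eq_fun do rewrite LE.
  apply: cvgN; apply: (continuous_cvg _ _ cl); exact: continuous_ln.
(* A convergent [L] and [b] tending to infinity force the correlation to 1, through
   [rho = 1 - 2 (L / b)^2]. *)
have crho : rho_ k @[k --> \oo] --> (1 : R).
  have E k : rho_ k = 1 - 2 * (L k * (b_ k)^-1) ^+ 2.
    rewrite exprMn sqr_sqrtr; last first.
      by have := rho1 k; move=> /andP[_ r1]; rewrite divr_ge0// mulr_ge0 ?sqr_ge0// subr_ge0.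
    by field; rewrite gt_eqF.
  rewrite (_ : rho_ = fun k => 1 - 2 * (L k * (b_ k)^-1) ^+ 2); last by apply/funext => k; exact: E.
  suff : 1 - 2 * (L k * (b_ k)^-1) ^+ 2 @[k --> \oo] --> 1 - 2 * (t * 0) ^+ 2.
    by rewrite mulr0 expr0n/= mulr0 subr0.
  apply: cvgB; first exact: cvg_cst.
  by apply: cvgMr; under eq_fun do rewrite expr2; rewrite expr2;
     apply: cvgM; (apply: cvgM; [exact: cL|exact: cvg_binv]).
have cs : Num.max x (shifted_level (b_ k) (rho_ k) y z) @[k --> \oo] -->
    Num.max x (2 * t ^+ 2 + y - 2 * t * z).
  apply: (@cvg_comp _ _ _ (fun k => shifted_level (b_ k) (rho_ k) y z) (fun w => Num.max x w) _
    (nbhs (2 * t ^+ 2 + y - 2 * t * z))); last first.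
    by apply: (@continuous_max R R (cst x) idfun); [exact: cvg_cst|exact: cvg_id].
  suff : shifted_level (b_ k) (rho_ k) y z @[k --> \oo] --> (2 * t ^+ 2 + y - 2 * t * z) * 1^-1.
    by rewrite invr1 mulr1.
  apply: cvgM; last first.
    by apply: cvgV => //; rewrite oner_neq0.
  apply: cvgB.
    apply: cvgD; last exact: cvg_cst.
    apply: cvgMr; under eq_fun do rewrite expr2; rewrite expr2; exact: cvgM.
  apply: cvgMl; rewrite [2 * t]mulrC; apply: cvgM; first exact: cL.
  suff : Num.sqrt (2 * (1 + rho_ k)) @[k --> \oo] --> Num.sqrt (2 * (1 + 1) : R).
    have -> // : Num.sqrt (2 * (1 + 1)) = 2 :> R.
    by rewrite -[RHS]ger0_norm// -sqrtr_sqr expr2; congr (Num.sqrt (_ * _)).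
  apply: (continuous_cvg _ (@sqrt_continuous R _)).
  by apply: cvgMr; apply: cvgD => //; exact: cvg_cst.
have -> : Num.min (expR (- x)) (expR (- y) * lognormal l z) =
    expR (- Num.max x (2 * t ^+ 2 + y - 2 * t * z)).
  rewrite lognormalE gt_eqF// -expRD -/t.
  have -> : - y + (2 * t * z - 2 * t ^+ 2) = - (2 * t ^+ 2 + y - 2 * t * z) by ring.
  set s := 2 * t ^+ 2 + y - 2 * t * z.
  have [xs|xs] := leP x s; first by apply/min_idPr; rewrite ler_expR lerN2.
  by apply/min_idPl; rewrite ler_expR lerN2 ltW.
apply: cvg_trans (cvg_scaled_tail2 b0 bn boo cs).
apply: near_eq_cvg; near=> k.
rewrite -tail_sliceE//; last by case/andP: (rho1 k).
by near: k; move/cvgr_gt : crho; apply.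
Unshelve. all: by end_near. Qed.

(** Dominated convergence in [z], with the constant bound [expR (- x)]; the pointwise limits are
    treated separately for finite and infinite [l]. *)
Lemma cvg_joint_tail x y : joint_tail (n_ k) (b_ k) (rho_ k) x y @[k --> \oo] -->
  expR (- x) + expR (- y) - F_integrand x y l.
Proof.
have -> : expR (- x) + expR (- y) - F_integrand x y l =
    \int[N]_z Num.min (expR (- x)) (expR (- y) * lognormal l z).
  by rewrite F_integrandE; ring.
under eq_fun do rewrite joint_tailE//.
apply: (@bounded_cvg_Rintegral _ _ _ N _ _ (expR (- x))).
- by move=> k; exact: measurable_tail_slice.
- move=> z; have := expN_extnng_ge0 l; rewrite le_eqVlt => /predU1P[l0|l0]; last exact: cvg_slice1.
  rewrite lognormalE -l0 eqxx mulr0 (min_idPr (expR_ge0 _)); exact: cvg_slice0.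
- by move=> k z; rewrite ger0_norm ?tail_slice_ge0// tail_slice_le.
Qed.

End cvg_joint_tail.

(* If this failed, [lambda] would converge in [0, +oo] along a subsequence of counterexamples,
   contradicting [cvg_joint_tail]. *)
Lemma joint_tail_uniform (b : nat -> R) x y eps :
  (forall n, (0 < n)%N -> 0 < b n) ->
  (forall n, (0 < n)%N -> b n = n%:R * normal_pdf 0 1 (b n)) ->
  b n @[n --> \oo] --> +oo -> 0 < eps ->
  \forall n \near \oo, forall rho, -1 <= rho <= 1 ->
    `|joint_tail n (b n) rho x y -
      (expR (- x) + expR (- y) - F_integrand x y (lambda (b n) rho))| < eps.
Proof.
move=> b0 bn boo eps0; apply: contrapT => H.
have /choice[p Hp] : forall k, exists q : nat * R, [/\ (k < q.1)%N, -1 <= q.2 <= 1 &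
    eps <= `|joint_tail q.1 (b q.1) q.2 x y -
      (expR (- x) + expR (- y) - F_integrand x y (lambda (b q.1) q.2))|].
  move=> k.
  apply: contrapT => Hk; apply: H; exists k.+1 => // n /= kn rho rho1.
  rewrite ltNge; apply/negP => He; apply: Hk; by exists (n, rho).
pose u k := e (lambda (b (p k).1) (p k).2).
have bu : bounded_fun u.
  exists 1; split => // M M1 k _ /=; rewrite ger0_norm ?expN_extnng_ge0// (le_trans _ (ltW M1))//.
  exact: expN_extnng_le1.
have [f fi /cvg_ex[c fc]] := bolzano_weierstrass bu.
have fk k : (k <= f k)%N.
  by elim: k => // k ih; apply: (leq_ltn_trans ih); rewrite ltnNge -leEnat fi -ltnNge.
have c01 : 0 <= c <= 1.
  apply/andP; split; [apply: (cvgr_to_ge fc)|apply: (cvgr_to_le fc)]; apply: nearW => k.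
    exact: expN_extnng_ge0.
  exact: expN_extnng_le1.
pose q k := p (f k).
have q0 k : (0 < (q k).1)%N by have [h _ _] := Hp (f k); exact: leq_ltn_trans h.
have kq k : (k <= (q k).1)%N by have [h _ _] := Hp (f k); exact: leq_trans (fk k) (ltnW h).
have cl : e (lambda (b (q k).1) (q k).2) @[k --> \oo] --> e (rexpN_extnng c).
  by rewrite rexpN_extnngK.
have qoo : b (q k).1 @[k --> \oo] --> +oo.
  apply: (cvg_comp (fun k => (q k).1) b _ boo) => A [m _ mA]; exists m => // k /= mk.
  by apply: mA => /=; exact: leq_trans (kq k).
have C1 := @cvg_joint_tail (fun k => (q k).1) (fun k => b (q k).1) (fun k => (q k).2)
  (rexpN_extnng c) (fun k => b0 _ (q0 k)) (fun k => bn _ (q0 k)) qoo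
  (fun k => let: And3 _ h _ := Hp (f k) in h) cl x y.
have C2 := @cvg_F_integrand R x y (fun k => lambda (b (q k).1) (q k).2) _ cl.
have /cvgrPdist_lt H1 := C1; have /cvgrPdist_lt H2 := C2.
have /(_ _ (divr_gt0 eps0 (ltr0n _ 2))) := H1; have /(_ _ (divr_gt0 eps0 (ltr0n _ 2))) := H2.
move=> [m1 _ M1] [m2 _ M2]; pose m := maxn m1 m2.
have := M1 m (leq_maxl _ _); have := M2 m (leq_maxr _ _) => /=.
have [_ _] := Hp (f m); rewrite -/(q m).
set J := joint_tail _ _ _ _ _; set F := F_integrand _ _ (lambda _ _).
set F' := F_integrand _ _ _; set E := expR _ + _ => h1 h2 h3.
suff : `|J - (E - F)| < eps by rewrite ltNge h1.
have -> : J - (E - F) = - (E - F' - J) - (F' - F) by ring.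
by rewrite (le_lt_trans (ler_normB _ _))// normrN; move: h2 h3; lra.
Qed.

(** A bound [b n <= K] gives [n phi(K) <= n phi(b n) = b n <= K], which fails for large [n]. *)
Lemma cvg_level (b : nat -> R) : (forall n, (0 < n)%N -> b n = n%:R * normal_pdf 0 1 (b n)) ->
  b n @[n --> \oo] --> +oo.
Proof.
move=> bn; apply/cvgryPgt => K.
near=> n; have n0 : (0 < n)%N by near: n; exact: nbhs_infty_gt.
rewrite ltNge; apply/negP => bK.
have b0 : 0 < b n by rewrite bn// mulr_gt0 ?ltr0n// normal_pdf01_gt0.
have : normal_pdf 0 1 K <= normal_pdf 0 1 (b n).
  rewrite !normal_pdf01E ler_wpM2l ?normal_peak_ge0// ler_expR ler_pM2r ?invr_gt0// lerN2.
  by rewrite ler_sqr// nnegrE (le_trans (ltW b0)).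
move=> /(ler_wpM2l (ler0n R n)); rewrite -bn// => /le_trans/(_ bK).
rewrite -ler_pdivlMr ?normal_pdf01_gt0// leNgt => /negP; apply.
near: n; exact: nbhs_infty_gtr.
Unshelve. all: by end_near. Qed.

End joint_tail.

(** * Row maxima *)

Section products.
Context (R : realType).

(** The factors are exchanged one at a time, the remaining ones being at most 1. *)
Lemma normr_prodB (I : Type) (r : seq I) (a b : I -> R) :
  (forall i, 0 <= a i <= 1) -> (forall i, 0 <= b i <= 1) ->
  `|\prod_(i <- r) a i - \prod_(i <- r) b i| <= \sum_(i <- r) `|a i - b i|.
Proof.
move=> a01 b01; elim: r => [|i r ih]; first by rewrite !big_nil subrr normr0.
rewrite !big_cons; set A := \prod_(j <- r) a j in ih *; set B := \prod_(j <- r) b j in ih *.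
have B01 : `|B| <= 1.
  rewrite ger0_norm; first by apply: prodr_ile1 => j _; exact: b01.
  by apply: prodr_ge0 => j _; case/andP: (b01 j).
have -> : a i * A - b i * B = a i * (A - B) + (a i - b i) * B by ring.
rewrite (le_trans (ler_normD _ _))// !normrM addrC lerD//.
  by rewrite ler_piMr.
rewrite (le_trans _ ih)// ler_piMl//; case/andP: (a01 i) => ? ?; by rewrite ger0_norm.
Qed.

(** From [1 - p <= exp(-p) <= 1 / (1 + p) <= 1 - p + p^2]. *)
Lemma normr_expRN_sub (p : R) : 0 <= p <= 1 -> `|1 - p - expR (- p)| <= p ^+ 2.
Proof.
move=> /andP[p0 p1].
have h1 := expR_ge1Dx (- p); have h2 := expR_ge1Dx p.
have h3 : expR (- p) <= 1 - p + p ^+ 2.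
  have ep : 0 < 1 + p by rewrite ltr_pwDl.
  rewrite expRN (@le_trans _ _ (1 + p)^-1)// ?lef_pV2 ?posrE ?expR_gt0//.
  rewrite -[leLHS]mul1r ler_pdivrMr//.
  have : 0 <= p ^+ 3 by rewrite exprn_ge0.
  by rewrite [in X in X -> _]exprS !mulrDl !mulrDr !mul1r !mulr1 mulNr; lra.
by rewrite ler_norml; apply/andP; split; lra.
Qed.

Lemma normr_prod_expR (I : Type) (r : seq I) (p : I -> R) : (forall i, 0 <= p i <= 1) ->
  `|\prod_(i <- r) (1 - p i) - expR (- \sum_(i <- r) p i)| <= \sum_(i <- r) p i ^+ 2.
Proof.
move=> p01; rewrite -sumrN expR_sum.
apply: le_trans (@normr_prodB _ _ (fun i => 1 - p i) (fun i => expR (- p i)) _ _) _.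
- by move=> i; have := p01 i; lra.
- by move=> i; rewrite expR_ge0 -expR0 ler_expR oppr_le0; case/andP: (p01 i).
- by apply: ler_sum => i _; exact: normr_expRN_sub.
Qed.

Lemma normr_expRN_le (a b : R) : 0 <= a -> 0 <= b -> `|expR (- a) - expR (- b)| <= `|a - b|.
Proof.
wlog ab : a b / a <= b => [H|] a0 b0.
  have [|/ltW] := leP a b; first by move=> ?; exact: H.
  by move=> ?; rewrite distrC (distrC a); exact: H.
rewrite (distrC a) ger0_norm ?subr_ge0 ?ler_expR ?lerN2// ger0_norm ?subr_ge0//.
have -> : expR (- b) = expR (- a) * expR (- (b - a)) by rewrite -expRD; congr expR; ring.
have h := expR_ge1Dx (- (b - a)).
have e1 : expR (- a) <= 1 by rewrite -expR0 ler_expR oppr_le0.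
have -> : expR (- a) - expR (- a) * expR (- (b - a)) = expR (- a) * (1 - expR (- (b - a))) by ring.
apply: (@le_trans _ _ (expR (- a) * (b - a))); first by rewrite ler_wpM2l ?expR_ge0//; lra.
by rewrite ler_piMl// subr_ge0.
Qed.

End products.

Section empirical_integral.
Context (d : measure_display) (T : measurableType d) (R : realType).

Lemma ge0_integral_empirical n (l : 'I_n.+1 -> T) (f : T -> R) :
  measurable_fun setT f -> (forall x, 0 <= f x) ->
  (\int[empirical R l]_x (f x)%:E = (n.+1%:R^-1 * \sum_(i < n.+1) f (l i))%:E)%E.
Proof.
move=> mf f0.
have mf' : measurable_fun setT (EFin \o f) by apply/measurable_EFinP.
rewrite (eq_measure_integral (mscale (n.+1%:R^-1)%:nng
    (msum (fun k => \d_(l (inord k))) n.+1))); last first.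
  move=> A mA _; rewrite /mscale /msum /= /empirical; congr (_ * _)%E.
  by apply: eq_bigr => i _; rewrite inord_val.
rewrite ge0_integral_mscale//; last by move=> x _; rewrite lee_fin.
rewrite ge0_integral_measure_sum//; last by move=> x _; rewrite lee_fin.
rewrite EFinM -sumEFin; congr (_ * _)%E; apply: eq_bigr => i _.
by rewrite integral_dirac// diracT mul1e inord_val.
Qed.

Lemma Rintegral_empirical n (l : 'I_n.+1 -> T) (f : T -> R) :
  measurable_fun setT f -> (forall x, 0 <= f x) ->
  \int[empirical R l]_x f x = n.+1%:R^-1 * \sum_(i < n.+1) f (l i).
Proof. by move=> mf f0; rewrite /Rintegral ge0_integral_empirical. Qed.

End empirical_integral.

Section row.
Context (d : measure_display) (T : measurableType d) (R : realType).
Variables (P : probability T R) (n : nat) (X : 'I_n.+1 -> {RV P >-> (R * R)%type}).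
Variables (rho : 'I_n.+1 -> R) (b x y : R).
Hypothesis b0 : 0 < b.
Hypothesis indep : mutually_independent P (fun i w => X i w).
Hypothesis gaussX : forall i, bivariate_gaussian P (X i).
Hypothesis X1 : forall i, standard_normal P (fun w => (X i w).1).
Hypothesis X2 : forall i, standard_normal P (fun w => (X i w).2).
Hypothesis Xrho : forall i,
  correlation P (fun w => (X i w).1) (fun w => (X i w).2) = rho i.
Local Notation N := (gauss R).
Local Notation NN := (N \x N)%E.

Let u := b + x / b.
Let v := b + y / b.
Let Q : set (R * R) := `]-oo, u] `*` `]-oo, v].

Let mQ : measurable Q. Proof. exact: measurableX. Qed.

Let law i : -1 <= rho i <= 1 /\ forall B, measurable B -> P (X i @^-1` B) =
    NN [set z : R * R | B (z.1, rho i * z.1 + Num.sqrt (1 - rho i ^+ 2) * z.2)].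
Proof.
rewrite -Xrho; apply: gaussian_pair_law => //.
Qed.

Let p i := 1 - fine (P (X i @^-1` Q)).

Let mXQ i : measurable (X i @^-1` Q).
Proof. by rewrite -[X in measurable X]setTI; exact: measurable_funP. Qed.

Let fPXQ i : P (X i @^-1` Q) \is a fin_num.
Proof. exact: fin_num_measure. Qed.

Let p01 i : 0 <= p i <= 1.
Proof.
rewrite /p subr_ge0 gerBl fine_ge0// andbT -lee_fin fineK//.
exact: probability_le1.
Qed.

Let pE i : n.+1%:R * p i =
  scaled_tail n.+1 b x + scaled_tail n.+1 b y - joint_tail n.+1 b (rho i) x y.
Proof.
rewrite /scaled_tail /joint_tail -mulrDr -mulrBr; congr (_ * _).
have mA : measurable (fst @^-1` `]u, +oo[%classic : set (R * R)).
  by rewrite -[X in measurable X]setTI; exact: measurable_fst.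
have mB : measurable (snd @^-1` `]v, +oo[%classic : set (R * R)).
  by rewrite -[X in measurable X]setTI; exact: measurable_snd.
have m A : measurable A -> measurable (X i @^-1` A).
  by move=> mA'; rewrite -[X in measurable X]setTI; exact: measurable_funP.
have fin A : measurable A -> P (X i @^-1` A) \is a fin_num.
  by move=> mA'; apply: fin_num_measure; exact: m.
have -> : N `]b + x / b, +oo[%classic = P (X i @^-1` (fst @^-1` `]u, +oo[%classic)).
  by rewrite (X1 i)//.
have -> : N `]b + y / b, +oo[%classic = P (X i @^-1` (snd @^-1` `]v, +oo[%classic)).
  by rewrite (X2 i)//.
have -> : NN (tail_set b (rho i) x y) =
    P (X i @^-1` (fst @^-1` `]u, +oo[%classic `&` snd @^-1` `]v, +oo[%classic)).
  rewrite (law i).2; last exact: measurableI.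
  congr (NN _); apply/predeqP => z; rewrite /tail_set /= !in_itv/= !andbT //.
have QE : ~` Q = fst @^-1` `]u, +oo[%classic `|` snd @^-1` `]v, +oo[%classic.
  apply/predeqP => z; rewrite /Q /setX /= !in_itv/= !andbT.
  split=> [/not_andP[] /negP|[] uz []]; rewrite -?ltNge.
  - by left.
  - by right.
  - by rewrite leNgt uz.
  - by rewrite (leNgt _ v) uz.
have U : P (X i @^-1` (fst @^-1` `]u, +oo[%classic `|` snd @^-1` `]v, +oo[%classic)) =
   (P (X i @^-1` (fst @^-1` `]u, +oo[%classic)) + P (X i @^-1` (snd @^-1` `]v, +oo[%classic))
     - P (X i @^-1` (fst @^-1` `]u, +oo[%classic `&` snd @^-1` `]v, +oo[%classic)))%E.
  rewrite preimage_setU preimage_setI; apply: measureUfinr; [exact: m|exact: m|].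
  by rewrite -ge0_fin_numE// fin.
rewrite -fineD ?fin// -fineB ?fin ?fin_numD ?fin//; last exact: measurableI.
rewrite -U -QE -preimage_setC.
have -> : P (~` (X i @^-1` Q)) = (1 - P (X i @^-1` Q))%E by exact: probability_setC.
by rewrite fineB.
Qed.

(** Let [q i] be the probability that the i-th vector leaves the quadrant. Inclusion-exclusion
    expresses it by marginal and joint tails, and independence turns the maximum into a product. *)
Lemma normalized_max_df : exists q : 'I_n.+1 -> R,
  [/\ forall i, 0 <= q i <= 1, forall i, -1 <= rho i <= 1,
    forall i, n.+1%:R * q i =
      scaled_tail n.+1 b x + scaled_tail n.+1 b y - joint_tail n.+1 b (rho i) x y &
    fine (distribution P (normalized_max b X) (`]-oo, x] `*` `]-oo, y])) =
      \prod_(i < n.+1) (1 - q i)].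
Proof.
exists p; split => //; first by move=> i; case: (law i).
rewrite /distribution /pushforward.
have -> : normalized_max b X @^-1` (`]-oo, x] `*` `]-oo, y]) =
    \bigcap_(i in [set` [set: 'I_n.+1]%SET]) (X i @^-1` Q).
  have bu (c t : R) : (b * (t - b) <= c) = (t <= b + c / b).
    by rewrite mulrC -ler_pdivlMr// lerBlDl.
  apply/predeqP => w; rewrite /normalized_max /Q /setX /= !in_itv/=; split.
    move=> [/bigmax_leP[_ hx] /bigmax_leP[_ hy]] i _ /=.
    by rewrite !in_itv/= -!bu; split; [exact: hx|exact: hy].
  move=> H.
  have Hi i : (X i w).1 <= u /\ (X i w).2 <= v.
    have : i \in [set: 'I_n.+1]%SET by rewrite inE.
    by move=> /(H i) /=; rewrite !in_itv.
  by split; apply/bigmax_leP; split=> [|i _]; rewrite bu; apply: (Hi _).1 || apply: (Hi _).2.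
rewrite (indep _ (fun=> mQ)).
under eq_bigl do rewrite inE.
rewrite (eq_bigr (fun i => (1 - p i)%:E)); last first.
  by move=> i _; rewrite /p opprB addrC subrK fineK.
by rewrite prodEFin.
Qed.

End row.

Lemma near_inftyS_shift (Q : nat -> Prop) :
  (\forall n \near \oo, Q n) -> \forall n \near \oo, Q n.+1.
Proof. by move=> [m _ H]; exists m => // k mk; exact: (H k.+1 (leqW mk)). Qed.

(** * Comparison of the row maxima with F *)

Section triangular_array.
Context (R : realType) (d : nat -> measure_display) (T : forall n, measurableType (d n)).
Variables (P : forall n, probability (T n) R).
Variables (X : forall n, 'I_n.+1 -> {RV P n >-> (R * R)%type}).
Variables (rho : forall n, 'I_n.+1 -> R) (b : nat -> R).
Arguments X : clear implicits.
Arguments rho : clear implicits.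
Hypothesis indep : forall n, mutually_independent (P n) (fun i w => X n i w).
Hypothesis gaussX : forall n i, bivariate_gaussian (P n) (X n i).
Hypothesis X1 : forall n i, standard_normal (P n) (fun w => (X n i w).1).
Hypothesis X2 : forall n i, standard_normal (P n) (fun w => (X n i w).2).
Hypothesis Xrho : forall n i,
  correlation (P n) (fun w => (X n i w).1) (fun w => (X n i w).2) = rho n i.
Hypothesis bn : forall n, (0 < n)%N -> b n = n%:R * normal_pdf 0 1 (b n).

Let b0 n : (0 < n)%N -> 0 < b n.
Proof. by move=> n0; rewrite bn// mulr_gt0 ?ltr0n// normal_pdf01_gt0. Qed.

(** Poisson approximation: the product of the [1 - q i] is close to [exp(- sum q i)], and the sum is
    an average of the values [n q i], each uniformly close to the integrand of F at its lambda. The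
    comparison holds along the whole array, so both directions of the equivalence can use it. *)
Lemma cvg_max_df_sub x y :
  fine (distribution (P n) (normalized_max (b n.+1) (X n)) (`]-oo, x] `*` `]-oo, y])) -
  F_ (empirical R (fun i => lambda (b n.+1) (rho n i))) x y @[n --> \oo] --> (0 : R).
Proof.
apply/cvgrPdist_lt => eps eps0.
(* One quarter each for the Poisson error, the two marginal tails and the joint tail. *)
have eps4 : 0 < eps / 4 by rewrite divr_gt0.
have boo := cvg_level bn.
have bSoo : b n.+1 @[n --> \oo] --> +oo by rewrite (cvg_shiftS b).
pose C := expR (- x) + expR (- y).
have C0 : 0 <= C by rewrite addr_ge0 ?expR_ge0.
have ct z := @cvg_scaled_tail R (fun n => n.+1) (fun n => b n.+1)
  (fun k => b0 (ltn0Sn k)) (fun k => bn (ltn0Sn k)) bSoo z.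
have /cvgrPdist_lt/(_ _ eps4) tx := ct x.
have /cvgrPdist_lt/(_ _ eps4) ty := ct y.
have ju := @joint_tail_uniform R b x y _ b0 bn boo eps4.
have juS : \forall n \near \oo, forall r, -1 <= r <= 1 ->
    `|joint_tail n.+1 (b n.+1) r x y -
      (expR (- x) + expR (- y) - F_integrand x y (lambda (b n.+1) r))| < eps / 4.
  exact: (near_inftyS_shift ju).
near=> n.
have n0 : 0 < n.+1%:R :> R by rewrite ltr0n.
rewrite sub0r normrN.
have [q [q01 r1 qE ->]] := normalized_max_df x y (b0 (ltn0Sn n)) (@indep n)
  (@gaussX n) (@X1 n) (@X2 n) (@Xrho n).
rewrite /F_ Rintegral_empirical; last 2 first.
- exact: measurable_F_integrand.
- exact: F_integrand_ge0.
set S := _ * \sum_(i < n.+1) _.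
have S0 : 0 <= S.
  by apply: mulr_ge0; [rewrite invr_ge0 ltW|apply: sumr_ge0 => i _; exact: F_integrand_ge0].
have q0 i : 0 <= q i by case/andP: (q01 i).
(* Every [q i] is of order [1 / n] uniformly in the correlation, so the sum of squares is at most
   [C^2 / n]. *)
have qC i : n.+1%:R * q i <= C.
  rewrite qE lerBlDr (@le_trans _ _ C) ?lerDl ?joint_tail_ge0// lerD// scaled_tail_le ?b0//; exact: bn.
have h1 : `|\prod_(i < n.+1) (1 - q i) - expR (- \sum_(i < n.+1) q i)| <= C ^+ 2 / n.+1%:R.
  apply: le_trans (normr_prod_expR _ q01) _.
  apply: (@le_trans _ _ (\sum_(i < n.+1) (C / n.+1%:R) ^+ 2)).
    apply: ler_sum => i _; rewrite ler_sqr ?nnegrE ?divr_ge0 ?(ltW n0)//.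
    by rewrite ler_pdivlMr// mulrC.
  rewrite sumr_const card_ord -[leLHS]mulr_natr; move: (n.+1%:R) n0 => m m0.
  by rewrite le_eqVlt; apply/orP; left; apply/eqP; field; rewrite gt_eqF.
have h2 : `|expR (- \sum_(i < n.+1) q i) - expR (- S)| <= `|\sum_(i < n.+1) q i - S|.
  by apply: normr_expRN_le => //; apply: sumr_ge0.
have h3 : `|\sum_(i < n.+1) q i - S| <= 3 * (eps / 4).
  have -> : \sum_(i < n.+1) q i - S = n.+1%:R^-1 * \sum_(i < n.+1)
      (n.+1%:R * q i - F_integrand x y (lambda (b n.+1) (rho n i))).
    rewrite /S sumrB -mulr_sumr mulrBr mulKf// gt_eqF//.
  rewrite normrM ger0_norm ?invr_ge0 ?(ltW n0)// ler_pdivrMl//.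
  apply: le_trans (ler_norm_sum _ _ _) _.
  have -> : n.+1%:R * (3 * (eps / 4)) = \sum_(i < n.+1) 3 * (eps / 4).
    by rewrite sumr_const card_ord -[RHS]mulr_natl.
  apply: ler_sum => i _; rewrite qE.
  have a1 : `|expR (- x) - scaled_tail n.+1 (b n.+1) x| < eps / 4 by near: n.
  have a2 : `|expR (- y) - scaled_tail n.+1 (b n.+1) y| < eps / 4 by near: n.
  have a3 : `|joint_tail n.+1 (b n.+1) (rho n i) x y -
      (expR (- x) + expR (- y) - F_integrand x y (lambda (b n.+1) (rho n i)))| < eps / 4.
    have : forall r, -1 <= r <= 1 -> `|joint_tail n.+1 (b n.+1) r x y -
      (expR (- x) + expR (- y) - F_integrand x y (lambda (b n.+1) r))| < eps / 4 by near: n.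
    by apply.
  move: a1 a2 a3; rewrite !ltr_norml ler_norml.
  move: (scaled_tail _ _ _) (scaled_tail _ _ _) (joint_tail _ _ _ _ _) (F_integrand _ _ _)
    (expR _) (expR _) => *; lra.
have h4 : C ^+ 2 / n.+1%:R < eps / 4.
  rewrite ltr_pdivrMr// mulrC -ltr_pdivrMr//.
  near: n; near=> n; apply: (@lt_le_trans _ _ n%:R); last by rewrite ler_nat.
  by near: n; exact: nbhs_infty_gtr.
have -> : \prod_(i < n.+1) (1 - q i) - expR (- S) =
  (\prod_(i < n.+1) (1 - q i) - expR (- \sum_(i < n.+1) q i)) +
  (expR (- \sum_(i < n.+1) q i) - expR (- S)) by ring.
apply: le_lt_trans (ler_normD _ _) _.
apply: (@lt_le_trans _ _ (eps / 4 + 3 * (eps / 4))); last by lra.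
by apply: ltr_leD; [exact: le_lt_trans h1 h4|exact: le_trans h2 h3].
Unshelve. all: by end_near. Qed.

End triangular_array.

(** * Weierstrass approximation and moments *)

Section weierstrass.
Context (R : realType).

(* The Bernstein polynomial with values [g k] at the nodes, defined by conditioning on the
   first of [n] Bernoulli trials. *)
Fixpoint bernstein (n : nat) (g : nat -> R) : {poly R} :=
  if n is n'.+1 then 'X * bernstein n' (g \o S) + (1 - 'X) * bernstein n' g
  else (g 0%N)%:P.

Lemma bernsteinS n g x : (bernstein n.+1 g).[x] =
  x * (bernstein n (g \o S)).[x] + (1 - x) * (bernstein n g).[x].
Proof. by rewrite /= !hornerE. Qed.

Lemma bernstein_le n g h x : 0 <= x <= 1 -> (forall k, (k <= n)%N -> g k <= h k) ->
  (bernstein n g).[x] <= (bernstein n h).[x].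
Proof.
move=> /andP[x0 x1]; elim: n g h => [|n ih] g h gh; first by rewrite /= !hornerC gh.
rewrite !bernsteinS lerD// ler_wpM2l ?subr_ge0//; apply: ih => k kn; apply: gh => //.
exact: leqW.
Qed.

Lemma bernstein_affine n a c g x :
  (bernstein n (fun k => a + c * g k)).[x] = a + c * (bernstein n g).[x].
Proof.
elim: n g => [|n ih] g; first by rewrite /= !hornerC.
rewrite !bernsteinS (ih (g \o S)) ih; ring.
Qed.

(** Second moment of a binomial variable about [a]: variance plus squared bias. All [a] are treated
    together because the induction replaces [a] by [a - 1]. *)
Lemma bernstein_variance n a x : (bernstein n (fun k => (k%:R - a) ^+ 2)).[x] =
  n%:R * (x * (1 - x)) + (n%:R * x - a) ^+ 2.
Proof.
elim: n a => [|n ih] a; first by rewrite /= hornerC; ring.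
rewrite bernsteinS.
have -> : (fun k : nat => (k%:R - a) ^+ 2) \o S = fun k => (k%:R - (a - 1)) ^+ 2.
  by apply/funext => k /=; rewrite -natr1; congr (_ ^+ 2); ring.
by rewrite !ih -natr1; ring.
Qed.

(** Bernstein's argument. Uniform continuity gives [|f x - f y| <= eps / 2 + K (x - y)^2], where
    [K = D / d^2] makes the last term exceed the oscillation [D] as soon as [|x - y| >= d]. The
    binomial mean of the quadratic term is at most [K / n]. *)
Theorem weierstrass01 (f : R -> R) (eps : R) : {within `[0, 1], continuous f} -> 0 < eps ->
  exists p : {poly R}, forall x, 0 <= x <= 1 -> `|f x - p.[x]| <= eps.
Proof.
move=> cf eps0; have eps2 : 0 < eps / 2 by rewrite divr_gt0.
have [d d0 Hd] := heine_cantor (@segment_compact R 0 1) cf eps2.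
have [c1 c1I fc1] := EVT_max ler01 cf.
have [c2 c2I fc2] := EVT_min ler01 cf.
pose D := f c1 - f c2.
have D0 : 0 <= D by rewrite subr_ge0 fc1.
pose K := D / d ^+ 2.
have K0 : 0 <= K by rewrite divr_ge0// sqr_ge0.
have fxy x y : 0 <= x <= 1 -> 0 <= y <= 1 -> `|f x - f y| <= eps / 2 + K * (x - y) ^+ 2.
  move=> x01 y01; have [xy|xy] := ltP `|x - y| d.
    rewrite (@le_trans _ _ (eps / 2))//; last by rewrite lerDl mulr_ge0// sqr_ge0.
    by apply/ltW/Hd => //; rewrite /= in_itv.
  apply: (@le_trans _ _ D).
    have hx : x \in `[0, 1] by rewrite in_itv.
    have hy : y \in `[0, 1] by rewrite in_itv.
    rewrite ler_norml /D; move: (fc1 _ hx) (fc1 _ hy) (fc2 _ hx) (fc2 _ hy).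
    by move=> ? ? ? ?; apply/andP; split; lra.
  apply: (@le_trans _ _ (K * (x - y) ^+ 2)); last by rewrite lerDr ltW.
  rewrite /K mulrAC ler_pdivlMr ?exprn_gt0// ler_wpM2l//.
  by rewrite -(real_normK (num_real (x - y))) ler_sqr ?nnegrE// ltW.
near \oo => n.
have n0 : 0 < n%:R :> R by rewrite ltr0n; near: n; exact: nbhs_infty_gt.
have nK : K / n%:R < eps / 2.
  rewrite ltr_pdivrMr// mulrC -ltr_pdivrMr//; near: n; exact: nbhs_infty_gtr.
exists (bernstein n (fun k => f (k%:R / n%:R))) => x x01.
pose g k := f (k%:R / n%:R).
pose v (k : nat) : R := (k%:R - n%:R * x) ^+ 2.
have gk k : (k <= n)%N -> `|f x - g k| <= eps / 2 + K / n%:R ^+ 2 * v k.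
  move=> kn; rewrite (le_trans (fxy _ _ x01 _))//.
    by rewrite divr_ge0//= ler_pdivrMr// mul1r ler_nat.
  rewrite lerD2l /v -mulrA ler_wpM2l// le_eqVlt; apply/orP; left; apply/eqP.
  by field; rewrite gt_eqF.
have vE : (bernstein n v).[x] = n%:R * (x * (1 - x)).
  by rewrite bernstein_variance subrr expr0n addr0.
have x1 : x * (1 - x) <= 1.
  by move: x01 => /andP[? ?]; rewrite -[leRHS]mulr1 ler_pM ?subr_ge0// gerBl.
have h1 : eps / 2 + K / n%:R ^+ 2 * (bernstein n v).[x] <= eps.
  suff : K / n%:R ^+ 2 * (bernstein n v).[x] <= eps / 2 by lra.
  rewrite vE (_ : _ * _ = K / n%:R * (x * (1 - x))); last by field; rewrite gt_eqF.
  by rewrite (le_trans _ (ltW nK))// ler_piMr// divr_ge0// ltW.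
have e1 : (bernstein n g).[x] <= f x + eps / 2 + K / n%:R ^+ 2 * (bernstein n v).[x].
  rewrite -bernstein_affine; apply: bernstein_le => // k /gk; rewrite ler_norml; lra.
have e2 : f x - eps / 2 + - (K / n%:R ^+ 2) * (bernstein n v).[x] <= (bernstein n g).[x].
  rewrite -bernstein_affine; apply: bernstein_le => // k /gk; rewrite ler_norml mulNr; lra.
rewrite -/g ler_norml; move: e1 e2 h1; rewrite mulNr; set c := K / _ * _.
by move=> ? ? ?; apply/andP; split; lra.
Unshelve. all: by end_near. Qed.

End weierstrass.

(** * Moments with a weight *)

Section weighted_moments.
Context d (T : measurableType d) (R : realType) (w h : T -> R).
Hypothesis mw : measurable_fun setT w.
Hypothesis mh : measurable_fun setT h.
Hypothesis w01 : forall x, 0 <= w x <= 1.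
Hypothesis h01 : forall x, 0 <= h x <= 1.

Let wh1 k x : `|w x * h x ^+ k| <= 1.
Proof.
have /andP[? ?] := w01 x; have /andP[? ?] := h01 x.
by rewrite normrM mulr_ile1// ger0_norm ?exprn_ge0// exprn_ile1.
Qed.

Let mwh k : measurable_fun setT (fun x => w x * h x ^+ k).
Proof. by apply: measurable_funM => //; exact: measurable_funX. Qed.

Let psum (a : nat -> R) n x : R := \sum_(k < n) a k * (w x * h x ^+ k).

Let mpsum a n : measurable_fun setT (psum a n).
Proof. by apply: measurable_sum => k; exact: measurable_funM. Qed.

Let psum_bound a n x : `|psum a n x| <= \sum_(k < n) `|a k|.
Proof.
apply: le_trans (ler_norm_sum _ _ _) _; apply: ler_sum => k _.
by rewrite normrM ler_piMr.
Qed.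

Let Rintegral_psum (P : probability T R) a n :
  \int[P]_x psum a n x = \sum_(k < n) a k * \int[P]_x (w x * h x ^+ k).
Proof.
elim: n => [|n ih].
  rewrite big_ord0 (_ : psum a 0 = fun=> 0) ?(probability_Rintegral_cst P 0)//.
  by apply/funext => x; rewrite /psum big_ord0.
rewrite big_ord_recr /= -ih.
rewrite (_ : psum a n.+1 = fun x => psum a n x + a n * (w x * h x ^+ n)); last first.
  by apply/funext => x; rewrite /psum big_ord_recr.
rewrite (@bounded_RintegralD _ _ _ P _ _ (\sum_(k < n) `|a k| + `|a n|))//.
- congr (_ + _); apply: (@RintegralZl _ _ _ P setT (fun x => w x * h x ^+ n) (a n) measurableT).
  exact: (@bounded_integrable _ _ _ P _ 1 (mwh n) (wh1 n)).
- exact: measurable_funM.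
- by move=> x; rewrite (le_trans (psum_bound _ _ _))// lerDl.
- by move=> x; rewrite normrM (le_trans (ler_piMr _ (wh1 n x)))// lerDr sumr_ge0.
Qed.

(** Approximates [phi] by a polynomial uniformly on [0, 1], where [h] takes its values. It serves
    twice: with weight 1 along an ultrafilter for compactness, and with a constant sequence and a
    vanishing weight at l = oo for uniqueness. *)
Lemma cvg_weighted_moments (F : set_system nat) {FF : ProperFilter F}
    (P_ : nat -> probability T R) (P : probability T R) :
  (forall k, \int[P_ n]_x (w x * h x ^+ k) @[n --> F] --> \int[P]_x (w x * h x ^+ k)) ->
  forall phi : R -> R, {within `[0, 1], continuous phi} -> measurable_fun setT (phi \o h) ->
  \int[P_ n]_x (w x * phi (h x)) @[n --> F] --> \int[P]_x (w x * phi (h x)).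
Proof.
move=> H phi cphi mphi; apply/cvgrPdist_lt => eps eps0.
have eps4 : 0 < eps / 4 by rewrite divr_gt0.
have [p pE] := weierstrass01 cphi eps4.
have mf : measurable_fun setT (fun x => w x * phi (h x)) by exact: measurable_funM.
pose a k := p`_k.
have fp x : `|w x * phi (h x) - psum a (size p) x| <= eps / 4.
  rewrite (_ : psum a (size p) x = w x * p.[h x]); last first.
    by rewrite horner_coef mulr_sumr; apply: eq_bigr => k _; rewrite mulrCA.
  have /andP[w0 w1] := w01 x; rewrite -mulrBr normrM (ger0_norm w0).
  by rewrite (le_trans _ (pE _ (h01 x)))// ler_piMl.
have fb x : `|w x * phi (h x)| <= eps / 4 + \sum_(k < size p) `|a k|.
  by rewrite -[w x * _](subrK (psum a (size p) x)) (le_trans (ler_normD _ _))// lerD.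
have I (mu : probability T R) :
    `|\int[mu]_x (w x * phi (h x)) - \int[mu]_x psum a (size p) x| <= eps / 4.
  rewrite -(@bounded_RintegralB _ _ _ mu _ _ (eps / 4 + \sum_(k < size p) `|a k|))//.
    by apply: normr_bounded_Rintegral => //; exact: measurable_funB.
  by move=> x; rewrite (le_trans (psum_bound _ _ _))// lerDr ltW.
have Cp : \int[P_ n]_x psum a (size p) x @[n --> F] --> \int[P]_x psum a (size p) x.
  rewrite Rintegral_psum (_ : (fun n => _) =
      fun n => \sum_(k < size p) a k * \int[P_ n]_x (w x * h x ^+ k)); last first.
    by apply/funext => n; exact: Rintegral_psum.
  elim: (size p) => [|m ih].
    rewrite big_ord0 (_ : (fun n => _) = fun=> 0); first exact: cvg_cst.
    by apply/funext => n; rewrite big_ord0.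
  rewrite big_ord_recr (_ : (fun n => _) = fun n =>
    \sum_(k < m) a k * \int[P_ n]_x (w x * h x ^+ k) + a m * \int[P_ n]_x (w x * h x ^+ m)).
    by apply: cvgD => //; apply: cvgMr; exact: H.
  by apply/funext => n; rewrite big_ord_recr.
have /cvgrPdist_lt/(_ _ eps4) := Cp.
apply: filterS => n hn; have h1 := I P; have h2 := I (P_ n).
set A := \int[P]_x (w x * phi (h x)) in h1 *; set B := \int[P_ n]_x (w x * phi (h x)) in h2 *.
set A' := \int[P]_x psum _ _ _ in h1 hn; set B' := \int[P_ n]_x psum _ _ _ in h2 hn.
rewrite (_ : A - B = (A - A') + (A' - B') - (B - B')); last by ring.
rewrite (le_lt_trans (ler_normB _ _))//.
apply: (@le_lt_trans _ _ (`|A - A'| + `|A' - B'| + `|B - B'|)); first by rewrite lerD2r ler_normD.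
move: h1 h2 hn; lra.
Qed.

Lemma weighted_moments_eq (P P' : probability T R) :
  (forall k, \int[P]_x (w x * h x ^+ k) = \int[P']_x (w x * h x ^+ k)) ->
  forall phi : R -> R, {within `[0, 1], continuous phi} -> measurable_fun setT (phi \o h) ->
  \int[P]_x (w x * phi (h x)) = \int[P']_x (w x * phi (h x)).
Proof.
move=> H phi cphi mphi.
have c1 : \int[P]_x (w x * phi (h x)) @[_ --> \oo] --> \int[P']_x (w x * phi (h x)).
  by apply: (@cvg_weighted_moments \oo _ (fun=> P)) => // k; rewrite H; exact: cvg_cst.
exact: (@cvg_unique R^o (@Rhausdorff R) _ _ _ _ (cvg_cst _) c1).
Qed.

End weighted_moments.

(** Through [e], weak convergence on [0, oo] is the method of moments on [0, 1]. *)
Lemma cvg_moments (R : realType) (F : set_system nat) {FF : ProperFilter F}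
    (nu_ : nat -> probability (extnng R) R) (nu : probability (extnng R) R) :
  (forall k, \int[nu_ n]_l expN_extnng l ^+ k @[n --> F] --> \int[nu]_l expN_extnng l ^+ k) ->
  forall f : extnng R -> R, continuous f -> \int[nu_ n]_l f l @[n --> F] --> \int[nu]_l f l.
Proof.
move=> H f cf.
have XE k (mu : probability (extnng R) R) :
    \int[mu]_l (1 * expN_extnng l ^+ k) = \int[mu]_l expN_extnng l ^+ k.
  by apply: eq_Rintegral => l _; rewrite mul1r.
have fE (mu : probability (extnng R) R) :
    \int[mu]_l f l = \int[mu]_l (1 * (f \o @rexpN_extnng R) (expN_extnng l)).
  by apply: eq_Rintegral => l _; rewrite mul1r /= expN_extnngK.
rewrite fE (_ : (fun n => _) = fun n => \int[nu_ n]_l (1 * (f \o @rexpN_extnng R) (expN_extnng l))).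
  apply: (@cvg_weighted_moments _ _ _ (fun=> 1)) => //.
  - exact: measurable_expN_extnng.
  - by move=> l; rewrite ler01 lexx.
  - by move=> l; rewrite expN_extnng_ge0 expN_extnng_le1.
  - move=> k; rewrite XE (_ : (fun n => _) = fun n => \int[nu_ n]_l expN_extnng l ^+ k); first exact: H.
    by apply/funext => n; exact: XE.
  - exact: continuous_comp_rexpN.
  - rewrite (_ : _ \o _ = f); first exact: continuous_measurable_extnng.
    by apply/funext => l; rewrite /= expN_extnngK.
by apply/funext => n; exact: fE.
Qed.

(** * Uniqueness *)

Lemma probability_fin_num d (T : measurableType d) (R : realType) (P : probability T R)
  (A : set T) : measurable A -> P A \is a fin_num.
Proof. by move=> mA; exact: fin_num_measure. Qed.

Section lognormal_law.
Context (R : realType) (nu nu' : probability (extnng R) R).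
Local Notation N := (gauss R).
Local Notation Q := (nu \x N)%E.
Local Notation Q' := (nu' \x N)%E.
Local Notation W := (fun u : extnng R * R => lognormal u.1 u.2).

Hypothesis Fnu : F_ nu = F_ nu'.

Let mW : measurable_fun setT W := @measurable_lognormal R.

Let minW (a : R) : 0 <= a -> \int[Q]_u Num.min a (W u) = \int[Q']_u Num.min a (W u).
Proof.
rewrite le_eqVlt => /predU1P[<-|a0].
  have E (mu : probability (extnng R) R) : \int[(mu \x N)%E]_u Num.min 0 (W u) = 0.
    rewrite -[RHS](probability_Rintegral_cst (mu \x N)%E); apply: eq_Rintegral => u _.
    by apply: min_l; exact: lognormal_ge0.
  by rewrite !E.
(* At this point [E[min(exp(-x), exp(-y) W)]] is [E[min(a, W)]]. *)
have : F_ nu (- ln a) 0 = F_ nu' (- ln a) 0 by rewrite Fnu.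
rewrite /F_ => /expR_inj/oppr_inj; rewrite !Rintegral_F_integrand => /addrI/oppr_inj.
rewrite !opprK lnK ?posrE// oppr0 expR0.
by under eq_Rintegral do rewrite mul1r; under [in RHS]eq_Rintegral do rewrite mul1r.
Qed.

(** The right derivative of [min(a, w)] in [a] is the indicator of [a < w]; thus the tail
    probabilities of [W] are derivatives of [E[min(a, W)]]. *)
Let diffq (a : R) (n : nat) (w : R) := n.+1%:R * (Num.min (a + n.+1%:R^-1) w - Num.min a w).

Let diffq01 a n w : `|diffq a n w| <= 1.
Proof.
have n0 : 0 < n.+1%:R :> R by rewrite ltr0n.
have i0 : 0 < n.+1%:R^-1 :> R by rewrite invr_gt0.
rewrite /diffq normrM ger0_norm ?(ltW n0)// -ler_pdivlMl// mulr1 ger0_norm; last first.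
  by rewrite subr_ge0 le_min !ge_min lexx orbT andbT lerDl (ltW i0).
rewrite lerBlDr addr_minr le_min !ge_min.
by rewrite addrC lexx/= lerDr (ltW i0) orbT.
Qed.

Let diffq_cvg a w : diffq a n w @[n --> \oo] --> (\1_`]a, +oo[ w : R).
Proof.
rewrite indicE mem_setE in_itv/= andbT.
have [aw|aw] := ltP a w; last first.
  rewrite (_ : (fun n => _) = fun=> 0); first exact: cvg_cst.
  apply/funext => n; rewrite /diffq !min_r ?subrr ?mulr0//.
  by rewrite (le_trans aw)// lerDl invr_ge0.
have wa : 0 < w - a by rewrite subr_gt0.
apply: cvg_near_cst; near=> n; apply/eqP; rewrite /diffq !min_l ?(ltW aw)//.
  by rewrite addrAC subrr add0r divff// pnatr_eq0.
rewrite -lerBrDl ltW//.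
near: n; exact: near_infty_natSinv_lt (PosNum wa).
Unshelve. all: by end_near. Qed.

Let mdiffq (mu : probability (extnng R) R) a n : measurable_fun setT (fun u => diffq a n (W u)).
Proof.
by apply: measurable_funM => //; apply: measurable_funB; apply: measurable_minr.
Qed.

Let int_diffq (mu : probability (extnng R) R) a n : 0 <= a ->
  \int[(mu \x N)%E]_u diffq a n (W u) =
  n.+1%:R * (\int[(mu \x N)%E]_u Num.min (a + n.+1%:R^-1) (W u) - \int[(mu \x N)%E]_u Num.min a (W u)).
Proof.
move=> a0.
have an : 0 <= a + n.+1%:R^-1 by rewrite addr_ge0// invr_ge0.
have m c : measurable_fun setT (fun u => Num.min c (W u)) by exact: measurable_minr.
have b c u : 0 <= c -> c <= a + n.+1%:R^-1 -> `|Num.min c (W u)| <= a + n.+1%:R^-1.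
  move=> c0 ca; rewrite ger0_norm; last by rewrite le_min c0 lognormal_ge0.
  by rewrite ge_min ca.
have aa : a <= a + n.+1%:R^-1 by rewrite lerDl invr_ge0.
rewrite -(@bounded_RintegralB _ _ _ (mu \x N)%E _ _ (a + n.+1%:R^-1) (m _) (m _)
  (fun u => b _ u an (lexx _)) (fun u => b _ u a0 aa)).
apply: (@RintegralZl _ _ _ (mu \x N)%E setT (fun u => Num.min (a + n.+1%:R^-1) (W u) - Num.min a (W u)) _ measurableT).
apply: (@bounded_integrable _ _ _ (mu \x N)%E _ ((a + n.+1%:R^-1) + (a + n.+1%:R^-1))).
  by apply: measurable_funB; exact: m.
by move=> u; rewrite (le_trans (ler_normB _ _))// lerD ?b.
Qed.

Lemma lognormal_law_eq A : measurable A -> Q (W @^-1` A) = Q' (W @^-1` A).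
Proof.
apply: measure_eq_ray => //; first exact: (le_lt_trans (@probability_le1 _ _ _ Q _ measurableT) (ltry _)).
move=> a.
have mA : measurable (W @^-1` `]a, +oo[) by rewrite -[X in measurable X]setTI; exact: mW.
have [a0|a0] := leP 0 a; last first.
  have -> : W @^-1` `]a, +oo[ = setT.
    by apply/predeqP => u; split => //= _; rewrite in_itv/= andbT (lt_le_trans a0)// lognormal_ge0.
  exact: etrans (@probability_setT _ _ _ Q) (esym (@probability_setT _ _ _ Q')).
have L (mu : probability (extnng R) R) : \int[(mu \x N)%E]_u diffq a n (W u) @[n --> \oo] -->
    fine ((mu \x N)%E (W @^-1` `]a, +oo[)).
  rewrite -(Rintegral_indic (mu \x N)%E mA).
  apply: (@bounded_cvg_Rintegral _ _ _ (mu \x N)%E _ _ 1).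
  - by move=> n; exact: mdiffq.
  - by move=> u; exact: diffq_cvg.
  - by move=> n u; exact: diffq01.
have f1 : Q (W @^-1` `]a, +oo[) \is a fin_num by exact: (@probability_fin_num _ _ _ Q).
have f2 : Q' (W @^-1` `]a, +oo[) \is a fin_num by exact: (@probability_fin_num _ _ _ Q').
apply: etrans (esym (fineK f1)) _; apply: etrans _ (fineK f2); congr EFin.
have E : (fun n => \int[Q]_u diffq a n (W u)) = fun n => \int[Q']_u diffq a n (W u).
  by apply/funext => n; rewrite !int_diffq// !minW// addr_ge0// invr_ge0.
have L1 := L nu; rewrite E in L1.
exact: (@cvg_unique R^o (@Rhausdorff R) _ _ _ _ L1 (L nu')).
Qed.

Lemma lognormal_integral_eq (psi : R -> R) : measurable_fun setT psi -> (forall w, 0 <= psi w) ->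
  (\int[nu]_l \int[N]_z (psi (lognormal l z))%:E = \int[nu']_l \int[N]_z (psi (lognormal l z))%:E)%E.
Proof.
move=> mpsi psi0.
have mE : measurable_fun setT (EFin \o psi) by apply/measurable_EFinP.
have mp : measurable_fun setT (fun u => (psi (W u))%:E) by exact: (measurableT_comp mE mW).
have p0 u : (0 <= (psi (W u))%:E)%E by rewrite lee_fin.
have E (mu : probability (extnng R) R) :
  (\int[mu \x N]_u (psi (W u))%:E = \int[mu]_l \int[N]_z (psi (lognormal l z))%:E)%E.
  exact: (@fubini_tonelli1 _ _ _ _ _ mu N _ mp p0).
rewrite -!E.
transitivity (\int[pushforward Q W]_w (psi w)%:E)%E.
  apply/esym; apply: (@ge0_integral_transfer _ _ _ _ _ Q (pushforward Q W) W) => //.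
apply: (@ge0_integral_transfer _ _ _ _ _ Q' (pushforward Q W) W) => //.
by move=> A mA; exact: lognormal_law_eq.
Qed.

End lognormal_law.

(** The inverse is [x / x^2], with the division written through [expR] and [ln]; at 0 the factor [x]
    reproduces the convention [0^-1 = 0]. *)
Lemma measurable_inv (R : realType) : measurable_fun setT (@GRing.inv R).
Proof.
rewrite (_ : @GRing.inv R = fun x => x * expR (- ln (x ^+ 2))); last first.
  apply/funext => x; have [->|x0] := eqVneq x 0; first by rewrite invr0 mul0r.
  by rewrite expRN lnK ?posrE ?exprn_even_gt0// expr2 invfM mulVKf.
apply: measurable_funM => //; apply: measurableT_comp => //; apply: measurable_funN.
by apply: (@measurableT_comp _ _ _ _ _ _ (@ln R)) => //; exact: measurable_funX.
Qed.

(** * Recovering nu from the law of W *)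

Section mixture_injective.
Context (R : realType).
Local Notation N := (gauss R).
Local Notation e := (@expN_extnng R).

Let sqr_level (l : extnng R) : R := ln (e l) ^+ 2.

Let u (l : extnng R) : R :=
  if e l == 0 then 1 else sqr_level l / (1 + sqr_level l).

(** At [v = r^2 / (1 + r^2)] this is [exp(-r^2 / 2) / sqrt(1 + r^2)], the factor left over by
    [integral_psi]; at [v = 1], the value of [u] at l = oo, it is 0. Being a function of [u], it can
    be divided out by a continuous test function of [u]. *)
Let damp (v : R) : R := Num.sqrt (1 - v) * expR (- (v / (1 - v) / 2)).

Let damp_gt0 v : v < 1 -> 0 < damp v.
Proof. by move=> v1; rewrite mulr_gt0 ?expR_gt0// sqrtr_gt0 subr_gt0. Qed.

Let weight l := damp (u l).

Let u01 l : 0 <= u l <= 1.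
Proof.
rewrite /u; case: ifP => _; first by rewrite ler01 lexx.
have s0 : 0 <= sqr_level l by exact: sqr_ge0.
by rewrite divr_ge0 ?addr_ge0//= ler_pdivrMr ?ltr_wpDr// mul1r lerDr.
Qed.

Let weight01 l : 0 <= weight l <= 1.
Proof.
have /andP[u0 u1] := u01 l.
rewrite mulr_ge0 ?sqrtr_ge0 ?expR_ge0//= mulr_ile1 ?sqrtr_ge0 ?expR_ge0//.
  by rewrite -[leRHS]sqrtr1 ler_wsqrtr// gerBl.
by rewrite -[leRHS]expR0 ler_expR oppr_le0; apply: divr_ge0 => //; rewrite divr_ge0// subr_ge0.
Qed.

Let measurable_u : measurable_fun setT u.
Proof.
have ms : measurable_fun setT sqr_level.
  apply: measurable_funX; apply: (@measurableT_comp _ _ _ _ _ _ (@ln R)) => //.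
  exact: measurable_expN_extnng.
apply: measurable_fun_ifT => //.
  by apply: measurable_fun_eqr => //; exact: measurable_expN_extnng.
apply: measurable_funM => //; apply: (measurableT_comp (@measurable_inv R)).
exact: measurable_funD.
Qed.

Let measurable_weight : measurable_fun setT weight.
Proof.
have m1 : measurable_fun setT (fun l => 1 - u l) by exact: measurable_funB.
apply: measurable_funM; first exact: (measurableT_comp (continuous_measurable_fun (@sqrt_continuous R))).
apply: measurableT_comp => //; apply: measurable_funN; apply: measurable_funM => //.
apply: measurable_funM => //; exact: (measurableT_comp (@measurable_inv R)).
Qed.

(** The square root also kills the value [w = 0] taken at l = oo, where [ln w] is meaningless. The
    constant 8 turns [(2 r Z)^2 / 8] into [r^2 Z^2 / 2], so the Gaussian factor adds [r^2] to the
    inverse variance of [Z]. *)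
Let psi k (w : R) : R := Num.sqrt w * ((ln w ^+ 2) ^+ k * expR (- (ln w ^+ 2 / 8))).

Let measurable_psi k : measurable_fun setT (psi k).
Proof.
have ml : measurable_fun setT (fun w : R => ln w ^+ 2) by exact: measurable_funX.
apply: measurable_funM; first exact: (continuous_measurable_fun (@sqrt_continuous R)).
apply: measurable_funM; first exact: measurable_funX.
by apply: measurableT_comp => //; apply: measurable_funN; exact: measurable_funM.
Qed.

Let psi0 k w : 0 <= psi k w.
Proof. by rewrite !mulr_ge0 ?sqrtr_ge0 ?expR_ge0// exprn_ge0// sqr_ge0. Qed.

Let sqrt_expR (t : R) : Num.sqrt (expR t) = expR (t / 2).
Proof.
rewrite (_ : expR t = expR (t / 2) ^+ 2); last by rewrite expr2 -expRD; congr expR; field.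
by rewrite sqrtr_sqr ger0_norm ?expR_ge0.
Qed.

(* Under the density [sqrt W], the variable [ln W] is [2 r Z] for a standard normal [Z] and
   [r = - ln (e l)], and rescaling [Z] absorbs the Gaussian factor of [psi k]. *)
Let integral_psi k l : (\int[N]_z (psi k (lognormal l z))%:E =
  (weight l * u l ^+ k * (4 ^+ k * gauss_moment R k))%:E)%E.
Proof.
rewrite /psi; under eq_integral do rewrite lognormalE.
rewrite /weight /u; case: ifPn => [_|el0].
  under eq_integral do rewrite sqrtr0 mul0r.
  by rewrite integral0 /damp subrr sqrtr0 !mul0r.
rewrite /sqr_level -(sqrrN (ln _)).
(* [s2] is the inverse variance once the factor of [psi k] has joined the normal density, so [s z]
   is standard again. *)
move: (- ln (e l)) => r; pose s2 := 1 + r ^+ 2; pose s := Num.sqrt s2.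
have s20 : 0 < s2 by rewrite ltr_pwDl// sqr_ge0.
have s0 : 0 < s by rewrite sqrtr_gt0.
have ss : s ^+ 2 = s2 by rewrite sqr_sqrtr// ltW.
have mpow : measurable_fun setT (fun z : R => (z ^+ 2) ^+ k).
  by apply: measurable_funX; exact: measurable_funX.
pose g z : R := (4 * r ^+ 2 * (z - r) ^+ 2) ^+ k * expR (- (r ^+ 2 * (z - r) ^+ 2 / 2)).
have mzr : measurable_fun setT (fun z : R => (z - r) ^+ 2).
  by apply: measurable_funX; exact: measurable_funB.
have mg : measurable_fun setT g.
  apply: measurable_funM; first by apply: measurable_funX; exact: measurable_funM.
  by apply: measurableT_comp => //; apply: measurable_funN; apply: measurable_funM => //; exact: measurable_funM.
have g0 z : 0 <= g z.
  apply: mulr_ge0; last exact: expR_ge0.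
  by apply: exprn_ge0; apply: mulr_ge0; [apply: mulr_ge0 => //|]; exact: sqr_ge0.
transitivity (\int[N]_z ((expR (- (r ^+ 2 / 2)))%:E * ((g z)%:E * (expR (r * z - r ^+ 2 / 2))%:E)))%E.
  apply: eq_integral => z _; rewrite -!EFinM; congr EFin.
  rewrite sqrt_expR expRK [g z * _]mulrC [RHS]mulrA -expRD; congr (expR _ * _); first by field.
  have -> : (2 * r * z - 2 * r ^+ 2) ^+ 2 = 4 * r ^+ 2 * (z - r) ^+ 2 by ring.
  by congr (_ * expR _); field.
have mgE : measurable_fun setT (EFin \o g) by apply/measurable_EFinP.
rewrite ge0_integralZl//; last 2 first.
- apply: emeasurable_funM => //; apply/measurable_EFinP; apply: measurableT_comp => //.
  exact: measurable_funB.
- by move=> z _; rewrite mule_ge0// lee_fin ?expR_ge0.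
rewrite (@ge0_integral_normal_shift R r (EFin \o g))//.
have mgr : measurable_fun setT (fun z : R => (g (z + r)%R)%:E).
  by apply: (measurableT_comp mgE); exact: measurable_funD.
rewrite ge0_integral_normal//=; last by move=> z; rewrite lee_fin.
have mp : measurable_fun setT (fun z : R => (((z ^+ 2) ^+ k)%:E * (normal_pdf 0 1 z)%:E)%E).
  by apply: emeasurable_funM; apply/measurable_EFinP => //; exact: measurable_normal_pdf.
have p0 (z : R) : (0 <= ((z ^+ 2) ^+ k)%:E)%E by rewrite lee_fin exprn_ge0// sqr_ge0.
have := integral_gauss_even R k; rewrite ge0_integral_normal//; last exact/measurable_EFinP.
rewrite (@ge0_integral_affine R s 0)//; last 2 first.
- by rewrite gt_eqF.
- by move=> z; rewrite mule_ge0// lee_fin normal_pdf_ge0.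
rewrite gtr0_norm// => sI.
pose q := r ^+ 2 / s2.
have q0 : 0 <= q by rewrite divr_ge0 ?sqr_ge0// ltW.
have gE z : ((g (z + r)%R)%:E * (normal_pdf 0 1 z)%:E =
    ((4 * q) ^+ k)%:E * ((((s * z + 0) ^+ 2) ^+ k)%R%:E * (normal_pdf 0 1 (s * z + 0)%R)%:E))%E.
  rewrite addr0 -!EFinM; congr EFin; rewrite /g addrK !normal_pdf01E.
  have -> : 4 * r ^+ 2 * z ^+ 2 = 4 * q * (s * z) ^+ 2.
    by rewrite [(s * z) ^+ 2]exprMn ss /q; field; rewrite gt_eqF.
  have -> : expR (- (s * z) ^+ 2 / 2) = expR (- (r ^+ 2 * z ^+ 2 / 2)) * expR (- z ^+ 2 / 2).
    by rewrite -expRD; congr expR; rewrite [(s * z) ^+ 2]exprMn ss /s2; field.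
  by rewrite [in LHS]exprMn; ring.
under eq_integral do rewrite gE.
have ms : measurable_fun setT (fun z : R => s * z + 0).
  by apply: measurable_funD => //; exact: measurable_funM.
rewrite ge0_integralZl//; last 3 first.
- exact: (measurableT_comp mp ms).
- by move=> z _; rewrite mule_ge0// lee_fin normal_pdf_ge0.
- by rewrite lee_fin exprn_ge0// mulr_ge0.
set J := (\int[_]_z _)%E in sI *.
have -> : J = (s^-1 * gauss_moment R k)%:E.
  by rewrite EFinM -sI muleA -EFinM mulVf ?gt_eqF// mul1e.
rewrite -!EFinM; congr EFin; rewrite /damp.
have -> : 1 - r ^+ 2 / s2 = s2^-1 by rewrite /s2; field; rewrite gt_eqF.
rewrite sqrtrV ?(ltW s20)// -/s invrK divfK ?gt_eqF// exprMn /q; ring.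
Qed.

(** The weight is positive except at l = oo. Sets [r < e l] with [0 <= r] avoid that point and are
    recovered by dividing the weight out; the mass at l = oo follows from the total mass 1. *)
Theorem F_inj (nu nu' : probability (extnng R) R) : F_ nu = F_ nu' -> measure_eq nu nu'.
Proof.
move=> Fnu.
have wu1 k l : `|weight l * u l ^+ k| <= 1.
  have /andP[? ?] := weight01 l; have /andP[? ?] := u01 l.
  by rewrite normrM mulr_ile1// ger0_norm ?exprn_ge0// exprn_ile1.
have mwu k : measurable_fun setT (fun l => weight l * u l ^+ k).
  by apply: measurable_funM => //; exact: measurable_funX.
have moments k : \int[nu]_l (weight l * u l ^+ k) = \int[nu']_l (weight l * u l ^+ k).
  pose C := 4 ^+ k * gauss_moment R k.
  have C0 : C != 0 by rewrite gt_eqF// mulr_gt0 ?exprn_gt0// gauss_moment_gt0.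
  apply: (mulIf C0).
  have E (mu : probability (extnng R) R) : \int[mu]_l (weight l * u l ^+ k) * C =
      fine (\int[mu]_l \int[N]_z (psi k (lognormal l z))%:E)%E.
    rewrite -(@RintegralZr _ _ _ mu setT _ C measurableT); last first.
      exact: (@bounded_integrable _ _ _ mu _ 1 (mwu k) (wu1 k)).
    by rewrite /Rintegral; congr fine; apply: eq_integral => l _; rewrite integral_psi.
  by rewrite !E; congr fine; exact: lognormal_integral_eq.
apply: extnng_measure_eq => r.
have [r1|r1] := leP 1 r.
  have -> : [set l | r < e l] = set0.
    by apply/predeqP => l; split => //=; rewrite ltNge (le_trans (expN_extnng_le1 l)).
  by rewrite !measure0.
have [r0|r0] := ltP r 0.
  have -> : [set l | r < e l] = setT.
    by apply/predeqP => l; split => //= _; rewrite (lt_le_trans r0)// expN_extnng_ge0.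
  by rewrite !(@probability_setT _ _ _ _).
(* [u] decreases in [e l], so [r < e l] becomes [u l < c]. For [r = 0] the threshold is 1, a value
   that [u] takes only at l = oo. *)
pose c : R := if r == 0 then 1 else ln r ^+ 2 / (1 + ln r ^+ 2).
have c1 : c <= 1.
  rewrite /c; case: ifP => // _.
  by rewrite ler_pdivrMr ?ltr_wpDr ?sqr_ge0// mul1r lerDr.
have -> : [set l | r < e l] = u @^-1` `]-oo, c[.
  apply/predeqP => l /=; rewrite in_itv/= /c /u; have [el0|el0] := eqVneq (e l) 0.
    by rewrite el0 ltNge r0 ltNge -/c c1.
  have el : 0 < e l by rewrite lt_neqAle eq_sym el0 expN_extnng_ge0.
  have frac (p q : R) : 0 <= p -> 0 <= q -> (p / (1 + p) < q / (1 + q)) = (p < q).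
    move=> p0 q0; rewrite ltr_pdivrMr ?ltr_wpDr// mulrAC ltr_pdivlMr ?ltr_wpDr//.
    by rewrite !mulrDr !mulr1 (mulrC q) ltrD2r.
  have [->|rn0] := eqVneq r 0.
    by rewrite el ltr_pdivrMr ?ltr_wpDr ?sqr_ge0// mul1r ltrDr ltr01.
  have rp : 0 < r by rewrite lt_neqAle eq_sym rn0.
  have l0 : 0 <= - ln (e l) by rewrite oppr_ge0 ln_le0// expN_extnng_le1.
  have lr : 0 <= - ln r by rewrite oppr_ge0 ln_le0// ltW.
  rewrite frac ?sqr_ge0// /sqr_level -(sqrrN (ln (e l))) -(sqrrN (ln r)) ltr_sqr ?nnegrE// ltrN2.
  by rewrite ltr_ln ?posrE.
have mA : measurable (u @^-1` `]-oo, c[) by rewrite -[X in measurable X]setTI; exact: measurable_u.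
pose h n := n.+1%:R^-1 : R.
have h0 n : 0 < h n by rewrite invr_gt0.
(* The ramps vanish from [c - h n] on, away from the point 1 where [damp] degenerates. Capping the
   argument of [damp] at [c - h n] makes the quotient [phi] continuous without changing its product
   with the weight. *)
pose ramp n (v : R) : R := Num.min 1 (Num.max 0 (n.+1%:R * (c - h n - v))).
have ramp01 n v : 0 <= ramp n v <= 1.
  by rewrite le_min ler01 le_max lexx/= ge_min lexx.
pose phi n v := ramp n v / damp (Num.min v (c - h n)).
have dlt1 n v : Num.min v (c - h n) < 1.
  by rewrite gt_min [X in _ || X](lt_le_trans _ c1) ?orbT// gtrBl.
have cphi n : continuous (phi n).
  move=> v; apply: cvgM.
    apply: (@continuous_min R R (cst 1) (fun v => Num.max 0 (n.+1%:R * (c - h n - v)))); first exact: cvg_cst.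
    apply: (@continuous_max R R (cst 0) (fun v => n.+1%:R * (c - h n - v))); first exact: cvg_cst.
    by apply: cvgMr; apply: cvgB; [exact: cvg_cst|exact: cvg_id].
  apply: cvgV; first by rewrite gt_eqF// damp_gt0.
  have cm : Num.min t (c - h n) @[t --> v] --> Num.min v (c - h n).
    by apply: (@continuous_min R R idfun (cst (c - h n))); [exact: cvg_id|exact: cvg_cst].
  have cB : 1 - Num.min t (c - h n) @[t --> v] --> 1 - Num.min v (c - h n).
    by apply: cvgB => //; exact: cvg_cst.
  apply: cvgM; first exact: (continuous_cvg _ (@sqrt_continuous R _)).
  apply: (continuous_cvg _ (@continuous_expR R _)); apply: cvgN; apply: cvgMl.
  by apply: cvgM => //; apply: cvgV => //; rewrite subr_eq0 gt_eqF.
have phiE n l : weight l * phi n (u l) = ramp n (u l).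
  rewrite /weight /phi; have [ul|ul] := leP (c - h n) (u l).
    have -> : ramp n (u l) = 0; last by rewrite mul0r mulr0.
    by rewrite /ramp max_l ?min_r// mulr_ge0_le0// subr_le0.
  rewrite mulrCA divff ?mulr1// gt_eqF// damp_gt0//.
  by rewrite (lt_le_trans ul)// (le_trans _ c1)// gerBl ltW.
have E n : \int[nu]_l ramp n (u l) = \int[nu']_l ramp n (u l).
  have := @weighted_moments_eq _ _ _ weight u measurable_weight measurable_u weight01 u01 nu nu' moments
    (phi n) (continuous_subspaceT (@cphi n)) (measurableT_comp (continuous_measurable_fun (@cphi n)) measurable_u).
  by under eq_Rintegral do rewrite phiE; under [in RHS]eq_Rintegral do rewrite phiE.
have L (mu : probability (extnng R) R) :
    \int[mu]_l ramp n (u l) @[n --> \oo] --> fine (mu (u @^-1` `]-oo, c[)).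
  rewrite -(Rintegral_indic mu mA); apply: (@bounded_cvg_Rintegral _ _ _ mu _ _ 1).
  - move=> n; apply: (measurableT_comp _ measurable_u).
    apply: measurable_minr => //; apply: measurable_maxr => //; apply: measurable_funM => //.
    exact: measurable_funB.
  - move=> l; have -> : \1_(u @^-1` `]-oo, c[) l = ((u l < c)%R)%:R :> R.
      by rewrite indicE; congr (nat_of_bool _)%:R; apply/idP/idP; rewrite inE /= in_itv.
    have [ul|ul] := ltP (u l) c; last first.
      apply: cvg_near_cst; apply: nearW => n; apply/eqP.
      rewrite /ramp max_l ?min_r// mulr_ge0_le0// subr_le0 (le_trans _ ul)// gerBl ltW//.
    have d0 : 0 < (c - u l) / 2 by rewrite divr_gt0// subr_gt0.
    apply: cvg_near_cst; near=> n; apply/eqP; rewrite /ramp min_l// le_max; apply/orP; right.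
    have hn : h n < (c - u l) / 2 by near: n; exact: near_infty_natSinv_lt (PosNum d0).
    by rewrite -ler_pdivrMl// mulr1 -/(h n); lra.
  - by move=> n l; have /andP[? ?] := ramp01 n (u l); rewrite ger0_norm.
have L1 := L nu; rewrite (_ : (fun n => _) = fun n => \int[nu']_l ramp n (u l)) in L1; last exact/funext.
have Q := @cvg_unique R^o (@Rhausdorff R) _ _ _ _ L1 (L nu').
by rewrite -(fineK (@probability_fin_num _ _ _ nu _ mA)) Q fineK//; exact: probability_fin_num.
Unshelve. all: by end_near. Qed.

End mixture_injective.

(** * Compactness of the probability measures on [0, +oo] *)

Section exponential_law.
Context (R : realType).

(** A source of randomness for two purposes: it yields a uniform variable for quantile functions,
    and it is the law of [exp(-X)] for each coordinate [X] of the limit. *)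
Definition expo : set R -> \bar R := @exponential_prob R 1.

Let expo0 : expo set0 = 0%E.
Proof. exact: (@measure0 _ _ _ (@exponential_prob R 1)). Qed.

Let expo_ge0 A : (0 <= expo A)%E.
Proof. exact: (@measure_ge0 _ _ _ (@exponential_prob R 1)). Qed.

Let expo_sigma_additive : semi_sigma_additive expo.
Proof. exact: (@measure_semi_sigma_additive _ _ _ (@exponential_prob R 1)). Qed.

HB.instance Definition _ := isMeasure.Build _ R _ expo
  expo0 expo_ge0 expo_sigma_additive.

Let expo_setT : expo setT = 1%E.
Proof. exact: (@integral_exponential_pdf R 1 ltr01). Qed.

HB.instance Definition _ := Measure_isProbability.Build _ R _ expo expo_setT.

Lemma expo_ray (t : R) : 0 <= t -> expo `[t, +oo[ = (expR (- t))%:E.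
Proof.
move=> t0; rewrite -integral_expN_ray /expo /exponential_prob.
have mi : measurable_fun `[t, +oo[%classic (fun x => (exponential_pdf 1 x)%:E : \bar R).
  by apply/measurable_EFinP; apply: measurable_funTS; exact: measurable_exponential_pdf.
rewrite ge0_integral_lebE//; last first.
  by move=> x _; rewrite lee_fin exponential_pdf_ge0.
rewrite integral_mkcond; apply: eq_integral => s _.
rewrite patchE indicE; case: ifPn => [|_]; last by rewrite mul0r.
rewrite inE/= in_itv/= andbT => ts.
by rewrite exponential_pdfE ?(le_trans t0)// !mul1r mulN1r.
Qed.

Lemma expo_lt0 : expo `]-oo, 0[ = 0%E.
Proof.
have -> : `]-oo, 0[%classic = ~` `[0, +oo[%classic :> set R by rewrite setCitvr.
have -> : expo (~` `[0, +oo[%classic) = (1 - expo `[0%R, +oo[%classic)%E by exact: probability_setC.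
by rewrite expo_ray// oppr0 expR0 subee.
Qed.

Lemma expo_ler (s : R) : 0 <= s <= 1 -> expo [set v | expR (- `|v|) <= s] = s%:E.
Proof.
move=> /andP[]; rewrite le_eqVlt => /predU1P[<- _|s0].
  rewrite (_ : [set v | _] = set0) ?measure0//.
  by apply/predeqP => v; split => //=; rewrite leNgt expR_gt0.
rewrite le_eqVlt => /predU1P[->|s1].
  rewrite (_ : [set v | _] = setT) ?expo_setT//.
  by apply/predeqP => v; split => //= _; rewrite -expR0 ler_expR oppr_le0.
have t0 : 0 < - ln s by rewrite oppr_gt0 ln_lt0// s0.
have E : [set v | expR (- `|v|) <= s] = `[- ln s, +oo[%classic `|` `]-oo, ln s]%classic.
  apply/predeqP => v /=; rewrite !in_itv/= andbT -{1}(lnK s0) ler_expR lerNl.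
  by rewrite ler_normr lerN2; split => [/orP[|]|[|]] ->; [left|right| |rewrite orbT].
have le0 : (expo `]-oo, ln s] <= 0)%E.
  rewrite -expo_lt0; apply: le_measure; rewrite ?inE//.
  by move=> v /=; rewrite !in_itv/= => /le_lt_trans; apply; rewrite -oppr_gt0.
have e0 : expo `]-oo, ln s] = 0%E by apply/eqP; rewrite eq_le le0 measure_ge0.
rewrite E measureU//; last first.
  apply/predeqP => v; split=> //=; rewrite !in_itv/= andbT => -[a1 a2].
  by move: t0; rewrite ltNge => /negP; apply; move: a1 a2; lra.
have e1 : expo `[- ln s, +oo[ = s%:E by rewrite expo_ray ?(ltW t0)// opprK lnK.
by rewrite [X in (_ + X)%E]e0 adde0; exact: e1.
Qed.

(** Uniform on [0, 1] under [expo]; the absolute value keeps it in ]0, 1] for every real [v]. *)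
Definition unif (v : R) : R := expR (- `|v|).

Lemma unif_gt0 v : 0 < unif v. Proof. exact: expR_gt0. Qed.

Lemma unif_le1 v : unif v <= 1. Proof. by rewrite -expR0 ler_expR oppr_le0. Qed.

Lemma measurable_unif : measurable_fun setT unif.
Proof. by apply: measurableT_comp => //; apply: measurable_funN; exact: normr_measurable. Qed.

Lemma expo_unif (a b : R) : 0 <= a -> a <= b -> b <= 1 ->
  fine (expo (unif @^-1` `]a, b])) = b - a.
Proof.
move=> a0 ab b1.
have m s : measurable (unif @^-1` `]-oo, s]).
  by rewrite -[X in measurable X]setTI; exact: measurable_unif.
have e s : 0 <= s <= 1 -> expo (unif @^-1` `]-oo, s]) = s%:E.
  move=> s01; have E : unif @^-1` `]-oo, s] = [set v | expR (- `|v|) <= s].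
    by apply/predeqP => v /=; rewrite in_itv.
  by rewrite E expo_ler.
have -> : unif @^-1` `]a, b] = unif @^-1` `]-oo, b] `\` unif @^-1` `]-oo, a].
  apply/predeqP => v /=; rewrite !in_itv/=; split=> [/andP[av ->]|[-> /negP]].
    by split=> //; apply/negP; rewrite -ltNge.
  by rewrite -ltNge => ->.
have D : expo (unif @^-1` `]-oo, b] `\` unif @^-1` `]-oo, a]) =
    (expo (unif @^-1` `]-oo, b]) - expo (unif @^-1` `]-oo, b] `&` unif @^-1` `]-oo, a]))%E.
  apply: measureD => //; by rewrite -ge0_fin_numE// fin_num_measure.
rewrite D setIidr; last by move=> v /=; rewrite !in_itv/= => /le_trans; apply.
rewrite (e b) ?(e a)//; lra.
Qed.

Let darboux N (g : R -> R) (c : nat -> R) : (0 < N)%N ->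
  measurable_fun setT g -> (forall u, `|g u| <= 1) -> (forall k, (k < N)%N -> 0 <= c k) ->
  (forall k u, (k < N)%N -> k%:R / N%:R < u -> u <= k.+1%:R / N%:R -> g u <= c k) ->
  \int[expo]_v g (unif v) <= N%:R^-1 * \sum_(k < N) c k.
Proof.
move=> N0 mg g1 c0 gc.
have N0' : 0 < N%:R :> R by rewrite ltr0n.
pose C k : set R := unif @^-1` `]k%:R / N%:R, k.+1%:R / N%:R].
have mC k : measurable (C k) by rewrite -[X in measurable X]setTI; exact: measurable_unif.
pose s n (v : R) : R := \sum_(k < n) c k * \1_(C k) v.
have ms n : measurable_fun setT (s n).
  by apply: measurable_sum => k; apply: measurable_funM => //; exact: measurable_indic.
have cb k v : `|c k * \1_(C k) v| <= `|c k|.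
  by rewrite normrM ler_piMr// indicE; case: (_ \in _); rewrite ?normr1 ?normr0.
have sb n v : `|s n v| <= \sum_(k < n) `|c k|.
  by apply: le_trans (ler_norm_sum _ _ _) _; apply: ler_sum => k _.
have si n : (n <= N)%N -> \int[expo]_v s n v = N%:R^-1 * \sum_(k < n) c k.
  elim: n => [_|n ih nN].
    rewrite big_ord0 mulr0 -[RHS](probability_Rintegral_cst expo).
    by apply: eq_Rintegral => v _; rewrite /s big_ord0.
  rewrite (_ : s n.+1 = fun v => s n v + c n * \1_(C n) v); last first.
    by apply/funext => v; rewrite /s big_ord_recr.
  rewrite (@bounded_RintegralD _ _ _ expo _ _ (\sum_(k < n) `|c k| + `|c n|)) //.
  - rewrite ih 1?ltnW// big_ord_recr mulrDr; congr (_ + _).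
    rewrite (@RintegralZl _ _ _ expo setT (\1_(C n)) (c n) measurableT); last first.
      apply: (@bounded_integrable _ _ _ expo _ 1); first exact: measurable_indic.
      by move=> v; rewrite indicE; case: (_ \in _); rewrite ?normr1 ?normr0.
    rewrite Rintegral_indic// mulrC expo_unif.
    + by congr (_ * _); rewrite -mulrBl -natr1 addrAC subrr add0r mul1r.
    + by rewrite divr_ge0.
    + by rewrite ler_pM2r ?invr_gt0// ler_nat.
    + by rewrite ler_pdivrMr// mul1r ler_nat.
  - by apply: measurable_funM => //; exact: measurable_indic.
  - by move=> v; rewrite (le_trans (sb n v))// lerDl.
  - by move=> v; rewrite (le_trans (cb n v))// lerDr sumr_ge0.
rewrite -si//; apply: (@le_bounded_Rintegral _ _ _ expo _ _ (1 + \sum_(k < N) `|c k|)).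
- by apply: measurableT_comp => //; exact: measurable_unif.
- exact: ms.
- by move=> v; rewrite (le_trans (g1 _))// lerDl sumr_ge0.
- by move=> v; rewrite (le_trans (sb N v))// lerDr.
move=> v; pose u := unif v.
have u0 : 0 < u * N%:R by rewrite mulr_gt0// unif_gt0.
have [k kN /andP[ku uk]] : exists2 k, (k < N)%N & k%:R < u * N%:R <= k.+1%:R.
  have u1 : u * N%:R <= N.-1.+1%:R by rewrite prednK// ler_piMl// unif_le1.
  have ex : exists k : nat, u * N%:R <= k.+1%:R by exists N.-1.
  case: (ex_minnP ex) => m mu mmin.
  have mN : (m < N)%N by rewrite -(prednK N0) ltnS mmin.
  exists m => //; rewrite mu andbT; case: m mu mmin mN => // m mu mmin _.
  by rewrite ltNge; apply/negP => /mmin; rewrite ltnn.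
have kI : (v \in C k) by rewrite inE /C /= in_itv/= ltr_pdivrMr// ler_pdivlMr// ku uk.
rewrite /s (bigD1 (Ordinal kN))//= indicE kI mulr1.
apply: (@le_trans _ _ (c k)).
  by apply: gc => //; rewrite ?ltr_pdivrMr ?ler_pdivlMr.
rewrite lerDl; apply: sumr_ge0 => i _; apply: mulr_ge0; first exact: c0.
by rewrite indicE.
Qed.

(** Upper and lower sums of a monotone function with values in [0, 1] differ by at most [1 / N]. The
    error does not depend on [h], so it survives a limit along an ultrafilter. *)
Lemma monotone_riemann N (h : R -> R) : (0 < N)%N ->
  (forall u, 0 <= h u <= 1) -> {homo h : u w / u <= w >-> w <= u} ->
  `|\int[expo]_v h (unif v) - N%:R^-1 * \sum_(k < N) h (k%:R / N%:R)| <= N%:R^-1.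
Proof.
move=> N0 h01 hmono.
have N0' : 0 < N%:R :> R by rewrite ltr0n.
have mh : measurable_fun setT h by apply: nonincreasing_measurable => // u w /hmono.
have hb u : `|h u| <= 1 by case/andP: (h01 u) => ? ?; rewrite ger0_norm.
have hb' u : `|1 - h u| <= 1 by have := h01 u; rewrite ler_norml; lra.
have up := @darboux N h (fun k => h (k%:R / N%:R)) N0 mh hb _ _.
(* The lower bound is the upper bound for [1 - h], taken at right end points. *)
have lo := @darboux N (fun u => 1 - h u) (fun k => 1 - h (k.+1%:R / N%:R)) N0 _ hb' _ _.
have {}up : \int[expo]_v h (unif v) <= N%:R^-1 * \sum_(k < N) h (k%:R / N%:R).
  apply: up => [k _|k u _ ku _]; first by case/andP: (h01 (k%:R / N%:R)).
  by apply: hmono; exact: ltW.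
have {}lo : \int[expo]_v (1 - h (unif v)) <= N%:R^-1 * \sum_(k < N) (1 - h (k.+1%:R / N%:R)).
  apply: lo => [|k _|k u _ _ uk]; first exact: measurable_funB.
    by rewrite subr_ge0; case/andP: (h01 (k.+1%:R / N%:R)).
  by rewrite lerD2l lerN2 hmono.
move: lo; rewrite (@bounded_RintegralB _ _ _ expo (fun=> 1) _ 1)//; last 2 first.
- by apply: measurableT_comp => //; exact: measurable_unif.
- by move=> ?; rewrite normr1.
rewrite (probability_Rintegral_cst expo 1) sumrB sumr_const card_ord mulrBr mulVf ?gt_eqF// => lo.
have tel : \sum_(k < N) h (k.+1%:R / N%:R) = \sum_(k < N) h (k%:R / N%:R) - h 0 + h (N%:R / N%:R).
  case: N N0 {N0' up lo} => // N _.
  rewrite big_ord_recr [in RHS]big_ord_recl /= mul0r.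
  by rewrite [X in X - _]addrC addrK.
move: lo; rewrite tel mulrDr mulrBr => lo.
have h0 := h01 0; have h1 := h01 (N%:R / N%:R).
have Ni : 0 <= N%:R^-1 :> R by rewrite invr_ge0 ltW.
have e1 : N%:R^-1 * h 0 <= N%:R^-1 by rewrite ler_piMr//; case/andP: h0.
have e2 : 0 <= N%:R^-1 * h (N%:R / N%:R) by rewrite mulr_ge0//; case/andP: h1.
by rewrite ler_norml; apply/andP; split; lra.
Qed.

End exponential_law.

Arguments expo R : clear implicits.

(** * Quantile functions and their limits *)

Section quantile.
Context (R : realType).
Local Notation e := (@expN_extnng R).
Local Notation expo := (expo R).
Local Notation unif := (@unif R).

Let S (nu : probability (extnng R) R) (w : R) : R := fine (nu [set l | w <= e l]).

Let mS w : measurable [set l | w <= e l].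
Proof.
rewrite -[X in measurable X]setTI -(_ : e @^-1` `[w, +oo[ = [set l | w <= e l]).
  exact: measurable_expN_extnng.
by apply/predeqP => l /=; rewrite in_itv/= andbT.
Qed.

(* Nonincreasing in [u]: the left-continuous inverse of the survival function of [e l]. *)
Definition quantile (nu : probability (extnng R) R) (u : R) : R :=
  sup [set w | 0 <= w <= 1 /\ Num.min u 1 <= S nu w].

Let Smono nu : {homo S nu : u w / u <= w >-> w <= u}.
Proof.
move=> u w uw; apply: fine_le; rewrite ?fin_num_measure//.
by apply: le_measure; rewrite ?inE// => l /=; exact: le_trans.
Qed.

Let S0 nu : S nu 0 = 1.
Proof.
rewrite /S (_ : [set l | _] = setT).
  by have -> : nu setT = 1%E by exact: probability_setT.
by apply/predeqP => l; split => //= _; exact: expN_extnng_ge0.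
Qed.

(** Left continuity of the survival function: the sets [w' <= e l] decrease to [w <= e l] as [w']
    increases to [w]. The approximants [w - w / (n + 1)] stay nonnegative. *)
Let Sleft nu w u : 0 < w -> (forall w', 0 <= w' -> w' < w -> u <= S nu w') -> u <= S nu w.
Proof.
move=> w0 H.
have c : fine (nu [set l | w - w * n.+1%:R^-1 <= e l]) @[n --> \oo] --> S nu w.
  have mI : forall A : set (extnng R), measurable A -> measurable_fun setT (\1_A : extnng R -> R).
    by move=> A mA; exact: measurable_indic.
  rewrite /S -(Rintegral_indic nu (mS w)).
  rewrite (_ : (fun n => _) = fun n => \int[nu]_l (\1_[set l | w - w * n.+1%:R^-1 <= e l] l)); last first.
    by apply/funext => n; rewrite Rintegral_indic.
  apply: (@bounded_cvg_Rintegral _ _ _ nu _ _ 1).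
  - by move=> n; exact: mI.
  - move=> l; have [wl|lw] := leP w (e l).
      apply: cvg_near_cst; apply: nearW => n; apply/eqP; rewrite !indicE !mem_set//=.
      by rewrite (le_trans _ wl)// gerBl mulr_ge0// ?invr_ge0// ltW.
    have d0 : 0 < (w - e l) / w by rewrite divr_gt0// subr_gt0.
    apply: cvg_near_cst; near=> n; apply/eqP; rewrite !indicE !memNset//=.
      by apply/negP; rewrite -ltNge.
    apply/negP; rewrite -ltNge ltrBrDl -ltrBrDr mulrC -ltr_pdivlMr//.
    near: n; exact: near_infty_natSinv_lt (PosNum d0).
  - by move=> n l; rewrite indicE; case: (_ \in _); rewrite ?normr1 ?normr0.
apply: (cvgr_to_ge c); apply: nearW => n; apply: H.
  by rewrite subr_ge0 ler_piMr ?(ltW w0)// invf_le1 ?ler1n.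
by rewrite gtrBl mulr_gt0// invr_gt0.
Unshelve. all: by end_near. Qed.

Let qset nu u := [set w | 0 <= w <= 1 /\ Num.min u 1 <= S nu w].

(** The cap of [u] at 1 makes 0 admissible for every real [u], because [S nu 0 = 1]. *)
Let qset0 nu u : qset nu u 0.
Proof. by split; rewrite ?lexx ?ler01// S0 ge_min lexx orbT. Qed.

Let qsup nu u : has_sup (qset nu u).
Proof. by split; [exists 0; exact: qset0|exists 1 => w [/andP[]]]. Qed.

Lemma quantile01 nu u : 0 <= quantile nu u <= 1.
Proof.
apply/andP; split.
  by apply: ub_le_sup; [case: (qsup nu u)|exact: qset0].
by apply: ge_sup; [exists 0; exact: qset0|move=> w [/andP[]]].
Qed.

Lemma quantile_noninc nu : {homo quantile nu : u w / u <= w >-> w <= u}.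
Proof.
move=> u u' uu'; apply: sup_le; [|by exists 0; exact: qset0|exact: qsup].
move=> w [w01 wS]; apply/downP; exists w => //; split=> //; apply: (le_trans _ wS).
by rewrite le_min !ge_min uu' lexx orbT.
Qed.

(** A Galois connection; left continuity of [S] is what makes it hold at the supremum itself. *)
Lemma quantile_ge nu u w : u <= 1 -> 0 <= w <= 1 ->
  (w <= quantile nu u) = (u <= S nu w).
Proof.
move=> u1 /andP[w0 w1]; have mu : Num.min u 1 = u by apply: min_l.
apply/idP/idP => [wq|uS]; last first.
  apply: ub_le_sup; first by case: (qsup nu u).
  by split; rewrite ?w0 ?w1// mu.
move: w0; rewrite le_eqVlt => /predU1P[<-|w0]; first by rewrite S0.
apply: (Sleft w0) => w' w'0 w'w.
have qw : 0 < quantile nu u - w' by rewrite subr_gt0 (lt_le_trans w'w).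
have [t [_ tS]] := sup_adherent qw (qsup nu u).
rewrite -/(quantile nu u) opprB addrC subrK => w't.
by rewrite mu in tS; rewrite (le_trans tS)// Smono// ltW.
Qed.

Let mq (q : R -> R) : {homo q : u w / u <= w >-> w <= u} -> measurable_fun setT (fun v => q (unif v)).
Proof.
move=> hq; apply: (@measurableT_comp _ _ _ _ _ _ q); last exact: measurable_unif.
by apply: nonincreasing_measurable => // u w /hq.
Qed.

Let quantile_law (nu : probability (extnng R) R) (A : set (extnng R)) : measurable A ->
  nu A = expo ((fun v => rexpN_extnng (quantile nu (unif v))) @^-1` A).
Proof.
move=> mA; have [B mB AB] := measurable_extnng_preimage mA.
(* After the change of sign, the open rays of [measure_eq_ray] are complements of the closed rays
   that [quantile_ge] describes. *)
have -> : (fun v => rexpN_extnng (quantile nu (unif v))) @^-1` A =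
    (fun v => - quantile nu (unif v)) @^-1` (-%R @^-1` B).
  by rewrite AB; apply/predeqP => v /=; rewrite opprK rexpN_extnngK// quantile01.
have -> : A = (fun l => - e l) @^-1` (-%R @^-1` B).
  by rewrite AB; apply/predeqP => l /=; rewrite opprK.
have mNB : measurable (-%R @^-1` B) by rewrite -[X in measurable X]setTI; exact: oppr_measurable.
apply: (@measure_eq_ray _ _ _ _ _ nu expo _ _ _ _ _ _ _ mNB).
- by apply: measurable_funN; exact: measurable_expN_extnng.
- by apply: measurable_funN; apply: mq; exact: quantile_noninc.
- by rewrite -ge0_fin_numE// fin_num_measure.
move=> r; pose w := - r.
have E1 : (fun l => - e l) @^-1` `]r, +oo[ = ~` [set l | w <= e l].
  apply/predeqP => l /=; rewrite in_itv/= andbT ltrNr; split=> [|/negP].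
    by rewrite ltNge => /negP.
  by rewrite -ltNge.
have E2 : (fun v => - quantile nu (unif v)) @^-1` `]r, +oo[ = ~` [set v | w <= quantile nu (unif v)].
  apply/predeqP => l /=; rewrite in_itv/= andbT ltrNr; split=> [|/negP].
    by rewrite ltNge => /negP.
  by rewrite -ltNge.
have mQ : measurable [set v | w <= quantile nu (unif v)].
  rewrite -[X in measurable X]setTI.
  have := mq (@quantile_noninc nu) measurableT (measurable_itv `[w, +oo[).
  by congr (measurable (_ `&` _)); apply/predeqP => v /=; rewrite in_itv/= andbT.
rewrite E1 E2.
suff : nu [set l | w <= e l] = expo [set v | w <= quantile nu (unif v)].
  move=> E; apply: etrans (@probability_setC _ _ _ nu _ (mS w)) _.
  by apply: etrans (esym (@probability_setC _ _ _ expo _ mQ)); rewrite E.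
have [w0|w0] := ltP w 0.
  have -> : [set l | w <= e l] = setT.
    by apply/predeqP => l; split => //= _; rewrite (le_trans (ltW w0))// expN_extnng_ge0.
  have -> : [set v | w <= quantile nu (unif v)] = setT.
    by apply/predeqP => l; split => //= _; rewrite (le_trans (ltW w0))//; case/andP: (quantile01 nu (unif l)).
  exact: etrans (@probability_setT _ _ _ nu) (esym (@probability_setT _ _ _ expo)).
have [w1|w1] := leP w 1; last first.
  have -> : [set l | w <= e l] = set0.
    by apply/predeqP => l; split => //=; rewrite leNgt (le_lt_trans _ w1)// expN_extnng_le1.
  have -> : [set v | w <= quantile nu (unif v)] = set0.
    by apply/predeqP => l; split => //=; rewrite leNgt (le_lt_trans _ w1)//; case/andP: (quantile01 nu (unif l)).
  exact: etrans (@measure0 _ _ _ nu) (esym (@measure0 _ _ _ expo)).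
have -> : [set v | w <= quantile nu (unif v)] = [set v | expR (- `|v|) <= S nu w].
  by apply/predeqP => v /=; rewrite quantile_ge ?unif_le1// w0.
rewrite expo_ler; last first.
  rewrite fine_ge0//= -lee_fin fineK ?fin_num_measure//; exact: probability_le1.
by rewrite fineK// fin_num_measure.
Qed.

(** At each [u] the quantiles lie in [0, 1] and converge along [U]. The limit [q] is again monotone,
    and the image under [q] of a uniform variable is the limit measure; convergence is checked on
    the moments of [e]. *)
Theorem extnng_compact (U : set_system nat) {FU : UltraFilter U}
    (nu_ : nat -> probability (extnng R) R) :
  exists nu : probability (extnng R) R,
    forall f : extnng R -> R, continuous f -> \int[nu_ n]_l f l @[n --> U] --> \int[nu]_l f l.
Proof.
have /choice[q Hq] : forall u, exists l : R, 0 <= l <= 1 /\ quantile (nu_ n) u @[n --> U] --> l.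
  move=> u; pose f n := quantile (nu_ n) u.
  have [l [l01 ul]] : `[0, 1]%classic `&` cluster (f @ U) !=set0.
    have UI : (f @ U) `[0, 1]%classic.
      by apply: (@filterE _ U) => n; rewrite /= in_itv /=; exact: quantile01.
    exact: (@segment_compact R 0 1 (f @ U) _ UI).
  exists l; split; first by move: l01; rewrite /= in_itv.
  (* A cluster point of an ultrafilter is a limit. *)
  move=> B lB; have [//|UB] := in_ultra_setVsetC (f @^-1` B) FU.
  by have [x [/= nBx Bx]] := ul (~` B) B UB lB.
have q01 u : 0 <= q u <= 1 by case: (Hq u).
have qc u : quantile (nu_ n) u @[n --> U] --> q u by case: (Hq u).
have qmono : {homo q : u w / u <= w >-> w <= u}.
  move=> u w uw; apply: (ler_cvg_to (qc w) (qc u)).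
  by apply: nearW => n; exact: quantile_noninc.
pose theta v := rexpN_extnng (q (unif v)).
have mtheta : measurable_fun setT theta.
  by apply: (measurableT_comp (@measurable_rexpN_extnng R)); exact: mq.
pose thetaM : {mfun R >-> extnng R} := HB.pack theta (isMeasurableFun.Build _ _ _ _ theta mtheta).
exists (distribution expo thetaM) => f cf; apply: cvg_moments cf => k.
pose h (p : R -> R) u := p u ^+ k.
(* Finitely many values of the quantile function give the k-th moment up to [1 / N], with the same
   nodes for all measures, and these values converge along [U]. *)
have moment (nu : probability (extnng R) R) (p : R -> R) : (forall u, 0 <= p u <= 1) ->
    {homo p : u w / u <= w >-> w <= u} ->
    (forall A, measurable A -> nu A = expo ((fun v => rexpN_extnng (p (unif v))) @^-1` A)) ->
    forall N, (0 < N)%N ->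
    `|\int[nu]_l e l ^+ k - N%:R^-1 * \sum_(i < N) p (i%:R / N%:R) ^+ k| <= N%:R^-1.
  move=> p01 pm law N N0.
  have -> : \int[nu]_l e l ^+ k = \int[expo]_v (h p) (unif v).
    rewrite (@Rintegral_transfer _ _ _ _ _ expo nu (fun v => rexpN_extnng (p (unif v))) (fun l => e l ^+ k) 1)//.
    - by apply: eq_Rintegral => v _; rewrite rexpN_extnngK.
    - by apply: (measurableT_comp (@measurable_rexpN_extnng R)); exact: mq.
    - by apply: measurable_funX; exact: measurable_expN_extnng.
    - by move=> l; rewrite ger0_norm ?exprn_ge0 ?expN_extnng_ge0// exprn_ile1 ?expN_extnng_ge0 ?expN_extnng_le1.
  apply: (@monotone_riemann R N (h p)) => //.
    by move=> u; have /andP[? ?] := p01 u; rewrite /h exprn_ge0// exprn_ile1.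
  move=> u w uw; rewrite /h lerXn2r ?nnegrE ?pm//; by [case/andP: (p01 u)|case/andP: (p01 w)].
apply/cvgrPdist_lt => eps eps0.
have eps4 : 0 < eps / 4 by rewrite divr_gt0.
have [N N0 Neps] : exists2 N, (0 < N)%N & N%:R^-1 < eps / 4 :> R.
  have [m _ /(_ m (leqnn m))] := near_infty_natSinv_lt (PosNum eps4); by exists m.+1.
have csum m : \sum_(i < m) quantile (nu_ n) (i%:R / N%:R) ^+ k @[n --> U] -->
    \sum_(i < m) q (i%:R / N%:R) ^+ k.
  elim: m => [|m ih].
    rewrite big_ord0 (_ : (fun n => _) = fun=> 0); first exact: cvg_cst.
    by apply/funext => n; rewrite big_ord0.
  rewrite big_ord_recr (_ : (fun n => _) =
    fun n => \sum_(i < m) quantile (nu_ n) (i%:R / N%:R) ^+ k + quantile (nu_ n) (m%:R / N%:R) ^+ k).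
    by apply: cvgD => //; apply: (continuous_cvg _ (@exprn_continuous R k _)); exact: qc.
  by apply/funext => n; rewrite big_ord_recr.
have cs : N%:R^-1 * \sum_(i < N) quantile (nu_ n) (i%:R / N%:R) ^+ k @[n --> U] -->
    N%:R^-1 * \sum_(i < N) q (i%:R / N%:R) ^+ k.
  exact: cvgMr.
have /cvgrPdist_lt/(_ _ eps4) := cs.
apply: filterS => n hn.
have h1 := moment _ _ (quantile01 (nu_ n)) (@quantile_noninc (nu_ n)) (@quantile_law (nu_ n)) N N0.
have h2 := moment (distribution expo thetaM) q q01 qmono (fun A _ => erefl) N N0.
set A := \int[distribution expo thetaM]_l e l ^+ k in h2 *; set B := \int[nu_ n]_l e l ^+ k in h1 *.
set A' := N%:R^-1 * _ in h2 hn; set B' := N%:R^-1 * _ in h1 hn.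
rewrite (_ : A - B = (A - A') + (A' - B') - (B - B')); last by ring.
rewrite (le_lt_trans (ler_normB _ _))//.
apply: (@le_lt_trans _ _ (`|A - A'| + `|A' - B'| + `|B - B'|)); first by rewrite lerD2r ler_normD.
move: h1 h2 hn Neps; lra.
Qed.

End quantile.

(** * F is a distribution function *)

(* Summed over [N] equal steps the bounds telescope to [(a1 - a0) / N * (Psi a1 - Psi a0)]. *)
Lemma eq_of_quadratic_increments (R : realType) (D Psi : R -> R) (a0 a1 : R) : a0 <= a1 ->
  (forall a a', a0 <= a -> a <= a' -> `|D a' - D a| <= (a' - a) * (Psi a' - Psi a)) -> D a0 = D a1.
Proof.
move=> a01 H; have [->//|] := eqVneq a0 a1; rewrite eq_sym => ne.
have d0 : 0 < a1 - a0 by rewrite subr_gt0 lt_neqAle eq_sym ne.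
apply/esym/eqP; rewrite -subr_eq0 -normr_eq0; apply/negP => /negP Dn0.
have D0 : 0 < `|D a1 - D a0| by rewrite lt_neqAle eq_sym Dn0 normr_ge0.
pose K := (a1 - a0) * (Psi a1 - Psi a0).
have [N KN] : exists N : nat, K / `|D a1 - D a0| < N.+1%:R.
  have [n _ /(_ n (leqnn n)) /= h] := nbhs_infty_gtr (K / `|D a1 - D a0|).
  by exists n; rewrite (lt_le_trans h)// ler_nat.
have N0 : 0 < N.+1%:R :> R by rewrite ltr0n.
pose h := (a1 - a0) / N.+1%:R.
have h0 : 0 <= h by rewrite divr_ge0// ltW.
have step k : `|D (a0 + k%:R * h) - D a0| <= h * (Psi (a0 + k%:R * h) - Psi a0).
  elim: k => [|k ih]; first by rewrite mul0r addr0 !subrr normr0 mulr0.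
  have e1 : a0 <= a0 + k%:R * h by rewrite lerDl mulr_ge0.
  have e2 : a0 + k%:R * h <= a0 + k.+1%:R * h by rewrite lerD2l ler_wpM2r// ler_nat.
  have := H _ _ e1 e2.
  have -> : a0 + k.+1%:R * h - (a0 + k%:R * h) = h by rewrite -natr1; ring.
  move=> e3; rewrite -(subrK (D (a0 + k%:R * h)) (D (a0 + k.+1%:R * h))) -addrA.
  rewrite (le_trans (ler_normD _ _))//; move: e3 ih; rewrite !mulrBr; lra.
have xN : a0 + N.+1%:R * h = a1 by rewrite /h; field; rewrite addrC natr1 gt_eqF.
have := step N.+1; rewrite xN.
apply/negP; rewrite -ltNge /h mulrAC -/K ltr_pdivrMr//.
by rewrite mulrC -ltr_pdivrMr.
Qed.

(** [p x' - p' x = p (x' - x) + (p - p') x], with both coefficients at most 1. The right-hand side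
    is the increment of [x - p], in the form that [eq_of_quadratic_increments] asks for. *)
Lemma weighted_increment_le (R : realFieldType) (p p' x x' B : R) :
  0 <= p' <= p -> p <= 1 -> 0 <= x <= x' -> x <= 1 -> 0 <= B <= 1 ->
  B * (p * x' - p' * x) <= x' - p' - (x - p).
Proof.
move=> /andP[p'0 pp] p1 /andP[x0 xx] x1 /andP[B0 B1].
have h0 : 0 <= p * x' - p' * x by rewrite subr_ge0 ler_pM.
apply: (le_trans (ler_piMl h0 B1)).
have h1 : p * (x' - x) <= x' - x by rewrite ler_piMl// subr_ge0.
have h2 : (p - p') * x <= p - p' by rewrite ler_piMr// subr_ge0.
by move: h1 h2; rewrite mulrBr mulrBl; lra.
Qed.

(** * The conditional law of the second component *)

Section conditional_survival.
Context d (T : measurableType d) (R : realType) (P : probability T R) (W : T -> R).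
Hypothesis mW : measurable_fun setT W.
Hypothesis W0 : forall x, 0 <= W x.
Hypothesis EW : (\int[P]_x (W x)%:E <= 1)%E.
Implicit Types a c : R.

Let m a c := \int[P]_x Num.min a (c * W x).
(** Where [m] is differentiable in [a], its derivative is [1 - g a c]. Hence
    [expR (- a) * cond_surv a c] is minus the derivative in [a] of the joint survival function
    [exp(-(a + c - m a c))]. *)
Let g a c := fine (P [set x | c * W x <= a]).

(* The conditional probability that the second component of the limit law exceeds [c], in
   exponential scale, given that the first one equals [a]. *)
Definition cond_surv a c : R := expR (- (c - m a c)) * g a c.
Local Notation H := cond_surv.

Let mcW c : measurable_fun setT (fun x => c * W x). Proof. exact: measurable_funM. Qed.

Let mmin a c : measurable_fun setT (fun x => Num.min a (c * W x)).
Proof. exact: measurable_minr. Qed.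

Let min_bound a c x : 0 <= a -> 0 <= c -> `|Num.min a (c * W x)| <= a.
Proof.
move=> a0 c0; have cW : 0 <= c * W x by rewrite mulr_ge0.
by rewrite ger0_norm ?ge_min ?lexx// le_min a0.
Qed.

Let mA a c : measurable [set x | c * W x <= a].
Proof.
rewrite -[X in measurable X]setTI.
have := mcW c measurableT (measurable_itv `]-oo, a]).
by congr (measurable (_ `&` _)); apply/predeqP => x /=; rewrite in_itv.
Qed.

Let g01 a c : 0 <= g a c <= 1.
Proof.
rewrite fine_ge0//= -lee_fin fineK ?fin_num_measure//; exact: probability_le1.
Qed.

Let gE a c : g a c = \int[P]_x (\1_[set x | c * W x <= a] x).
Proof. by rewrite Rintegral_indic. Qed.

Let mind a c : measurable_fun setT (\1_[set x | c * W x <= a] : T -> R).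
Proof. exact: measurable_indic. Qed.

Let indb a c x : `|\1_[set x | c * W x <= a] x| <= 1 :> R.
Proof. by rewrite indicE; case: (_ \in _); rewrite ?normr1 ?normr0. Qed.

Let indE a c x : \1_[set x | c * W x <= a] x = ((c * W x <= a)%R)%:R :> R.
Proof. by rewrite indicE; congr (nat_of_bool _)%:R; apply/idP/idP; rewrite inE. Qed.

Let g_mono a a' c : a <= a' -> g a c <= g a' c.
Proof.
move=> aa; apply: fine_le; rewrite ?fin_num_measure//.
by apply: le_measure; rewrite ?inE// => x /= /le_trans; apply.
Qed.

Let g_lt0 a c : 0 < c -> a < 0 -> g a c = 0.
Proof.
move=> c0 a0; rewrite /g (_ : [set x | _] = set0) ?measure0//.
by apply/predeqP => x; split => //=; rewrite leNgt (lt_le_trans a0)// mulr_ge0// ltW.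
Qed.

Let m_le a c : 0 <= a -> 0 <= c -> 0 <= m a c <= a.
Proof.
move=> a0 c0; apply/andP; split.
  by apply: Rintegral_ge0 => x _; rewrite le_min a0 mulr_ge0.
rewrite (le_trans (ler_norm _))//; apply: normr_bounded_Rintegral => // x.
exact: min_bound.
Qed.

(** [a - m a c] is the mean of the positive part of [a - c W], a convex function of [a] with right
    derivative [g a c]; its increments lie between the slopes at the end points. *)
Let m_incr a a' c : 0 <= a -> a <= a' -> 0 <= c ->
  (a' - a) * g a c <= (a' - a) - (m a' c - m a c) <= (a' - a) * g a' c.
Proof.
move=> a0 aa c0; have a'0 : 0 <= a' := le_trans a0 aa.
have d0 : 0 <= a' - a by rewrite subr_ge0.
have E : (a' - a) - (m a' c - m a c) =
    \int[P]_x ((a' - a) - (Num.min a' (c * W x) - Num.min a (c * W x))).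
  rewrite (@bounded_RintegralB _ _ _ P (fun=> a' - a) _ (a' + a)).
  - rewrite (probability_Rintegral_cst P) (@bounded_RintegralB _ _ _ P _ _ (a' + a))//.
    + by move=> x; rewrite (le_trans (min_bound _ _ _))// lerDl.
    + by move=> x; rewrite (le_trans (min_bound _ _ _))// lerDr.
  - by [].
  - exact: measurable_funB.
  - by move=> _; rewrite ger0_norm//; lra.
  - by move=> x; rewrite (le_trans (ler_normB _ _))// lerD// min_bound.
have Eg b : (a' - a) * g b c = \int[P]_x ((a' - a) * \1_[set x | c * W x <= b] x).
  rewrite gE; apply/esym; apply: (@RintegralZl _ _ _ P setT (\1_[set x | c * W x <= b] : T -> R) _ measurableT).
  exact: (@bounded_integrable _ _ _ P _ 1 (mind b c) (indb b c)).
have mB : measurable_fun setT (fun x => (a' - a) - (Num.min a' (c * W x) - Num.min a (c * W x))).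
  by apply: measurable_funB => //; exact: measurable_funB.
have bB x : `|(a' - a) - (Num.min a' (c * W x) - Num.min a (c * W x))| <= (a' - a) + (a' + a).
  apply: le_trans (ler_normB _ _) _; apply: lerD; first by rewrite ger0_norm.
  by apply: le_trans (ler_normB _ _) _; apply: lerD; exact: min_bound.
have mI b : measurable_fun setT (fun x => (a' - a) * \1_[set x | c * W x <= b] x).
  exact: measurable_funM.
have bI b x : `|(a' - a) * \1_[set x | c * W x <= b] x| <= (a' - a) + (a' + a).
  rewrite normrM (ger0_norm d0) (@le_trans _ _ (a' - a))//; last by rewrite lerDl addr_ge0.
  by rewrite ler_piMr.
rewrite E !Eg; apply/andP; split;
  apply: (@le_bounded_Rintegral _ _ _ P _ _ ((a' - a) + (a' + a))) => // x; rewrite indE.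
- have [cW|cW] := leP (c * W x) a; last first.
    rewrite mulr0; have : Num.min a' (c * W x) <= a' by rewrite ge_min lexx.
    by lra.
  by rewrite min_r ?(le_trans cW)// subrr subr0 mulr1.
- have [cW|cW] := leP (c * W x) a'.
    by rewrite mulr1 gerBl subr_ge0 ge_min lexx orbT.
  by rewrite mulr0 (min_l (le_trans aa (ltW cW))); lra.
Qed.

Let m_mono a a' c : 0 <= a -> a <= a' -> 0 <= c -> m a c <= m a' c.
Proof.
move=> a0 aa c0; have /andP[_ h] := m_incr a0 aa c0.
apply: (@le_bounded_Rintegral _ _ _ P _ _ a') => // x.
- by rewrite (le_trans (min_bound _ a0 c0)).
- by rewrite min_bound// (le_trans a0).
- by rewrite le_min ge_min aa/= ge_min lexx orbT.
Qed.

(** The hypothesis [EW] enters here: [min(a, c W)] grows by at most [(c' - c) W]. Consequently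
    [c - m a c] is nonnegative and nondecreasing in [c], as a survival function demands. *)
Let m_lip a c c' : 0 <= a -> 0 <= c -> c <= c' -> 0 <= m a c' - m a c <= c' - c.
Proof.
move=> a0 c0 cc; have c'0 : 0 <= c' := le_trans c0 cc.
have d0 : 0 <= c' - c by rewrite subr_ge0.
have E : m a c' - m a c = \int[P]_x (Num.min a (c' * W x) - Num.min a (c * W x)).
  by rewrite (@bounded_RintegralB _ _ _ P _ _ a)// => x; exact: min_bound.
have mB : measurable_fun setT (fun x => Num.min a (c' * W x) - Num.min a (c * W x)).
  exact: measurable_funB.
have B0 x : 0 <= Num.min a (c' * W x) - Num.min a (c * W x).
  by rewrite subr_ge0 le_min !ge_min lexx/= ler_wpM2r// orbT.
rewrite E; apply/andP; split; first exact: Rintegral_ge0.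
have ib : P.-integrable setT (fun x => (Num.min a (c' * W x) - Num.min a (c * W x))%:E).
  apply: (@bounded_integrable _ _ _ P _ (a + a) mB) => x.
  by rewrite (le_trans (ler_normB _ _))// lerD// min_bound.
rewrite -lee_fin /Rintegral fineK; last exact: integrable_fin_num.
apply: (@le_trans _ _ (\int[P]_x ((c' - c)%:E * (W x)%:E))%E).
  apply: ge0_le_integral => //.
  - by move=> x _; rewrite lee_fin.
  - by apply/measurable_EFinP.
  - by apply/measurable_EFinP; exact: measurable_funM.
  - move=> x _; rewrite -EFinM lee_fin mulrBl.
    have h1 : Num.min a (c' * W x) <= a by rewrite ge_min lexx.
    have h2 : Num.min a (c' * W x) <= c' * W x by rewrite ge_min lexx orbT.
    have h3 : c * W x <= c' * W x by rewrite ler_wpM2r.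
    by have [h|h] := leP a (c * W x); lra.
rewrite ge0_integralZl//.
- by rewrite -[leRHS]mule1; apply: lee_wpmul2l => //; rewrite lee_fin.
- exact/measurable_EFinP.
- by move=> x _; rewrite lee_fin.
Qed.

Let m_le_c a c : 0 <= a -> 0 <= c -> m a c <= c.
Proof.
move=> a0 c0; have /andP[_] := m_lip a0 (lexx 0) c0.
rewrite subr0; have -> : m a 0 = 0; last by rewrite subr0.
rewrite -[RHS](probability_Rintegral_cst P); apply: eq_Rintegral => x _.
by rewrite mul0r min_r.
Qed.

Lemma cond_surv01 a c : 0 < c -> 0 <= H a c <= 1.
Proof.
move=> c0; have /andP[g0 g1] := g01 a c; rewrite mulr_ge0 ?expR_ge0//=.
have [a0|a0] := ltP a 0; first by rewrite /H g_lt0// mulr0.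
rewrite mulr_ile1 ?expR_ge0// -expR0 ler_expR oppr_le0 subr_ge0.
by apply: m_le_c => //; exact: ltW.
Qed.

Lemma cond_surv_mono a a' c : 0 < c -> a <= a' -> H a c <= H a' c.
Proof.
move=> c0 aa; have [a0|a0] := ltP a 0.
  by rewrite {1}/H g_lt0// mulr0; case/andP: (cond_surv01 a' c0).
have /andP[g0 _] := g01 a c.
rewrite ler_pM ?expR_ge0// ?g_mono// ler_expR lerN2 lerD2l lerN2.
by apply: m_mono => //; exact: ltW.
Qed.

Lemma cond_surv_anti a c c' : 0 <= a -> 0 < c -> c <= c' -> H a c' <= H a c.
Proof.
move=> a0 c0 cc; have /andP[g0 _] := g01 a c'.
rewrite ler_pM ?expR_ge0//.
  by rewrite ler_expR lerN2; have /andP[_] := m_lip a0 (ltW c0) cc; lra.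
apply: fine_le; rewrite ?fin_num_measure//.
by apply: le_measure; rewrite ?inE// => x /=; apply: le_trans; rewrite ler_wpM2r.
Qed.

Lemma measurable_cond_surv c : 0 < c -> measurable_fun setT (H ^~ c).
Proof. by move=> c0; apply: nondecreasing_measurable => // a a' aa; exact: cond_surv_mono. Qed.

Let cvg_m a (c_ : nat -> R) c : 0 <= a -> (forall n, 0 <= c_ n) -> c_ n @[n --> \oo] --> c ->
  m a (c_ n) @[n --> \oo] --> m a c.
Proof.
move=> a0 c_0 cc; apply: (@bounded_cvg_Rintegral _ _ _ P _ _ a) => //.
- move=> x; apply: (@cvg_comp _ _ _ c_ (fun t => Num.min a (t * W x)) _ (nbhs c) _ cc).
  apply: (@continuous_min R R (cst a) (fun t => t * W x)); first exact: cvg_cst.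
  by apply: cvgMl; exact: cvg_id.
- by move=> n x; exact: min_bound.
Qed.

(** The approach is from the left because the indicator of [c W <= a] jumps once [c W] passes
    [a]. *)
Let cvg_H a (c_ : nat -> R) c : 0 <= a -> (forall n, 0 <= c_ n) -> c_ n @[n --> \oo] --> c ->
  (forall n, c_ n <= c) ->
  H a (c_ n) @[n --> \oo] --> H a c.
Proof.
move=> a0 c_0 cc c_c; apply: cvgM.
  apply: (continuous_cvg _ (@continuous_expR R _)); apply: cvgN; apply: cvgB => //; exact: cvg_m.
rewrite gE (_ : (fun n => _) = fun n => \int[P]_x (\1_[set x | c_ n * W x <= a] x)); last first.
  by apply/funext => n; exact: gE.
apply: (@bounded_cvg_Rintegral _ _ _ P _ _ 1) => // x.
rewrite (_ : (fun n => _) = fun n => ((c_ n * W x <= a)%R)%:R); last by apply/funext => n; exact: indE.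
rewrite indE; have [h|h] := leP (c * W x) a.
  apply: cvg_near_cst; apply: nearW => n; apply/eqP.
  by have -> : c_ n * W x <= a by rewrite (le_trans _ h)// ler_wpM2r.
have cw : c_ n * W x @[n --> \oo] --> c * W x by exact: cvgMl.
apply: cvg_near_cst; near=> n; apply/eqP; rewrite leNgt.
have -> // : a < c_ n * W x.
by near: n; move/cvgr_gt : cw; apply.
Unshelve. all: by end_near. Qed.

Lemma cond_surv_left a c u : 0 <= a -> 0 < c ->
  (forall c', 0 < c' -> c' < c -> u <= H a c') -> u <= H a c.
Proof.
move=> a0 c0 h; pose c_ n := c - c / 2 * n.+1%:R^-1.
have c2 n : 0 < c / 2 * n.+1%:R^-1 by rewrite !mulr_gt0// invr_gt0.
have c2c n : c / 2 * n.+1%:R^-1 <= c / 2 by rewrite ler_piMr ?invf_le1 ?ler1n// divr_ge0// ltW.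
have c_0 n : 0 < c_ n by rewrite subr_gt0 (le_lt_trans (c2c n))// gtr_pMr// invf_lt1// ltr1n.
have c_c n : c_ n < c by rewrite gtrBl.
apply: (cvgr_to_ge (@cvg_H a c_ c a0 (fun n => ltW (c_0 n)) _ (fun n => ltW (c_c n)))).
  suff : c_ n @[n --> \oo] --> c - c / 2 * 0 by rewrite mulr0 subr0.
  by apply: cvgB; [exact: cvg_cst|apply: cvgMr; exact: cvg_harmonic].
by apply: nearW => n; apply: h.
Qed.

Lemma cond_surv_near0 a u : 0 < a -> u < 1 -> exists2 c, 0 < c & u <= H a c.
Proof.
move=> a0 u1.
have c1 : H a (n.+1%:R^-1) @[n --> \oo] --> (1 : R).
  suff : H a (n.+1%:R^-1) @[n --> \oo] --> expR (- (0 - 0)) * 1.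
    by rewrite subrr oppr0 expR0 mulr1.
  apply: cvgM.
    apply: (continuous_cvg _ (@continuous_expR R _)); apply: cvgN; apply: cvgB; first exact: cvg_harmonic.
    apply: (@squeeze_cvgr _ _ _ _ (fun=> 0) (fun n => n.+1%:R^-1)); [|exact: cvg_cst|exact: cvg_harmonic].
    apply: nearW => n; rewrite m_le_c ?(ltW a0)// andbT.
    by case/andP: (@m_le a n.+1%:R^-1 (ltW a0) (ltac:(by rewrite invr_ge0))).
  rewrite (_ : (fun n => _) = fun n => \int[P]_x (\1_[set x | n.+1%:R^-1 * W x <= a] x)); last first.
    by apply/funext => n; exact: gE.
  suff : \int[P]_x (\1_[set x | n.+1%:R^-1 * W x <= a] x) @[n --> \oo] --> \int[P]_x (fun=> 1) x.
    by rewrite (probability_Rintegral_cst P 1).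
  apply: (@bounded_cvg_Rintegral _ _ _ P _ _ 1) => // x.
  rewrite (_ : (fun n => _) = fun n => ((n.+1%:R^-1 * W x <= a)%R)%:R); last by apply/funext => n; exact: indE.
  have aw : 0 < a / (W x + 1) by rewrite divr_gt0// ltr_pwDr.
  apply: cvg_near_cst; near=> n; apply/eqP; rewrite (_ : _ <= a = true)//.
  rewrite (@le_trans _ _ (n.+1%:R^-1 * (W x + 1)))//; first by rewrite ler_wpM2l// lerDl.
  rewrite -ler_pdivlMr ?ltr_pwDr//; apply: ltW.
  by near: n; exact: near_infty_natSinv_lt (PosNum aw).
have [n _ /(_ n (leqnn n)) /= h] := cvgr_gt 1 c1 u u1.
by exists n.+1%:R^-1; [rewrite invr_gt0|exact: ltW].
Unshelve. all: by end_near. Qed.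

Lemma cond_surv_pinfty a u : 0 <= a -> 0 < u -> exists2 c, 0 < c & H a c < u.
Proof.
(* Since [m a c <= a], this choice makes [c - m a c] exceed [- ln u]. *)
move=> a0 u0; pose c := Num.max 1 (a - ln u + 1).
have c0 : 0 < c by rewrite lt_max ltr01.
exists c => //; have /andP[g0 g1] := g01 a c.
apply: (@le_lt_trans _ _ (expR (- (c - m a c)))); first by rewrite ler_piMr// expR_ge0.
rewrite -[ltRHS]lnK// ltr_expR.
have /andP[_ ma] := @m_le a c a0 (ltW c0).
have : a - ln u + 1 <= c by rewrite le_max lexx orbT.
lra.
Qed.

Let E a c := \int[expo R]_t (\1_`[a, +oo[ t * H t c).

Let expo_rayR t : 0 <= t -> fine (expo R `[t, +oo[) = expR (- t).
Proof. by move=> t0; rewrite expo_ray. Qed.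

Let mE a c : 0 < c -> measurable_fun setT (fun t => \1_`[a, +oo[%classic t * H t c).
Proof. by move=> c0; apply: measurable_funM; [exact: measurable_indic|exact: measurable_cond_surv]. Qed.

Let bE a c t : 0 < c -> `|\1_`[a, +oo[%classic t * H t c| <= 1.
Proof.
move=> c0; have /andP[h0 h1] := cond_surv01 t c0.
rewrite normrM (ger0_norm h0) indicE; case: (_ \in _); rewrite ?normr1 ?mul1r// normr0 mul0r.
exact: ler01.
Qed.

Let E_incr a a' c : 0 <= a -> a <= a' -> 0 < c ->
  (expR (- a) - expR (- a')) * H a c <= E a c - E a' c <= (expR (- a) - expR (- a')) * H a' c.
Proof.
move=> a0 aa c0.
pose I t : R := \1_`[a, +oo[%classic t - \1_`[a', +oo[%classic t.
have mI : measurable_fun setT I by apply: measurable_funB; exact: measurable_indic.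
have IE t : I t = ((a <= t) && (t < a'))%:R.
  rewrite /I !indicE !mem_setE !in_itv/= !andbT.
  have [ta|ta] := leP a' t; first by rewrite (le_trans aa ta) subrr.
  by rewrite subr0 andbT.
have bI t : `|I t| <= 1 by rewrite IE; case: (_ && _); rewrite ?normr1 ?normr0.
have EI (r : R) : \int[expo R]_t (r * I t) = (expR (- a) - expR (- a')) * r.
  rewrite (@RintegralZl _ _ _ (expo R) setT I r measurableT); last exact: (@bounded_integrable _ _ _ (expo R) _ 1 mI bI).
  rewrite (@bounded_RintegralB _ _ _ (expo R) _ _ 1).
  - rewrite (Rintegral_indic (expo R) (measurable_itv `[a, +oo[)).
    rewrite (Rintegral_indic (expo R) (measurable_itv `[a', +oo[)).
    by rewrite (expo_rayR a0) (expo_rayR (le_trans a0 aa)) [LHS]mulrC.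
  - exact: measurable_indic.
  - exact: measurable_indic.
  - by move=> t; rewrite indicE; case: (_ \in _); rewrite ?normr1 ?normr0.
  - by move=> t; rewrite indicE; case: (_ \in _); rewrite ?normr1 ?normr0.
have EE : E a c - E a' c = \int[expo R]_t (I t * H t c).
  rewrite -(@bounded_RintegralB _ _ _ (expo R) _ _ 1 (mE a c0) (mE a' c0) (fun t => bE a t c0) (fun t => bE a' t c0)).
  by apply: eq_Rintegral => t _; rewrite mulrBl.
have mIH : measurable_fun setT (fun t => I t * H t c).
  by apply: measurable_funM => //; exact: measurable_cond_surv.
have mIr (r : R) : measurable_fun setT (fun t => r * I t) by exact: measurable_funM.
have b1 t : `|I t * H t c| <= 1.
  by have /andP[h0 h1] := cond_surv01 t c0; rewrite normrM mulr_ile1// ger0_norm.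
have b2 b t : `|H b c * I t| <= 1.
  by have /andP[h0 h1] := cond_surv01 b c0; rewrite normrM mulr_ile1// ger0_norm.
rewrite EE -!EI; apply/andP; split; apply: (@le_bounded_Rintegral _ _ _ (expo R) _ _ 1) => // t; rewrite IE.
- have [ta|] := boolP ((a <= t) && (t < a')); last by rewrite mulr0 mul0r.
  by rewrite mulr1 mul1r; apply: cond_surv_mono => //; case/andP: ta.
- have [ta|] := boolP ((a <= t) && (t < a')); last by rewrite mulr0 mul0r.
  by rewrite mulr1 mul1r; apply: cond_surv_mono => //; case/andP: ta => _ /ltW.
Qed.

(** Formally both sides have the same derivative in [a], but [g] may jump. Their difference [D] is
    therefore estimated through increments, is constant by [eq_of_quadratic_increments], and
    vanishes because both sides are at most [expR (- b)] at [b]. *)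
Lemma integral_cond_surv a c : 0 <= a -> 0 < c ->
  \int[expo R]_t (\1_`[a, +oo[ t * H t c) =
  expR (- (a + c - \int[P]_x Num.min a (c * W x))).
Proof.
move=> a0 c0; rewrite -/(m a c) -/(E a c).
have expD1 (y w : R) : 0 <= y -> y - y * expR (- w) <= y * w.
  move=> y0; rewrite -{1}(mulr1 y) -mulrBr ler_wpM2l//.
  by have := expR_ge1Dx (- w); lra.
have expD2 (y w : R) : 0 <= y -> y * w <= y * expR w - y.
  move=> y0; rewrite -[X in _ - X](mulr1 y) -mulrBr ler_wpM2l//.
  by have := expR_ge1Dx w; lra.
pose A b := expR (- (c - m b c)).
pose D b := expR (- b) * A b - E b c.
suff D0 : D a = 0.
  have -> : expR (- (a + c - m a c)) = expR (- a) * A a by rewrite -expRD; congr expR; ring.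
  by apply/esym/eqP; rewrite -subr_eq0 -/(D a) D0.
have A1 b : 0 <= b -> A b <= 1.
  by move=> b0; rewrite -expR0 ler_expR oppr_le0 subr_ge0 m_le_c// ltW.
have Dc b : a <= b -> D a = D b.
  (* [g - exp(-t)] is nondecreasing and collects the variation of [g], jumps included, together with
     that of the exponential. *)
  move=> ab; apply: (@eq_of_quadratic_increments R D (fun t => g t c - expR (- t))) => // t t' at_ tt.
  have t0 : 0 <= t := le_trans a0 at_.
  have t'0 : 0 <= t' := le_trans t0 tt.
  have /andP[G1 G2] := m_incr t0 tt (ltW c0).
  have /andP[J1 J2] := E_incr t0 tt c0.
  have /andP[g0 g1] := g01 t c; have /andP[g'0 g'1] := g01 t' c.
  have AA : A t <= A t' by rewrite ler_expR lerN2 lerD2l lerN2; apply: m_mono => //; exact: ltW.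
  set dl := t' - t in G1 G2 *.
  have dl0 : 0 <= dl by rewrite subr_ge0.
  set p := expR (- t) in J1 J2 *; set p' := expR (- t') in J1 J2 *.
  have p'0 : 0 <= p' by exact: expR_ge0.
  have pp : p' <= p by rewrite ler_expR lerN2.
  have p1 : p <= 1 by rewrite -expR0 ler_expR oppr_le0.
  have p'p : p' = p * expR (- dl) by rewrite -expRD; congr expR; rewrite /dl; ring.
  have pp' : p = p' * expR dl by rewrite -expRD; congr expR; rewrite /dl; ring.
  pose Dl := dl - (m t' c - m t c).
  have e1 : p' * A t' = p * A t * expR (- Dl) by rewrite -!expRD; congr expR; rewrite /Dl /dl; ring.
  have e2 : p * A t = p' * A t' * expR Dl by rewrite -!expRD; congr expR; rewrite /Dl /dl; ring.
  have At0 : 0 <= A t by exact: expR_ge0.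
  have At'0 : 0 <= A t' by exact: expR_ge0.
  have pA0 : 0 <= p * A t := mulr_ge0 (le_trans p'0 pp) At0.
  have p'A0 : 0 <= p' * A t' := mulr_ge0 p'0 At'0.
  (* Bounds for the increments of the closed form ([q1], [q2]) and of [E] (via [q3], [q4]). Paired
     with opposite end points of [g] but the same value of [A], they differ by a term that [key]
     estimates with that value as [B]. *)
  have q1 : p * A t - p' * A t' <= p * A t * (dl * g t' c).
    by rewrite e1; exact: le_trans (expD1 _ _ pA0) (ler_wpM2l pA0 G2).
  have q2 : p' * A t' * (dl * g t c) <= p * A t - p' * A t'.
    by rewrite e2; exact: le_trans (ler_wpM2l p'A0 G1) (expD2 _ _ p'A0).
  have q3 : p - p' <= dl * p.
    by rewrite p'p [dl * _]mulrC; apply: expD1; exact: le_trans pp.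
  have q4 : dl * p' <= p - p'.
    by rewrite pp' [dl * _]mulrC; exact: expD2.
  have gg : g t c <= g t' c by exact: g_mono.
  have key B : 0 <= B -> B <= 1 -> dl * (B * (p * g t' c - p' * g t c)) <= dl * (g t' c - p' - (g t c - p)).
    by move=> B0 B1; rewrite ler_wpM2l// weighted_increment_le ?p'0 ?g0 ?B0.
  have k1 := key _ At0 (A1 _ t0); have k2 := key _ At'0 (A1 _ t'0).
  have j1 : dl * p' * (A t * g t c) <= E t c - E t' c.
    by apply: le_trans J1; rewrite (ler_wpM2r _ q4)// mulr_ge0.
  have j2 : E t c - E t' c <= dl * p * (A t' * g t' c).
    by apply: (le_trans J2); rewrite (ler_wpM2r _ q3)// mulr_ge0.
  rewrite /D -/p -/p' ler_norml; apply/andP; split.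
    rewrite lerNl [leLHS](_ : _ = p * A t - p' * A t' - (E t c - E t' c)); last by ring.
    apply: le_trans (lerB q1 j1) (le_trans _ k1).
    by rewrite le_eqVlt; apply/orP; left; apply/eqP; ring.
  rewrite [leLHS](_ : _ = E t c - E t' c - (p * A t - p' * A t')); last by ring.
  apply: le_trans (lerB j2 q2) (le_trans _ k2).
  by rewrite le_eqVlt; apply/orP; left; apply/eqP; ring.
have Db b : a <= b -> `|D a| <= 2 * expR (- b).
  move=> ab; have b0 : 0 <= b := le_trans a0 ab.
  rewrite (Dc _ ab) (le_trans (ler_normB _ _))// mulrDl mul1r lerD//.
    by rewrite ger0_norm ?mulr_ge0 ?expR_ge0// ler_piMr ?expR_ge0// A1.
  have -> : expR (- b) = \int[expo R]_t (\1_`[b, +oo[ t) by rewrite Rintegral_indic// expo_rayR.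
  have mi : measurable_fun setT (\1_`[b, +oo[%classic : R -> R) by exact: measurable_indic.
  have h0 t : 0 <= \1_`[b, +oo[%classic t * H t c.
    by rewrite mulr_ge0//; case/andP: (cond_surv01 t c0).
  rewrite ger0_norm; last by apply: Rintegral_ge0.
  apply: (@le_bounded_Rintegral _ _ _ (expo R) _ _ 1 (mE b c0) mi (fun t => bE b t c0)).
    by move=> t; rewrite indicE; case: (_ \in _); rewrite ?normr1 ?normr0.
  by move=> t; rewrite ler_piMr//; case/andP: (cond_surv01 t c0).
apply/eqP; rewrite -normr_le0 leNgt; apply/negP => D0.
pose b := Num.max a (- ln (`|D a| / 4)).
have Da4 : 0 < `|D a| / 4 by rewrite divr_gt0.
have := Db b (ltac:(by rewrite le_max lexx)).
have : expR (- b) <= `|D a| / 4.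
  by rewrite -[leRHS]lnK// ler_expR lerNl le_max lexx orbT.
lra.
Qed.

End conditional_survival.

(** * A law on the plane with prescribed distribution function *)

Section joint_law.
Context d (T : measurableType d) (R : realType) (P : probability T R) (W : T -> R).
Hypothesis mW : measurable_fun setT W.
Hypothesis W0 : forall x, 0 <= W x.
Hypothesis EW : (\int[P]_x (W x)%:E <= 1)%E.
Local Notation H := (cond_surv P W).
Local Notation expo2 := (expo R \x expo R)%E.

Let levels (z : R * R) : set R := [set y | expR (- z.2) <= H z.1 (expR (- y))].

(** A conditional quantile: [H z.1 (expR (- y))] plays the conditional distribution function in [y],
    and [expR (- z.2)] a uniform variable independent of [z.1]. *)
Let level (z : R * R) : R := inf (levels z).

(** [0 < z.1] and [expR (- z.2) < 1] make the set of levels nonempty; the complement is null under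
    [expo2]. *)
Let good : set (R * R) := [set z | 0 < z.1 /\ 0 < z.2].

(** [cond_surv_left], which is right continuity in [y], puts the infimum into the set of levels. *)
Let level_le z y : good z -> (level z <= y) = (expR (- z.2) <= H z.1 (expR (- y))).
Proof.
move=> [z1 z2].
have u0 : 0 < expR (- z.2) by exact: expR_gt0.
have u1 : expR (- z.2) < 1 by rewrite expR_lt1 oppr_lt0.
have up y1 y2 : levels z y1 -> y1 <= y2 -> levels z y2.
  move=> h yy; rewrite /levels /= (le_trans h)//.
  by apply: cond_surv_anti => //; [exact: ltW|exact: expR_gt0|rewrite ler_expR lerN2].
have hinf : has_inf (levels z).
  split.
    have [c c0 hc] := cond_surv_near0 mW W0 EW z1 u1.
    by exists (- ln c); rewrite /levels /= opprK lnK.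
  have [c c0 hc] : exists2 c, 0 < c & H z.1 c < expR (- z.2).
    by apply: cond_surv_pinfty => //; exact: ltW.
  exists (- ln c) => y' hy'; rewrite leNgt; apply/negP => yc.
  have := le_lt_trans hy' (le_lt_trans _ hc); rewrite ltxx => /(_ _)/negP; apply; last by [].
  apply: cond_surv_anti => //; [exact: ltW|].
  by rewrite -[leLHS]lnK// ler_expR lerNr ltW.
apply/idP/idP => [ly|]; last by move=> h; apply: ge_inf => //; case: hinf.
apply: cond_surv_left => //; [exact: ltW|exact: expR_gt0|move=> c' c'0 c'c].
have yc : y < - ln c' by rewrite ltrNr -ltr_expR lnK.
have [t ht tc] : exists2 t, levels z t & t < - ln c'.
  have e0 : 0 < - ln c' - y by rewrite subr_gt0.
  have [t ht tl] := inf_adherent e0 hinf.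
  by exists t => //; rewrite (lt_le_trans tl)// -/(level z); move: ly; lra.
have := up _ _ ht (ltW tc); by rewrite /levels /= opprK lnK.
Qed.

Let mgood : measurable good.
Proof.
have -> : good = `]0, +oo[%classic `*` `]0, +oo[%classic.
  by apply/predeqP => z; rewrite /good /setX /= !in_itv/= !andbT.
exact: measurableX.
Qed.

Let mlevels y : measurable [set z : R * R | expR (- z.2) <= H z.1 (expR (- y))].
Proof.
have m1 : measurable_fun setT (fun z : R * R => H z.1 (expR (- y)) - expR (- z.2)).
  apply: measurable_funB.
    by apply: (measurableT_comp (measurable_cond_surv mW W0 EW (expR_gt0 _))).
  by apply: measurableT_comp => //; exact: (measurable_funN measurable_snd).
have := m1 measurableT _ (measurable_itv `[0, +oo[).
by congr (measurable _); apply/predeqP => z /=; rewrite in_itv/= andbT subr_ge0; split=> [[]|].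
Qed.

Let pairT (z : R * R) : R * R :=
  (- ln z.1, if z \in good then level z else 0).

Let mpairT : measurable_fun setT pairT.
Proof.
apply/measurable_fun_pairP; split.
  by apply: measurable_funN; apply: (measurableT_comp (@measurable_ln R)).
(* The sign turns the lower rays described by [level_le] into the generating rays [[r, +oo[]. *)
rewrite -[X in measurable_fun _ X]opprK.
apply: measurable_funN.
apply: (measurability _ (@RGenCInfty.measurableE R)) => _ [_ [r ->] <-].
rewrite setTI.
have -> : (fun z => - (pairT z).2) @^-1` `[r, +oo[ =
   (good `&` [set z : R * R | expR (- z.2) <= H z.1 (expR (- - r))]) `|`
   (~` good `&` [set _ | 0 <= - r]).
  apply/predeqP => z /=; rewrite in_itv/= andbT lerNr.
  have [zg|zg] := boolP (z \in good).
    have zg' : good z by rewrite inE in zg.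
    rewrite level_le//; split=> [h|[[]|[]]//]; by left.
  have zg' : ~ good z by rewrite notin_setE in zg.
  split=> [h|[[]|[]]//]; by right.
apply: measurableU; apply: measurableI => //.
- exact: measurableC.
- have [h|h] := boolP (0 <= - r).
    by rewrite (_ : [set _ | _] = setT)//; apply/predeqP.
  by rewrite (_ : [set _ | _] = set0)//; apply/predeqP.
Qed.

Let pairM : {mfun (R * R)%type >-> (R * R)%type} := HB.pack pairT (isMeasurableFun.Build _ _ _ _ pairT mpairT).

Let expo_le0 : expo R `]-oo, 0] = 0%E.
Proof.
pose A : set R := `]-oo, 0[%classic.
pose B : set R := [set 0].
have -> : `]-oo, 0]%classic = A `|` B :> set R.
  apply/predeqP => z; rewrite /A /B /= !in_itv/= le_eqVlt.
  by split=> [/orP[/eqP|]|[->|->]]; [right|left|rewrite orbT|rewrite eqxx].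
have mA : measurable A by exact: measurable_itv.
have mB : measurable B by exact: measurable_set1.
have e1 : expo R B = 0%E.
  rewrite /expo /exponential_prob; apply: null_set_integral => //.
    by apply/measurable_EFinP; apply: measurable_funTS; exact: measurable_exponential_pdf.
  exact: lebesgue_measure_set1.
have l1 := @measureU2 _ _ _ (expo R) _ _ mA mB.
have l2 : (expo R (A `|` B) <= 0)%E.
  by apply: (le_trans l1); rewrite [X in (_ + X)%E]e1 adde0 -(expo_lt0 R).
by apply/eqP; rewrite eq_le l2 measure_ge0.
Qed.

Let good_null : expo2 (~` good) = 0%E.
Proof.
pose C : set R := `]-oo, 0]%classic.
pose C1 := C `*` [set: R].
pose C2 := [set: R] `*` C.
have mC : measurable C by exact: measurable_itv.
have m1 : measurable C1 by exact: measurableX.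
have m2 : measurable C2 by exact: measurableX.
have C0 : expo R C = 0%E by exact: expo_le0.
have l1 : (expo2 (~` good) <= 0)%E.
  apply: (@le_trans _ _ (expo2 (C1 `|` C2))).
    apply: (@le_measure _ _ _ expo2); rewrite ?inE; [exact: measurableC|exact: measurableU|].
    move=> z /= /not_andP[] /negP; rewrite -leNgt => z0; [left|right];
      by rewrite /C1 /C2 /C /setX /= in_itv/=.
  apply: (le_trans (@measureU2 _ _ _ expo2 _ _ m1 m2)).
  have e1 : expo2 C1 = 0%E.
    apply: etrans (@product_measure1E _ _ _ _ _ (expo R) (expo R) _ _ mC measurableT) _.
    by rewrite [X in (X * _)%E]C0 mul0e.
  have e2 : expo2 C2 = 0%E.
    apply: etrans (@product_measure1E _ _ _ _ _ (expo R) (expo R) _ _ measurableT mC) _.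
    by rewrite [X in (_ * X)%E]C0 mule0.
  by rewrite [X in (X + _)%E]e1 [X in (_ + X)%E]e2 adde0.
by apply/eqP; rewrite eq_le l1 (@measure_ge0 _ _ _ expo2).
Qed.

Let expo_exp_le (h : R) : 0 <= h <= 1 -> expo R [set v | expR (- v) <= h] = h%:E.
Proof.
move=> /andP[]; rewrite le_eqVlt => /predU1P[<- _|h0 h1].
  rewrite (_ : [set v | _] = set0) ?measure0//.
  by apply/predeqP => v; split => //=; rewrite leNgt expR_gt0.
have -> : [set v | expR (- v) <= h] = `[- ln h, +oo[%classic :> set R.
  by apply/predeqP => v /=; rewrite in_itv/= andbT -{1}(lnK h0) ler_expR lerNl.
by rewrite expo_ray ?oppr_ge0 ?ln_le0// opprK lnK.
Qed.

(** Up to a null set the preimage of a quadrant is [B]. Integrating out the second exponential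
    variable leaves [H], and [integral_cond_surv] evaluates the integral over the first. *)
Lemma joint_law_exists : exists mu : probability (R * R)%type R, forall x y,
  mu (`]-oo, x] `*` `]-oo, y]) =
  (expR (- (expR (- x) + expR (- y) - \int[P]_t Num.min (expR (- x)) (expR (- y) * W t))))%:E.
Proof.
exists (distribution expo2 pairM) => x y.
pose a := expR (- x); pose c := expR (- y).
have c0 : 0 < c by exact: expR_gt0.
have a0 : 0 < a by exact: expR_gt0.
pose B : set (R * R) := [set z | a <= z.1 /\ expR (- z.2) <= H z.1 c].
have mB : measurable B.
  have -> : B = fst @^-1` `[a, +oo[ `&` [set z | expR (- z.2) <= H z.1 c].
    by apply/predeqP => z; rewrite /B /= in_itv/= andbT.
  by apply: measurableI; [rewrite -[X in measurable X]setTI; exact: measurable_fst|exact: mlevels].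
have mI : measurable_fun setT (fun z : R * R => (\1_B z)%:E : \bar R).
  by apply/measurable_EFinP; exact: measurable_indic.
have E1 : distribution expo2 pairM (`]-oo, x] `*` `]-oo, y]) = expo2 B.
  rewrite /distribution /pushforward.
  set A := pairM @^-1` _.
  have mA : measurable A.
    by rewrite -[X in measurable X]setTI; apply: mpairT => //; exact: measurableX.
  have AB : A `&` good = B `&` good.
    apply/predeqP => z; split=> -[h zg]; split=> //; move: h; rewrite /A /B /setX /= /pairT /= !in_itv/= mem_set// level_le//.
      by move=> [h1 h2]; split => //; rewrite /a -[leRHS]lnK ?posrE//; [rewrite ler_expR lerNl|case: zg].
    by move=> [h1 h2]; split => //; rewrite lerNl -ler_expR lnK//; case: zg.
  have S C : measurable C -> expo2 C = expo2 (C `&` good).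
    move=> mC; rewrite -{1}(setIT C) -(setUv good) setIUr.
    have n0 : expo2 (C `&` ~` good) = 0%E.
      apply/eqP; rewrite eq_le (@measure_ge0 _ _ _ expo2) andbT -good_null.
      by apply: (@le_measure _ _ _ expo2); rewrite ?inE; [apply: measurableI => //; exact: measurableC|exact: measurableC|exact: subIsetr].
    rewrite (@measureU _ _ _ expo2).
    - by rewrite [X in (_ + X)%E]n0 adde0.
    - exact: measurableI.
    - by apply: measurableI => //; exact: measurableC.
    - by rewrite setIACA setICr setI0.
  by apply: etrans (S A mA) _; rewrite AB; exact: esym (S B mB).
have E2 : expo2 B = (\int[expo R]_t \int[expo R]_v (\1_B (t, v))%:E)%E.
  transitivity (\int[expo2]_z (\1_B z)%:E)%E; first exact/esym/integral_indicT.
  exact: (@fubini_tonelli1 _ _ _ _ _ (expo R) (expo R) _ mI (fun z => ler0n _ _)).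
apply: etrans E1 _; apply: etrans E2 _.
have inner t : (\int[expo R]_v (\1_B (t, v))%:E = (\1_`[a, +oo[ t * H t c)%:E)%E.
  rewrite indicE mem_setE in_itv/= andbT; have [at_|ta] := leP a t; last first.
    rewrite mul0r -[RHS](integral0 (expo R) setT); apply: eq_integral => v _.
    by rewrite indicE memNset// => -[/= +]; rewrite leNgt ta.
  rewrite mul1r -(expo_exp_le (cond_surv01 mW W0 EW t c0)).
  have mv : measurable [set v : R | expR (- v) <= H t c].
    have me : measurable_fun setT (fun v : R => expR (- v)) by apply: measurableT_comp => //; exact: measurable_funN.
    have := me measurableT _ (measurable_itv `]-oo, H t c]).
    by congr (measurable _); apply/predeqP => v /=; rewrite in_itv/=; split=> [[]|].
  rewrite -(integral_indicT (expo R) mv); apply: eq_integral => v _.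
  rewrite !indicE; congr (_%:R)%:E; congr nat_of_bool.
  by apply/idP/idP; rewrite !inE /B /=; [case|].
rewrite (eq_integral _ _ (fun t _ => inner t)).
have <- := integral_cond_surv mW W0 EW (ltW a0) c0.
rewrite /Rintegral fineK//; apply: integrable_fin_num => //.
apply: (@bounded_integrable _ _ _ (expo R) _ 1).
  by apply: measurable_funM; [exact: measurable_indic|exact: measurable_cond_surv].
move=> t; have /andP[h0 h1] := cond_surv01 mW W0 EW t c0.
rewrite normrM (ger0_norm h0) indicE; case: (_ \in _); rewrite ?normr1 ?mul1r// normr0 mul0r.
exact: ler01.
Qed.

End joint_law.

Section F_is_distribution_function.
Context (R : realType).
Local Notation N := (gauss R).

(** The likelihood ratio has mean 1 at finite [l] and 0 at l = oo, so its mean under any mixture is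
    at most 1. *)
Theorem F_df (nu : probability (extnng R) R) : exists mu : probability (R * R)%type R,
  forall x y, mu (`]-oo, x] `*` `]-oo, y]) = (F_ nu x y)%:E.
Proof.
have mW := @measurable_lognormal R.
have EW : (\int[nu \x N]_u (lognormal u.1 u.2)%:E <= 1)%E.
  have mE : measurable_fun setT (fun u : extnng R * R => (lognormal u.1 u.2)%:E).
    by apply/measurable_EFinP.
  have p0 (u : extnng R * R) : (0 <= (lognormal u.1 u.2)%:E)%E by rewrite lee_fin lognormal_ge0.
  rewrite (@fubini_tonelli1 _ _ _ _ _ nu N _ mE p0).
  apply: (@le_trans _ _ (\int[nu]_l (fun=> 1) l)%E); last first.
    by rewrite integral_cst// mul1e; exact: probability_le1.
  apply: ge0_le_integral => //.
  - by move=> l _; apply: integral_ge0 => z _.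
  - exact: (measurable_fun_fubini_tonelli_F _ mE p0).
  - move=> l _; rewrite /fubini_F /= /lognormal; case: l => -[r| |] //= r0.
    + rewrite -(gauss_expR (2 * r)); rewrite le_eqVlt; apply/orP; left; apply/eqP.
      by apply: eq_integral => z _; congr (expR _)%:E; field.
    + by rewrite integral0.
have [mu muE] := joint_law_exists mW (fun u => lognormal_ge0 _ _) EW.
by exists mu => x y; rewrite muE /F_ Rintegral_F_integrand.
Qed.

End F_is_distribution_function.

(** * Weak convergence in the plane *)

Section planar_weak_convergence.
Context (R : realType).
Implicit Types mu : probability (R * R)%type R.

Let quad x y : set (R * R) := `]-oo, x] `*` `]-oo, y].

Let mquad x y : measurable (quad x y). Proof. exact: measurableX. Qed.

Section df_convergence.
Variables (mu_ : nat -> probability (R * R)%type R) (mu : probability (R * R)%type R).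
Hypothesis dfc : forall x y, fine (mu_ n (quad x y)) @[n --> \oo] --> fine (mu (quad x y)).

(** A linear class that contains the indicators of quadrants by [dfc], hence those of half-open
    cells and the step functions built on them. *)
Let good (s : R * R -> R) := [/\ measurable_fun setT s, exists M, forall z, `|s z| <= M &
  \int[mu_ n]_z s z @[n --> \oo] --> \int[mu]_z s z].

Let goodD s t : good s -> good t -> good (fun z => s z + t z).
Proof.
move=> [ms [M sM] cs] [mt [M' tM] ct].
have sM' z : `|s z| <= M + M'.
  by rewrite (le_trans (sM z))// lerDl (le_trans _ (tM z)).
have tM' z : `|t z| <= M + M'.
  by rewrite (le_trans (tM z))// lerDr (le_trans _ (sM z)).
split; first exact: measurable_funD.
  by exists (M + M') => z; rewrite (le_trans (ler_normD _ _))// lerD.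
rewrite (@bounded_RintegralD _ _ _ mu _ _ (M + M'))//.
rewrite (_ : (fun n => _) = fun n => \int[mu_ n]_z s z + \int[mu_ n]_z t z); first exact: cvgD.
by apply/funext => n; rewrite (@bounded_RintegralD _ _ _ (mu_ n) _ _ (M + M')).
Qed.

Let goodZ a s : good s -> good (fun z => a * s z).
Proof.
move=> [ms [M sM] cs].
have E (P : probability (R * R)%type R) : \int[P]_z (a * s z) = a * \int[P]_z s z.
  apply: (@RintegralZl _ _ _ P setT s a measurableT).
  exact: (@bounded_integrable _ _ _ P _ M ms sM).
split; first exact: measurable_funM.
  by exists (`|a| * M) => z; rewrite normrM ler_wpM2l.
rewrite E (_ : (fun n => _) = fun n => a * \int[mu_ n]_z s z); first exact: cvgMr.
by apply/funext => n; rewrite E.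
Qed.

Let good0 : good (fun=> 0).
Proof.
split=> //; first by exists 0 => _; rewrite normr0.
rewrite (probability_Rintegral_cst mu 0) (_ : (fun n => _) = fun=> 0); first exact: cvg_cst.
by apply/funext => n; rewrite (probability_Rintegral_cst (mu_ n) 0).
Qed.

Let good_sum m (s : 'I_m -> R * R -> R) : (forall i, good (s i)) -> good (fun z => \sum_(i < m) s i z).
Proof.
elim: m s => [|m ih] s gs.
  by under eq_fun do rewrite big_ord0.
under eq_fun do rewrite big_ord_recr.
by apply: goodD => //; exact: ih.
Qed.

Let leb1 (x t : R) : R := ((t <= x)%R)%:R.

Let good_quad x y : good (fun z => leb1 x z.1 * leb1 y z.2).
Proof.
have -> : (fun z => leb1 x z.1 * leb1 y z.2) = \1_(quad x y) :> (R * R -> R).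
  apply/funext => z; rewrite indicE /leb1 -natrM mulnb; congr (nat_of_bool _)%:R.
  by apply/idP/idP; rewrite inE /quad /setX /= !in_itv/= => /andP.
split; first exact: measurable_indic.
  by exists 1 => z; rewrite indicE; case: (_ \in _); rewrite ?normr1 ?normr0.
rewrite (Rintegral_indic mu (mquad x y)) (_ : (fun n => _) = fun n => fine (mu_ n (quad x y))); first exact: dfc.
by apply/funext => n; exact: (Rintegral_indic (mu_ n) (mquad x y)).
Qed.

Let cell (a b c e : R) (z : R * R) : R :=
  (leb1 b z.1 - leb1 a z.1) * (leb1 e z.2 - leb1 c z.2).

Let good_cell a b c e : good (cell a b c e).
Proof.
have -> : cell a b c e = fun z => (leb1 b z.1 * leb1 e z.2 + (-1) * (leb1 a z.1 * leb1 e z.2)) +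
  ((-1) * (leb1 b z.1 * leb1 c z.2) + leb1 a z.1 * leb1 c z.2).
  by apply/funext => z; rewrite /cell; ring.
by apply: goodD; apply: goodD => //; apply: goodZ.
Qed.

Let leb1B a b t : a <= b -> leb1 b t - leb1 a t = ((a < t) && (t <= b))%:R.
Proof.
move=> ab; rewrite /leb1; have [ta|ta] := leP t a; first by rewrite (le_trans ta ab) subrr.
by rewrite subr0.
Qed.

Let tight eps : 0 < eps -> exists2 K, 0 < K & 1 - eps <= \int[mu]_z cell (- K) K (- K) K z.
Proof.
move=> eps0.
have c1 : \int[mu]_z cell (- n.+1%:R) n.+1%:R (- n.+1%:R) n.+1%:R z @[n --> \oo] --> (1 : R).
  suff : \int[mu]_z cell (- n.+1%:R) n.+1%:R (- n.+1%:R) n.+1%:R z @[n --> \oo] --> \int[mu]_z (fun=> 1) z.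
    by rewrite (probability_Rintegral_cst mu 1).
  apply: (@bounded_cvg_Rintegral _ _ _ mu _ _ 1).
  - by move=> n; case: (good_cell (- n.+1%:R) n.+1%:R (- n.+1%:R) n.+1%:R).
  - move=> z; apply: cvg_near_cst; near=> n; apply/eqP.
    have zn : `|z.1| + `|z.2| < n.+1%:R.
      rewrite (@lt_le_trans _ _ n%:R) ?ler_nat//.
      by near: n; exact: nbhs_infty_gtr.
    have z1 : `|z.1| < n.+1%:R by rewrite (le_lt_trans _ zn)// lerDl.
    have z2 : `|z.2| < n.+1%:R by rewrite (le_lt_trans _ zn)// lerDr.
    move: z1 z2; rewrite !ltr_norml => /andP[a1 a2] /andP[a3 a4].
    by rewrite /cell !leb1B ?ge0_cp// a1 a3 !ltW//= mulr1.
  - move=> n z; rewrite /cell !leb1B ?ge0_cp//.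
    by case: (_ && _); case: (_ && _); rewrite ?mulr1 ?mulr0 ?mul0r ?normr1 ?normr0.
have [n _ /(_ n (leqnn n)) /= h] := cvgr_ge 1 c1 (1 - eps) (ltac:(by rewrite ltrBlDr ltrDl)).
by exists n.+1%:R.
Unshelve. all: by end_near. Qed.

(** On a large square [f] is uniformly close to a step function on small cells, whose integrals
    converge. Outside, [f] is bounded and the mass is small: for the limit by tightness, and for
    late terms because the mass of the square converges. *)
Lemma df_weak_cvg : weak_cvg mu_ mu.
Proof.
move=> f cf [M0 [_ fM0]]; pose M := `|M0| + 1.
have M0' : 0 < M by rewrite ltr_wpDl.
have fM z : `|f z| <= M.
  by apply: (fM0 M) => //; rewrite (le_lt_trans (ler_norm _))// ltrDl.
have mf : measurable_fun setT f by exact: continuous_measurable_pair.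
apply/cvgrPdist_lt => eps eps0.
(* Step approximation, mass outside the square and convergence of the step integrals add up to at
   most [3 eta + 3 M eta]. *)
pose eta := eps / (8 * (M + 1)).
have eta0 : 0 < eta by rewrite divr_gt0// mulr_gt0// ltr_wpDl// ltW.
have [K K0 tK] := tight eta0.
have cK : compact (`[-K, K]%classic `*` `[-K, K]%classic : set (R * R)).
  by apply: compact_setX; exact: segment_compact.
have [dl dl0 Hdl] := heine_cantor cK (continuous_subspaceT cf) eta0.
have [m h_lt] : exists m : nat, 2 * K / m.+1%:R < dl.
  have [n _ /(_ n (leqnn n)) /= h] := nbhs_infty_gtr (2 * K / dl).
  exists n; rewrite ltr_pdivrMr// [dl * _]mulrC -ltr_pdivrMr//.
  by rewrite (lt_le_trans h)// ler_nat.
pose N := m.+1; pose h := 2 * K / N%:R.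
have h0 : 0 < h by rewrite divr_gt0// mulr_gt0.
pose t (i : nat) : R := - K + i%:R * h.
have tS i : t i <= t i.+1 by rewrite lerD2l ler_wpM2r ?(ltW h0)// ler_nat.
have t0 : t 0%N = - K by rewrite /t mul0r addr0.
have tN : t N = K by rewrite /t /h mulrC divfK ?pnatr_eq0//; ring.
have tK' i : (i <= N)%N -> -K <= t i <= K.
  move=> iN; rewrite {1}/t lerDl mulr_ge0 ?(ltW h0)//=.
  have : t i <= t N by rewrite /t lerD2l ler_wpM2r ?(ltW h0)// ler_nat.
  by rewrite tN.
pose b (i j : nat) z := cell (t i) (t i.+1) (t j) (t j.+1) z.
have b0 i j z : 0 <= b i j z by rewrite /b /cell !leb1B// mulr_ge0.
pose s z := \sum_(i < N) \sum_(j < N) f (t i, t j) * b i j z.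
have gs : good s by apply: good_sum => i; apply: good_sum => j; apply: goodZ; exact: good_cell.
pose chi z := cell (- K) K (- K) K z.
have gchi : good chi by exact: good_cell.
have chiE z : chi z = \sum_(i < N) \sum_(j < N) b i j z.
  have tel (x : R) k : \sum_(i < k) (leb1 (t i.+1) x - leb1 (t i) x) = leb1 (t k) x - leb1 (t 0%N) x.
    elim: k => [|k ih]; first by rewrite big_ord0 subrr.
    by rewrite big_ord_recr /= ih; ring.
  under eq_bigr do rewrite /b /cell -mulr_sumr tel.
  by rewrite -mulr_suml tel t0 tN.
have chi01 z : 0 <= chi z <= 1.
  rewrite /chi /cell !leb1B ?ge0_cp ?(ltW K0)//.
  by case: (- K < z.1 <= K); case: (- K < z.2 <= K); rewrite ?mulr1 ?mulr0 ?lexx ?ler01.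
have fs z : `|f z - s z| <= eta + M * (1 - chi z).
  have -> : f z - s z = f z * (1 - chi z) + \sum_(i < N) \sum_(j < N) (f z - f (t i, t j)) * b i j z.
    rewrite /s chiE mulrBr mulr1 mulr_sumr -addrA; congr (_ + _).
    rewrite -!sumrN -big_split; apply: eq_bigr => i _ /=.
    rewrite mulr_sumr -!sumrN -big_split; apply: eq_bigr => j _ /=; ring.
  rewrite (le_trans (ler_normD _ _))// addrC lerD//; last first.
    by rewrite normrM (ger0_norm (_ : 0 <= 1 - chi z)) ?ler_wpM2r// subr_ge0; case/andP: (chi01 z).
  apply: (@le_trans _ _ (\sum_(i < N) \sum_(j < N) eta * b i j z)).
    apply: le_trans (ler_norm_sum _ _ _) _; apply: ler_sum => i _.
    apply: le_trans (ler_norm_sum _ _ _) _; apply: ler_sum => j _.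
    rewrite normrM (ger0_norm (b0 _ _ _)).
    have [bz|bz] := eqVneq (b i j z) 0; first by rewrite bz !mulr0.
    rewrite ler_wpM2r//; apply: ltW; rewrite distrC.
    move: bz; rewrite /b /cell !leb1B//.
    have [/andP[x1 x2]|] := boolP ((t i < z.1) && (z.1 <= t i.+1)); last by rewrite mul0r eqxx.
    have [/andP[y1 y2] _|] := boolP ((t j < z.2) && (z.2 <= t j.+1)); last by rewrite mulr0 eqxx.
    have tSE k : t k.+1 = t k + h by rewrite /t -natr1; ring.
    have near_t u k : (k < N)%N -> t k < u -> u <= t k.+1 -> -K <= u <= K /\ `|t k - u| < dl.
      move=> kN tu ut; have /andP[k1 k2] := tK' _ (ltnW kN); have /andP[k3 k4] := tK' _ kN.
      split; first by rewrite (le_trans k1 (ltW tu)) (le_trans ut k4).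
      rewrite distrC ger0_norm ?subr_ge0 ?(ltW tu)// ltrBlDl.
      by apply: le_lt_trans ut _; rewrite tSE ltrD2l; exact: h_lt.
    have [zx dx] := near_t _ _ (ltn_ord i) x1 x2; have [zy dy] := near_t _ _ (ltn_ord j) y1 y2.
    by apply: Hdl; split; rewrite /= ?in_itv//=; apply: tK'; apply: ltnW.
  under eq_bigr do rewrite -mulr_sumr.
  by rewrite -mulr_sumr -chiE ler_piMr ?(ltW eta0)//; case/andP: (chi01 z).
have [ms [Ms sM] cs] := gs; have [mchi _ cchi] := gchi.
have chib z : `|1 - chi z| <= 1 by have := chi01 z; rewrite ler_norml; lra.
have bd (P : probability (R * R)%type R) :
    `|\int[P]_z f z - \int[P]_z s z| <= eta + M * (1 - \int[P]_z chi z).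
  have fb z : `|f z| <= M + Ms by rewrite (le_trans (fM z))// lerDl (le_trans _ (sM z)).
  have sb z : `|s z| <= M + Ms by rewrite (le_trans (sM z))// lerDr ltW.
  rewrite -(@bounded_RintegralB _ _ _ P f s (M + Ms) mf ms fb sb).
  have mfs : measurable_fun setT (fun z => f z - s z) by exact: measurable_funB.
  have m1 : measurable_fun setT (fun z => 1 - chi z) by exact: measurable_funB.
  have m2 : measurable_fun setT (fun z => eta + M * (1 - chi z)).
    by apply: measurable_funD => //; exact: measurable_funM.
  have ub z : eta + M * (1 - chi z) <= eta + M.
    by rewrite lerD2l ler_piMr ?(ltW M0')// gerBl; case/andP: (chi01 z).
  have fsb z : `|f z - s z| <= eta + M by exact: le_trans (fs z) (ub z).
  have g0 z : 0 <= eta + M * (1 - chi z).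
    by rewrite addr_ge0 ?(ltW eta0)// mulr_ge0 ?(ltW M0')// subr_ge0; case/andP: (chi01 z).
  have gb z : `|eta + M * (1 - chi z)| <= eta + M by rewrite ger0_norm.
  have E : \int[P]_z (eta + M * (1 - chi z)) = eta + M * (1 - \int[P]_z chi z).
    rewrite (@bounded_RintegralD _ _ _ P (fun=> eta) _ (eta + M)).
    - rewrite (probability_Rintegral_cst P eta); congr (_ + _).
      rewrite (@RintegralZl _ _ _ P setT (fun z => 1 - chi z) M measurableT); last first.
        exact: (@bounded_integrable _ _ _ P _ 1 m1 chib).
      rewrite (@bounded_RintegralB _ _ _ P (fun=> 1) _ 1)//.
      + by rewrite (probability_Rintegral_cst P 1).
      + by move=> _; rewrite normr1.
      + by move=> z; have := chi01 z; rewrite ler_norml; lra.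
    - by [].
    - exact: measurable_funM.
    - by move=> _; rewrite ger0_norm ?(ltW eta0)// lerDl ltW.
    - move=> z; rewrite normrM (ger0_norm (ltW M0')) (@le_trans _ _ M)//; last by rewrite lerDr ltW.
      by rewrite ler_piMr ?(ltW M0').
  rewrite -E ler_norml; apply/andP; split.
    rewrite -[leLHS]mulN1r -(@RintegralZl _ _ _ P setT _ (-1) measurableT); last first.
      exact: (@bounded_integrable _ _ _ P _ (eta + M) m2 gb).
    apply: (@le_bounded_Rintegral _ _ _ P _ _ (eta + M)) => //.
    - exact: measurable_funM.
    - by move=> z; rewrite mulN1r normrN.
    - by move=> z; have := fs z; rewrite ler_norml mulN1r; lra.
  apply: (@le_bounded_Rintegral _ _ _ P _ _ (eta + M)) => //.
  by move=> z; have := fs z; rewrite ler_norml; lra.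
have /cvgrPdist_lt/(_ _ eta0) cs' := cs.
have /cvgrPdist_lt/(_ _ eta0) cchi' := cchi.
near=> n.
have e1 : `|\int[mu]_z s z - \int[mu_ n]_z s z| < eta by near: n.
have e2 : `|\int[mu]_z chi z - \int[mu_ n]_z chi z| < eta by near: n.
have b1 := bd mu; have b2 := bd (mu_ n).
have k1 : 1 - \int[mu]_z chi z <= eta by move: tK; rewrite -/chi; move: (\int[mu]_z chi z) => *; lra.
have k2 : 1 - \int[mu_ n]_z chi z <= 2 * eta 
  by move: e2 k1; rewrite ltr_norml; move: (\int[mu]_z chi z) (\int[_]_z chi z) => *; lra.
have k3 : M * (1 - \int[mu]_z chi z) <= M * eta by rewrite ler_wpM2l// ltW.
have k4 : M * (1 - \int[mu_ n]_z chi z) <= M * (2 * eta) by rewrite ler_wpM2l// ltW.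
have etaE : eta * (8 * (M + 1)) = eps by rewrite divfK// gt_eqF// mulr_gt0// ltr_wpDl// ltW.
have Me : 0 < M * eta by rewrite mulr_gt0.
set A := \int[mu]_z f z in b1 *; set B := \int[mu_ n]_z f z in b2 *.
set A' := \int[mu]_z s z in b1 e1; set B' := \int[mu_ n]_z s z in b2 e1.
rewrite (_ : A - B = (A - A') + (A' - B') - (B - B')); last by ring.
apply: le_lt_trans (ler_normB _ _) _.
apply: (@le_lt_trans _ _ (`|A - A'| + `|A' - B'| + `|B - B'|)); first by rewrite lerD2r ler_normD.
by move: b1 b2 e1 k3 k4 Me eta0; rewrite -etaE; move: (`|_|) (`|_|) (`|_|) (M * (_ - _)) (M * (_ - _)) => *; lra.
Unshelve. all: by end_near. Qed.

End df_convergence.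

Let clamp (x : R) : R := Num.min 1 (Num.max 0 x).

Let clamp01 x : 0 <= clamp x <= 1.
Proof. by rewrite /clamp le_min ler01 le_max lexx/= ge_min lexx. Qed.

Let continuous_clamp : continuous clamp.
Proof.
move=> x; apply: (@continuous_min R R (cst 1) (fun x => Num.max 0 x)); first exact: cvg_cst.
by apply: (@continuous_max R R (cst 0) idfun); [exact: cvg_cst|exact: cvg_id].
Qed.

Let ramp (x y dl : R) (z : R * R) : R := clamp ((x - z.1) / dl) * clamp ((y - z.2) / dl).

Let ramp_continuous x y dl : continuous (ramp x y dl).
Proof.
move=> z; apply: cvgM.
  apply: (@continuous_comp _ _ _ (fun z : R * R => (x - z.1) / dl) clamp); last exact: continuous_clamp.
  by apply: cvgMl; apply: cvgB; [exact: cvg_cst|exact: cvg_fst].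
apply: (@continuous_comp _ _ _ (fun z : R * R => (y - z.2) / dl) clamp); last exact: continuous_clamp.
by apply: cvgMl; apply: cvgB; [exact: cvg_cst|exact: cvg_snd].
Qed.

Let ramp01 x y dl z : 0 <= ramp x y dl z <= 1.
Proof.
have /andP[a0 a1] := clamp01 ((x - z.1) / dl); have /andP[b0 b1] := clamp01 ((y - z.2) / dl).
by rewrite mulr_ge0//= mulr_ile1.
Qed.

Let ramp_bounded x y dl : [bounded ramp x y dl z | z in setT].
Proof.
exists 1; split=> // M M1 z _ /=; have /andP[a0 a1] := ramp01 x y dl z.
by rewrite ger0_norm// (le_trans a1)// ltW.
Qed.

Let ramp_le x y dl z : 0 < dl -> ramp x y dl z <= \1_(quad x y) z.
Proof.
move=> d0; rewrite indicE; have [|] := boolP (z \in quad x y).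
  by move=> _; case/andP: (ramp01 x y dl z).
rewrite notin_setE /quad /setX /= !in_itv/= => /not_andP h.
have /andP[a0 a1] := clamp01 ((x - z.1) / dl); have /andP[b0 b1] := clamp01 ((y - z.2) / dl).
have c0 u : u < 0 -> clamp (u / dl) = 0.
  by move=> u0; rewrite /clamp max_l ?min_r// pmulr_lle0 ?invr_gt0// ltW.
case: h => /negP; rewrite -ltNge -subr_lt0 => /c0 e; rewrite /ramp e ?mul0r ?mulr0//.
Qed.

Let ramp_ge x y dl z : 0 < dl -> \1_(quad x y) z <= ramp (x + dl) (y + dl) dl z.
Proof.
move=> d0; rewrite indicE; have [|] := boolP (z \in quad x y); last first.
  by move=> _; case/andP: (ramp01 (x + dl) (y + dl) dl z).
rewrite inE /quad /setX /= !in_itv/= => -[zx zy].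
have c1 u w : u <= w -> clamp ((w + dl - u) / dl) = 1.
  move=> uw; rewrite /clamp min_l// le_max; apply/orP; right.
  by rewrite ler_pdivlMr// mul1r; lra.
by rewrite /ramp !c1// mulr1.
Qed.

(** A continuous ramp fits between the indicator of a quadrant and that of the quadrant shifted by
    [dl] in both coordinates. Only diagonal shifts occur, so continuity of [G] is asked in that
    direction. The filter is general in order to include ultrafilters. *)
Lemma weak_cvg_df (F : set_system nat) {FF : ProperFilter F}
    (mu_ : nat -> probability (R * R)%type R) mu (G : R -> R -> R) :
  (forall f : R * R -> R, continuous f -> [bounded f z | z in setT] ->
    \int[mu_ n]_z f z @[n --> F] --> \int[mu]_z f z) ->
  (forall x y, fine (mu_ n (`]-oo, x] `*` `]-oo, y])) @[n --> F] --> G x y) ->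
  (forall x y, G (x + t) (y + t) @[t --> (0 : R)] --> G x y) ->
  forall x y, mu (`]-oo, x] `*` `]-oo, y]) = (G x y)%:E.
Proof.
move=> cw cdf cG x y; rewrite -/(quad x y).
have mramp a b dl : measurable_fun setT (ramp a b dl).
  by apply: continuous_measurable_pair; exact: ramp_continuous.
have rb a b dl z : `|ramp a b dl z| <= 1.
  by have /andP[? ?] := ramp01 a b dl z; rewrite ger0_norm.
have mi a b : measurable_fun setT (\1_(quad a b) : R * R -> R) by exact: measurable_indic.
have ib a b z : `|\1_(quad a b) z| <= 1 :> R.
  by rewrite indicE; case: (_ \in _); rewrite ?normr1 ?normr0.
have up (P : probability (R * R)%type R) a b dl : 0 < dl ->
    fine (P (quad a b)) <= \int[P]_z ramp (a + dl) (b + dl) dl z.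
  move=> d0; rewrite -(Rintegral_indic P (mquad a b)).
  by apply: (@le_bounded_Rintegral _ _ _ P _ _ 1) => // z; exact: ramp_ge.
have lo (P : probability (R * R)%type R) a b dl : 0 < dl ->
    \int[P]_z ramp a b dl z <= fine (P (quad a b)).
  move=> d0; rewrite -(Rintegral_indic P (mquad a b)).
  by apply: (@le_bounded_Rintegral _ _ _ P _ _ 1) => // z; exact: ramp_le.
have h1 dl : 0 < dl -> fine (mu (quad x y)) <= G (x + dl) (y + dl).
  move=> d0; rewrite (le_trans (up mu x y dl d0))//.
  apply: (ler_cvg_to (cw _ (@ramp_continuous (x + dl) (y + dl) dl) (@ramp_bounded (x + dl) (y + dl) dl)) (cdf (x + dl) (y + dl))).
  by apply: nearW => n; exact: lo.
have h2 dl : 0 < dl -> G (x + - dl) (y + - dl) <= fine (mu (quad x y)).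
  move=> d0; apply: le_trans (lo mu x y dl d0).
  apply: (ler_cvg_to (cdf (x + - dl) (y + - dl)) (cw _ (@ramp_continuous x y dl) (@ramp_bounded x y dl))).
  by apply: nearW => n; have := up (mu_ n) (x + - dl) (y + - dl) dl d0; rewrite !subrK.
suff E : fine (mu (quad x y)) = G x y.
  by rewrite -E fineK//; exact: (@probability_fin_num _ _ _ mu _ (mquad x y)).
apply/eqP; rewrite -subr_eq0 -normr_le0; apply/ler_addgt0Pr => eps eps0; rewrite add0r.
have /cvgrPdist_lt/(_ _ eps0)/nbhs_ballP[d /= d0 Hd] := cG x y.
have d2 : 0 < d / 2 by rewrite divr_gt0.
have b1 : ball (0 : R) d (d / 2) by rewrite /ball/= sub0r normrN gtr0_norm// ltr_pdivrMr// ltr_pMr// ltr1n.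
have b2 : ball (0 : R) d (- (d / 2)) by rewrite /ball/= sub0r opprK gtr0_norm// ltr_pdivrMr// ltr_pMr// ltr1n.
have := Hd _ b1; have := Hd _ b2; have := h1 _ d2; have := h2 _ d2.
rewrite !ltr_norml ler_norml => i1 i2 /andP[i3 i4] /andP[i5 i6].
by apply/andP; split; move: i1 i2 i3 i4 i5 i6; lra.
Qed.

End planar_weak_convergence.

(** * The theorem *)

Section F_continuity.
Context (R : realType).
Implicit Types nu : probability (extnng R) R.

(** Homogeneity of the exponent, the analytic form of max-stability; continuity of [F_ nu] along the
    diagonal follows from it. *)
Lemma F_integrand_shift (x y t : R) l :
  F_integrand (x + t) (y + t) l = expR (- t) * F_integrand x y l.
Proof.
rewrite /F_integrand; case: (extnng_val l) => [r| |]; last 2 first.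
- by rewrite !opprD !expRD; ring.
- by rewrite !opprD !expRD; ring.
case: eqP => _; first by rewrite -expRD; congr expR; rewrite -addr_minl opprD addrC.
rewrite (_ : y + t - (x + t) = y - x); last by ring.
rewrite (_ : x + t - (y + t) = x - y); last by ring.
by rewrite !opprD !expRD; ring.
Qed.

Lemma F_shift nu (x y t : R) :
  F_ nu (x + t) (y + t) = expR (- (expR (- t) * \int[nu]_l F_integrand x y l)).
Proof.
rewrite /F_ -(@RintegralZl _ _ _ nu setT (F_integrand x y) (expR (- t)) measurableT).
  by congr (expR (- _)); apply: eq_Rintegral => l _; exact: F_integrand_shift.
apply: (@bounded_integrable _ _ _ nu _ (expR (- x) + expR (- y))).
  exact: measurable_F_integrand.
exact: normr_F_integrand.
Qed.

Lemma cvg_F_shift nu (x y : R) : F_ nu (x + t) (y + t) @[t --> (0 : R)] --> F_ nu x y.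
Proof.
under eq_fun do rewrite F_shift.
rewrite (_ : F_ nu x y = expR (- (expR (- 0) * \int[nu]_l F_integrand x y l))); last first.
  by rewrite oppr0 expR0 mul1r.
apply: (continuous_cvg _ (@continuous_expR R _)); apply: cvgN; apply: cvgMl.
by apply: (continuous_cvg _ (@continuous_expR R _)); apply: cvgN; exact: cvg_id.
Qed.

Lemma cvg_F (U : set_system nat) {FU : Filter U} (nu_ : nat -> probability (extnng R) R) nu x y :
  \int[nu_ n]_l F_integrand x y l @[n --> U] --> \int[nu]_l F_integrand x y l ->
  F_ (nu_ n) x y @[n --> U] --> F_ nu x y.
Proof. by move=> h; apply: (continuous_cvg _ (@continuous_expR R _)); exact: cvgN. Qed.

(** If the integrals of some [f] stay [eps] away from the limit infinitely often, an ultrafilter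
    finer than [\oo] contains those indices. By compactness it has a limit measure, which equals
    [nu] by hypothesis, a contradiction. *)
Lemma ultra_weak_cvg (nu_ : nat -> probability (extnng R) R) nu :
  (forall (U : set_system nat) (nu' : probability (extnng R) R), UltraFilter U -> \oo `<=` U ->
    (forall f : extnng R -> R, continuous f -> \int[nu_ n]_l f l @[n --> U] --> \int[nu']_l f l) ->
    measure_eq nu nu') ->
  weak_cvg nu_ nu.
Proof.
move=> H f cf _; apply/cvgrPdist_lt => eps eps0; apply: contrapT => Hn.
pose D : set nat := [set n | eps <= `|\int[nu]_l f l - \int[nu_ n]_l f l|].
have PD : ProperFilter (within D \oo).
  constructor; last exact: within_filter.
  case=> m _ Dm; apply: Hn; exists m => // n mn.
  by rewrite /= ltNge; apply/negP; exact: (Dm n mn).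
have [U [UU DU]] := ultraFilterLemma PD.
have [nu' cnu'] := @extnng_compact R U UU nu_.
have UD : U D by apply: DU; exact: withinT.
have oU : \oo `<=` U by move=> A [m _ HA]; apply: DU; exists m => // n mn _; exact: HA.
have E : \int[nu']_l f l = \int[nu]_l f l.
  by congr fine; apply: eq_measure_integral => A mA _; rewrite (H U nu' UU oU cnu').
have /cvgrPdist_lt/(_ _ eps0) := cnu' f cf.
rewrite E => h.
have /filter_ex[n [/= h1]] : U (D `&` [set n | `|\int[nu]_l f l - \int[nu_ n]_l f l| < eps]).
  exact: filterI.
by rewrite ltNge h1.
Qed.

End F_continuity.

Theorem theorem2p5 (R : realType) :
  (forall (d : nat -> measure_display) (T : forall n, measurableType (d n))
      (P : forall n, probability (T n) R)
      (X : forall n, 'I_n.+1 -> {RV P n >-> (R * R)%type})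
      (rho : forall n, 'I_n.+1 -> R) (b : nat -> R),
    (forall n, mutually_independent (P n) (fun i w => X n i w)) ->
    (forall n i, bivariate_gaussian (P n) (X n i)) ->
    (forall n i, standard_normal (P n) (fun w => (X n i w).1)) ->
    (forall n i, standard_normal (P n) (fun w => (X n i w).2)) ->
    (forall n i, correlation (P n) (fun w => (X n i w).1)
                                   (fun w => (X n i w).2) = rho n i) ->
    (forall n, (0 < n)%N -> b n = n%:R * normal_pdf 0 1 (b n)) ->
    let M_ n := distribution (P n) (normalized_max (b n.+1) (X n)) in
    let nu_ n := empirical R (fun i => lambda (b n.+1) (rho n i)) in
    ((exists mu : probability (R * R)%type R, weak_cvg M_ mu) <->
     (exists nu : probability (extnng R) R, weak_cvg nu_ nu)) /\
    (forall (mu : probability (R * R)%type R) (nu : probability (extnng R) R),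
      weak_cvg M_ mu -> weak_cvg nu_ nu ->
      forall x y : R, mu (`]-oo, x] `*` `]-oo, y]) = (F_ nu x y)%:E)) /\
  (forall nu nu' : probability (extnng R) R,
    ~ measure_eq nu nu' -> F_ nu <> F_ nu') /\
  (forall (mu_ : nat -> probability (extnng R) R)
      (nu : probability (extnng R) R),
    weak_cvg mu_ nu ->
    forall x y : R, F_ (mu_ n) x y @[n --> \oo] --> F_ nu x y).
Proof.
split; last split; last 2 first.
- by move=> nu nu' nn FF; apply: nn; exact: F_inj.
- by move=> mu_ nu h x y; exact: weak_cvg_F.
move=> d T P X rho b indep gX X1 X2 Xrho bn M_ nu_.
have sub x y : fine (M_ n (`]-oo, x] `*` `]-oo, y])) - F_ (nu_ n) x y @[n --> \oo] --> (0 : R).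
  exact: (@cvg_max_df_sub R d T P X rho b).
(* Stated for every proper filter finer than [\oo]: it is applied to [\oo] itself and to
   ultrafilters. *)
have cdf (U : set_system nat) (FU : ProperFilter U) (nu : probability (extnng R) R) : \oo `<=` U ->
    (forall x y, F_ (nu_ n) x y @[n --> U] --> F_ nu x y) ->
    forall x y, fine (M_ n (`]-oo, x] `*` `]-oo, y])) @[n --> U] --> F_ nu x y.
  move=> oU cF x y; rewrite -[F_ nu x y]add0r.
  rewrite (_ : (fun n => _) = fun n => fine (M_ n (`]-oo, x] `*` `]-oo, y])) - F_ (nu_ n) x y
    + F_ (nu_ n) x y); last by apply/funext => n; rewrite subrK.
  by apply: cvgD; [apply: cvg_trans (sub x y) => A HA; exact: oU|exact: cF].
split; last first.
  move=> mu nu cM cnu; apply: (@weak_cvg_df R \oo _ M_ mu (F_ nu)).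
  - exact: cM.
  - by apply: cdf => // x y; exact: weak_cvg_F.
  - exact: cvg_F_shift.
split=> -[]; last first.
  move=> nu cnu; have [mu Hmu] := F_df nu; exists mu; apply: df_weak_cvg => x y.
  rewrite Hmu /=; apply: cdf => // x' y'; exact: weak_cvg_F.
move=> mu cM.
have lim (U : set_system nat) (nu : probability (extnng R) R) : UltraFilter U -> \oo `<=` U ->
    (forall f : extnng R -> R, continuous f -> \int[nu_ n]_l f l @[n --> U] --> \int[nu]_l f l) ->
    forall x y, mu (`]-oo, x] `*` `]-oo, y]) = (F_ nu x y)%:E.
  move=> UU oU cnu; apply: (@weak_cvg_df R U _ M_ mu (F_ nu)).
  - by move=> f cf bf; apply: cvg_trans (cM f cf bf) => A HA; exact: oU.
  - by apply: cdf => // x y; apply: cvg_F; apply: cnu; exact: continuous_F_integrand.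
  - exact: cvg_F_shift.
(* One ultrafilter supplies the candidate; [ultra_weak_cvg] then compares it with all the others. *)
have [U0 [UU0 oU0]] := @ultraFilterLemma nat \oo _.
have [nu cnu] := @extnng_compact R U0 UU0 nu_.
exists nu; apply: ultra_weak_cvg => U nu' UU oU cnu'; apply: F_inj.
apply/funext => x; apply/funext => y; apply: EFin_inj.
by rewrite -(lim U0 nu UU0 oU0 cnu) -(lim U nu' UU oU cnu').
Qed.
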